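(* Let $\gamma_c,\lambda_c,\gamma_d>0$ and $\lambda_d\in(0,2)$, and consider the hybrid system $\mathcal H_g$ defined in the context. Suppose that $\phi_c,\phi_d:E\to\mathbb R^{n\times p}$ satisfy the following. 1. There exists $\phi_M>0$ such that $|\phi_c(t,j)|_{\mathrm F}\le\phi_M$ for all $(t,j)\in E$ and $|\phi_d(t,j)|_{\mathrm F}\le\phi_M$ for all $(t,j)\in\Upsilon(E)$. 2. There exist $\Delta,\mu>0$ such that, for all $(t',j'),(t^*,j^* )\in E$ satisfying $\Delta\le(t^*-t')+(j^*-j')<\Delta+1$, $$\sum_{j=j'}^{j^*}\int_{\max\{t',t_j\}}^{\min\{t^*,t_{j+1}\}}\psi(s,j)^\top\psi(s,j)\,ds+\sum_{j=j'}^{j^*-1}\psi(t_{j+1},j+1)^\top\psi(t_{j+1},j+1)\ \ge\ \mu I,$$ where $\{t_j\}_{j=0}^{J}$ is the sequence defining $E$, $t_{J+1}:=T$, with $J:=\sup_jE$ and $T:=\sup_tE$, and $(t,j)\mapsto\psi(t,j)$ is generated by $\mathcal H_g$ (i.e. it is the $\psi$-component of the solution considered). Then, for each $\psi_0\ge0$, $q_M\ge q_m>0$ and each $\zeta\in(0,1)$, there exist $\kappa_g,\lambda_g>0$ such that each solution $\xi$ to $\mathcal H_g$ from $\xi(0,0)\in\mathcal X_0:=\{\xi\in\mathcal X_g:|\psi|_{\mathrm F}\le\psi_0\}$ satisfies $$|\xi(t,j)|_{\mathcal A_g}\le\kappa_g\,e^{-\lambda_g(t+j)}\,|\xi(0,0)|_{\mathcal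 A_g}\qquad\text{for all }(t,j)\in\operatorname{dom}\xi .$$ In particular, suitable choices are $\kappa_g:=\sqrt3\,\kappa$ and $\lambda_g:=\min\{\lambda,b\}$, where $$\kappa:=2\max\Big\{\tfrac{p_M}{p_m},\,a\rho\sqrt{\tfrac{p_M}{p_m}}\Big\},\quad \lambda:=\tfrac12\min\{\omega,b\},\quad a:=\max\Big\{\gamma_c\psi_M,\tfrac1{2\sqrt{\gamma_d}}\Big\},\quad b:=\tfrac12\min\{\lambda_c,\,-\ln(1-\lambda_d(2-\lambda_d))\},$$ $$p_m:=q_m,\quad p_M:=q_m+\frac{q_M\kappa_0^2}{2\lambda_0}+\frac{q_M\kappa_0^2e^{2\lambda_0}}{e^{2\lambda_0}-1},\quad \rho:=\sqrt{\frac{2p_M^3}{q_mp_m\zeta}\Big(\frac{2p_M}{q_m}+1\Big)},$$ $$\omega:=\tfrac12\min\Big\{\tfrac{q_m}{2p_M}(1-\zeta),\,-\ln\Big(1-\tfrac{q_m}{2p_M}(1-\zeta)\Big)\Big\},\quad \kappa_0:=\sqrt{\tfrac1{1-\sigma}},\quad \lambda_0:=-\frac{\ln(1-\sigma)}{2(\Delta+1)},$$ $$\sigma:=\frac{2\mu_0}{\big(1+\sqrt{(a_M+2)(\Delta+2)^3(a_M(\Delta+2)+1/2)}\big)^2},\quad \mu_0:=\min\Big\{\gamma_c,\tfrac1{2(\gamma_d+\psi_M^2)}\Big\}\mu,\quad a_M:=\gamma_c\psi_M^2,$$ $$\psi_M:=\psi_0+\max\Big\{\tfrac1{\lambda_c},\tfrac{\sqrt{2\lambda_d(2-\lambda_d)+16}}{\lambda_d(2-\lambda_d)}\Big\}\phi_M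 .$$
   Context: **Hybrid time domains.** A set $E\subset\mathbb R_{\ge0}\times\mathbb N$ is a hybrid time domain if for every $(T',J')\in E$ there is a nondecreasing sequence $\{t_j\}_{j=0}^{J'+1}$ with $t_0=0$ and $E\cap([0,T']\times\{0,\dots,J'\})=\bigcup_{j=0}^{J'}([t_j,t_{j+1}]\times\{j\})$. The $t_j$ ($j\ge1$) are the jump times. $\sup_tE$, $\sup_jE$ are the suprema of the $t$- and $j$-coordinates. $\Upsilon(E):=\{(t,j)\in E:(t,j+1)\in E\}$. **Solutions.** For a hybrid system $\dot\xi=F(\xi)$ on $C$, $\xi^+=G(\xi)$ on $D$, a solution is a function $\xi$ on a hybrid time domain $\operatorname{dom}\xi$ such that, for each $j$, $t\mapsto\xi(t,j)$ is locally absolutely continuous, and on each flow interval with nonempty interior $\xi(t,j)\in C$ for $t$ in the interior and $\dot\xi=F(\xi)$ for almost every $t$; and for $(t,j)\in\Upsilon(\operatorname{dom}\xi)$, $\xi(t,j)\in D$ and $\xi(t,j+1)=G(\xi(t,j))$. Solutions need not be complete. **Norms.** $|\cdot|$ is the Euclidean/induced matrix norm, $|\cdot|_{\mathrm F}$ the Frobenius norm. **Data.** $n,p,m\in\mathbb N$; $E$ is a hybrid time domain; $\phi_c,\phi_d:E\to\mathbb R^{n\times p}$, $u:E\to\mathbb R^m$; $f_c,g_d:\mathbb R^n\times\mathbb R^m\to\mathbb R^n$ continuous; $\theta\in\mathbb R^p$ a constant (unknown) vector. The plant is $\dot x=f_c(x,u)+\phi_c\theta$ during flows, $x^+=g_d(x,u)+\phi_d\theta$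 at jumps, with the same hybrid time domain as $\phi_c,\phi_d,u$. **The system $\mathcal H_g$.** State $\xi=(x,\hat\theta,\psi,\eta,\tau,k)\in\mathcal X_g:=\mathbb R^n\times\mathbb R^p\times\mathbb R^{n\times p}\times\mathbb R^n\times E$. Jump set $D_g:=\{\xi\in\mathcal X_g:(\tau,k+1)\in E\}$, flow set $C_g:=\mathrm{cl}(\mathcal X_g\setminus D_g)$. Flows ($\xi\in C_g$), with $y:=x+\eta$: $\dot x=f_c(x,u(\tau,k))+\phi_c(\tau,k)\theta$, $\dot{\hat\theta}=\gamma_c\psi^\top(y-\psi\hat\theta)$, $\dot\psi=-\lambda_c\psi+\phi_c(\tau,k)$, $\dot\eta=-\lambda_c(x+\eta)-f_c(x,u(\tau,k))$, $\dot\tau=1$, $\dot k=0$. Jumps ($\xi\in D_g$): $x^+=g_d(x,u(\tau,k))+\phi_d(\tau,k)\theta$, $\psi^+=(1-\lambda_d)\psi+\phi_d(\tau,k)$, $\eta^+=(1-\lambda_d)(x+\eta)-g_d(x,u(\tau,k))$, $y^+:=x^++\eta^+$, $\hat\theta^+=\hat\theta+\frac{\psi^{+\top}}{\gamma_d+|\psi^+|^2}(y^+-\psi^+\hat\theta)$, $\tau^+=\tau$, $k^+=k+1$. Solutions start from $\tau(0,0)=0$, $k(0,0)=0$, so $\tau(t,j)=t$, $k(t,j)=j$ and $\xi$ inherits the hybrid time domain $E$ (in general $\operatorname{dom}\xi\subset E$). **The set $\mathcal A_g$.** $\varepsilon:=x+\eta-\psi\theta$, $\mathcal A_g:=\{\xi\in\mathcal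 X_g:\hat\theta=\theta,\ \varepsilon=0\}$, and $|\xi|_{\mathcal A_g}=\sqrt{|\theta-\hat\theta|^2+|\varepsilon|^2}$. Convention: $-\ln 0=+\infty$.
   Formalization: The explicit choices of κ_g and λ_g are asserted only when σ<1 (else κ_0, λ_0 are undefined) and p_M≥1 (for small q_m, q_M the formula for ρ, not invariant under scaling of q, makes the stated bound false); existence of κ_g, λ_g is unrestricted. *)

(* Defs.v *)
From HB Require Import structures.
From mathcomp Require Import all_boot all_order all_algebra.
From mathcomp Require Import all_classical all_reals all_analysis.

Set Implicit Arguments.
Unset Strict Implicit.
Unset Printing Implicit Defensive.

Import Order.TTheory GRing.Theory Num.Theory.
Import numFieldNormedType.Exports.

Local Open Scope classical_set_scope.
Local Open Scope ring_scope.

(* Norms and the Loewner order.  The library norm on matrices is the sup norm,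
   so the Euclidean, induced and Frobenius norms are defined here. *)

Definition eucl_norm (R : realType) n (v : 'cV[R]_n) : R :=
  Num.sqrt (\sum_i v i 0 ^+ 2).

Definition frob_norm (R : realType) n p (A : 'M[R]_(n, p)) : R :=
  Num.sqrt (\sum_i \sum_j A i j ^+ 2).

Definition induced_norm (R : realType) n p (A : 'M[R]_(n, p)) : R :=
  sup [set eucl_norm (A *m v) | v in [set v | eucl_norm v <= 1]].

Definition loewner_le (R : realType) p (A B : 'M[R]_p) : Prop :=
  forall v : 'cV[R]_p, 0 <= (v^T *m (B - A) *m v) 0 0.

(* Hybrid time domains *)

Definition hybrid_time_domain (R : realType) (E : set (R * nat)) : Prop :=
  (forall z, E z -> 0 <= z.1) /\
  forall T J, E (T, J) ->
    exists t : nat -> R,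
      [/\ t 0%N = 0,
          forall j, (j <= J)%N -> t j <= t j.+1 &
          E `&` (`[0, T]%classic `*` [set j | (j <= J)%N]) =
          \bigcup_(j in [set j | (j <= J)%N])
            (`[t j, t j.+1]%classic `*` [set j])].

Definition flow_interval (R : realType) (E : set (R * nat)) (j : nat) : set R :=
  [set t | E (t, j)].

Definition Upsilon (R : realType) (E : set (R * nat)) : set (R * nat) :=
  [set z | E z /\ E (z.1, z.2.+1)].

(* The sequence (t_j) defining E: t_0 = 0, t_j is the j-th jump time (the left
   end of the j-th flow interval) for 1 <= j <= sup_j E, and t_(J+1) = sup_t E
   when J = sup_j E is finite. *)
Definition jump_time (R : realType) (E : set (R * nat)) (j : nat) : \bar R :=
  if `[< flow_interval E j !=set0 >]
  then ereal_inf [set t%:E | t in flow_interval E j]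
  else ereal_sup [set z.1%:E | z in E].

(* Solutions of hybrid systems *)

Definition loc_abs_continuous (R : realType) (V : normedModType R)
    (I : set R) (f : R -> V) : Prop :=
  forall a b : R, `[a, b]%classic `<=` I ->
  forall e : R, 0 < e -> exists2 d : R, 0 < d &
    forall N (l r : 'I_N -> R),
      (forall i, a <= l i /\ l i <= r i /\ r i <= b) ->
      trivIset setT (fun i => `]l i, r i[%classic) ->
      \sum_i (r i - l i) < d ->
      \sum_i `|f (r i) - f (l i)| < e.

(* X is the state space; xi is a total function of which only the values on dom
   are meaningful. *)
Record hybrid_solution (R : realType) (V : normedModType R) (X C D : set V)
    (F G : V -> V) (dom : set (R * nat)) (xi : R * nat -> V) : Prop := {
  sol_dom : hybrid_time_domain dom;
  sol_state : forall z, dom z -> X (xi z);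
  sol_ac : forall j,
    loc_abs_continuous (flow_interval dom j) (fun t => xi (t, j));
  sol_flow_set : forall j t,
    interior (flow_interval dom j) t -> C (xi (t, j));
  sol_flow : forall j, {ae @lebesgue_measure R, forall t,
    interior (flow_interval dom j) t ->
    is_derive t (1 : R) (fun s => xi (s, j)) (F (xi (t, j)))};
  sol_jump : forall t j, Upsilon dom (t, j) ->
    D (xi (t, j)) /\ xi (t, j.+1) = G (xi (t, j)) }.

(* The plant data.  Signals defined on E are total functions on R * nat; only
   their values on E are ever used. *)
Record plant (R : realType) (n p m : nat) := Plant {
  f_c : 'cV[R]_n -> 'cV[R]_m -> 'cV[R]_n;
  g_d : 'cV[R]_n -> 'cV[R]_m -> 'cV[R]_n;
  phi_c : R * nat -> 'M[R]_(n, p);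
  phi_d : R * nat -> 'M[R]_(n, p);
  input : R * nat -> 'cV[R]_m;
  theta : 'cV[R]_p }.

Record gains (R : realType) := Gains {
  gamma_c : R; lambda_c : R; gamma_d : R; lambda_d : R }.

(* The system H_g.  The state is (x, thetahat, psi, eta, tau, k), the counter k
   being real-valued so that the state lives in a normed space; membership in
   X_g forces k to be a natural number. *)

Definition gstate (R : realType) (n p : nat) : normedModType R :=
  ('cV[R]_n * 'cV[R]_p * 'M[R]_(n, p) * 'cV[R]_n * R * R)%type.

Definition st_x (R : realType) n p (s : gstate R n p) : 'cV[R]_n :=
  s.1.1.1.1.1.
Definition st_thetahat (R : realType) n p (s : gstate R n p) : 'cV[R]_p :=
  s.1.1.1.1.2.
Definition st_psi (R : realType) n p (s : gstate R n p) : 'M[R]_(n, p) :=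
  s.1.1.1.2.
Definition st_eta (R : realType) n p (s : gstate R n p) : 'cV[R]_n := s.1.1.2.
Definition st_tau (R : realType) n p (s : gstate R n p) : R := s.1.2.
Definition st_k (R : realType) n p (s : gstate R n p) : R := s.2.
Definition st_time (R : realType) n p (s : gstate R n p) : R * nat :=
  (st_tau s, Num.truncn (st_k s)).

Definition X_g (R : realType) n p (E : set (R * nat)) : set (gstate R n p) :=
  [set s | exists2 j : nat, st_k s = j%:R & E (st_tau s, j)].

Definition D_g (R : realType) n p (E : set (R * nat)) : set (gstate R n p) :=
  [set s | X_g E s /\ exists2 j : nat, st_k s + 1 = j%:R & E (st_tau s, j)].

Definition C_g (R : realType) n p (E : set (R * nat)) : set (gstate R n p) :=
  closure (X_g E `\` D_g E).

Definition F_g (R : realType) n p m (P : plant R n p m) (g : gains R)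
    (s : gstate R n p) : gstate R n p :=
  let x := st_x s in let thetahat := st_thetahat s in
  let psi := st_psi s in let eta := st_eta s in
  let z := st_time s in
  let y := x + eta in
  (f_c P x (input P z) + phi_c P z *m theta P,
   gamma_c g *: (psi^T *m (y - psi *m thetahat)),
   - lambda_c g *: psi + phi_c P z,
   - lambda_c g *: (x + eta) - f_c P x (input P z),
   1,
   0).

Definition G_g (R : realType) n p m (P : plant R n p m) (g : gains R)
    (s : gstate R n p) : gstate R n p :=
  let x := st_x s in let thetahat := st_thetahat s in
  let psi := st_psi s in let eta := st_eta s in
  let z := st_time s in
  let x' := g_d P x (input P z) + phi_d P z *m theta P in
  let psi' := (1 - lambda_d g) *: psi + phi_d P z in
  let eta' := (1 - lambda_d g) *: (x + eta) - g_d P x (input P z) in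
  let y' := x' + eta' in
  (x',
   thetahat + (gamma_d g + induced_norm psi' ^+ 2)^-1 *:
                (psi'^T *m (y' - psi' *m thetahat)),
   psi',
   eta',
   st_tau s,
   st_k s + 1).

(* Solutions of H_g with tau(0,0) = 0 and k(0,0) = 0 *)
Definition Hg_solution (R : realType) n p m (E : set (R * nat))
    (P : plant R n p m) (g : gains R)
    (dom : set (R * nat)) (xi : R * nat -> gstate R n p) : Prop :=
  [/\ hybrid_solution (X_g E) (C_g E) (D_g E) (F_g P g) (G_g P g) dom xi,
      st_tau (xi (0, 0%N)) = 0 &
      st_k (xi (0, 0%N)) = 0].

Definition X_0 (R : realType) n p (E : set (R * nat)) (psi0 : R) :
    set (gstate R n p) :=
  [set s | X_g E s /\ frob_norm (st_psi s) <= psi0].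

(* |xi|_(A_g) for A_g = {thetahat = theta, epsilon = 0} *)
Definition dist_Ag (R : realType) n p (theta : 'cV[R]_p) (s : gstate R n p) : R :=
  let epsilon := st_x s + st_eta s - st_psi s *m theta in
  Num.sqrt (eucl_norm (theta - st_thetahat s) ^+ 2 + eucl_norm epsilon ^+ 2).

(* Hybrid persistence of excitation of psi, with the times t_j of E.  psi is only
   generated on dom (a subset of E), so the two end points range over dom. *)

Definition mx_integral (R : realType) p (A : set R) (M : R -> 'M[R]_p) :
    'M[R]_p :=
  \matrix_(i, k) \int[@lebesgue_measure R]_(s in A) (M s i k).

Definition hybrid_gramian (R : realType) n p (E : set (R * nat))
    (psi : R * nat -> 'M[R]_(n, p)) (z' zs : R * nat) : 'M[R]_p :=
  let t := jump_time E in
  \sum_(z'.2 <= j < zs.2.+1)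
    mx_integral
      [set s : R | (maxe z'.1%:E (t j) <= s%:E <= mine zs.1%:E (t j.+1))%E]
      (fun s => (psi (s, j))^T *m psi (s, j)) +
  \sum_(z'.2 <= j < zs.2)
    (psi (fine (t j.+1), j.+1))^T *m psi (fine (t j.+1), j.+1).

Definition persistently_exciting (R : realType) n p (E dom : set (R * nat))
    (psi : R * nat -> 'M[R]_(n, p)) (Delta mu : R) : Prop :=
  forall z' zs, dom z' -> dom zs ->
    Delta <= (zs.1 - z'.1) + (zs.2%:R - z'.2%:R) < Delta + 1 ->
    loewner_le mu%:M (hybrid_gramian E psi z' zs).

Definition exp_bound (R : realType) n p m (E : set (R * nat))
    (P : plant R n p m) (g : gains R) (psi0 Delta mu kappa lambda : R) : Prop :=
  forall dom (xi : R * nat -> gstate R n p),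
    Hg_solution E P g dom xi ->
    X_0 E psi0 (xi (0, 0%N)) ->
    persistently_exciting E dom (fun z => st_psi (xi z)) Delta mu ->
    forall t j, dom (t, j) ->
      dist_Ag (theta P) (xi (t, j)) <=
        kappa * expR (- lambda * (t + j%:R)) * dist_Ag (theta P) (xi (0, 0%N)).

(* Explicit constants *)

Record bounds (R : realType) := Bounds {
  phi_M : R; Delta : R; mu : R; psi_0 : R; q_m : R; q_M : R; zeta : R }.

Definition psi_M (R : realType) (g : gains R) (c : bounds R) : R :=
  let l := lambda_d g * (2 - lambda_d g) in
  psi_0 c + Num.max (lambda_c g)^-1 (Num.sqrt (2 * l + 16) / l) * phi_M c.

Definition a_M (R : realType) (g : gains R) (c : bounds R) : R :=
  gamma_c g * psi_M g c ^+ 2.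

Definition mu_0 (R : realType) (g : gains R) (c : bounds R) : R :=
  Num.min (gamma_c g) (2 * (gamma_d g + psi_M g c ^+ 2))^-1 * mu c.

Definition sigma (R : realType) (g : gains R) (c : bounds R) : R :=
  2 * mu_0 g c /
  (1 + Num.sqrt ((a_M g c + 2) * (Delta c + 2) ^+ 3 *
                 (a_M g c * (Delta c + 2) + 2^-1))) ^+ 2.

Definition lambda_0 (R : realType) (g : gains R) (c : bounds R) : R :=
  - ln (1 - sigma g c) / (2 * (Delta c + 1)).

Definition kappa_0 (R : realType) (g : gains R) (c : bounds R) : R :=
  Num.sqrt (1 / (1 - sigma g c)).

Definition p_m (R : realType) (c : bounds R) : R := q_m c.

Definition p_M (R : realType) (g : gains R) (c : bounds R) : R :=
  let e2 := expR (2 * lambda_0 g c) in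
  q_m c + q_M c * kappa_0 g c ^+ 2 / (2 * lambda_0 g c)
        + q_M c * kappa_0 g c ^+ 2 * e2 / (e2 - 1).

Definition omega (R : realType) (g : gains R) (c : bounds R) : R :=
  let d := q_m c / (2 * p_M g c) * (1 - zeta c) in
  2^-1 * Num.min d (- ln (1 - d)).

(* Not invariant under (q_m, q_M) |-> (r q_m, r q_M), unlike p_M / p_m and
   omega. *)
Definition rho (R : realType) (g : gains R) (c : bounds R) : R :=
  Num.sqrt (2 * p_M g c ^+ 3 / (q_m c * p_m c * zeta c) *
            (2 * p_M g c / q_m c + 1)).

(* lne 0 = -oo, so that -ln 0 = +oo when lambda_d = 1 *)
Definition b_rate (R : realType) (g : gains R) : R :=
  2^-1 * fine (mine (lambda_c g)%:E
                    (- lne (1 - lambda_d g * (2 - lambda_d g))%:E)%E).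

Definition a_gain (R : realType) (g : gains R) (c : bounds R) : R :=
  Num.max (gamma_c g * psi_M g c) (2 * Num.sqrt (gamma_d g))^-1.

Definition lambda_r (R : realType) (g : gains R) (c : bounds R) : R :=
  2^-1 * Num.min (omega g c) (b_rate g).

Definition kappa_r (R : realType) (g : gains R) (c : bounds R) : R :=
  2 * Num.max (p_M g c / p_m c)
              (a_gain g c * rho g c * Num.sqrt (p_M g c / p_m c)).

Definition kappa_g (R : realType) (g : gains R) (c : bounds R) : R :=
  Num.sqrt 3 * kappa_r g c.

Definition lambda_g (R : realType) (g : gains R) (c : bounds R) : R :=
  Num.min (lambda_r g c) (b_rate g).

(* Main.v *)
(* In the coordinates [tht = theta - thetahat] and [ep = x + eta - psi theta] the
   plant maps cancel: [ep] contracts on its own at rate [b_rate], and [tht] is a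
   gradient flow of [|psi tht|^2] forced by [ep].  On a window where [psi] is
   persistently exciting, let [v] be the initial value of [tht].  The energy
   dissipated by [tht] bounds the displacement [tht - v] (Cauchy-Schwarz), hence
   also the difference between [psi tht] and [psi v]; as the Gramian makes
   [psi v] large, the dissipation is at least a fixed fraction of [|v|^2].  This
   gives [|tht|^2 <= (1 - sigma) |v|^2 + (5 / sigma) F^2] at the end of the window,
   where [F] measures the forcing, and iterating over windows yields exponential
   decay; the published constants leave room for the losses in these estimates.
   No transition matrix or converse Lyapunov function is needed.  The analytic
   input is that an absolutely continuous function whose derivative is
   nonpositive almost everywhere is nonincreasing. *)
Require Import Defs.
From HB Require Import structures.
From mathcomp Require Import all_boot all_order all_algebra.
From mathcomp Require Import all_classical all_reals all_analysis.
From mathcomp Require Import ring lra.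

Set Implicit Arguments.
Unset Strict Implicit.
Unset Printing Implicit Defensive.

Import Order.TTheory GRing.Theory Num.Theory.
Import numFieldNormedType.Exports.

Local Open Scope classical_set_scope.
Local Open Scope ring_scope.

(** * Absolutely continuous functions *)

(** The obstacle is that excitation is a statement about [psi] applied to a fixed vector, whereas
    [tht] dissipates only through [psi] applied to its current value; the gap between the two must
    be paid for by the dissipation itself. The dissipation is never integrated. It is represented by
    a potential [Z], half the difference between the square of a linear majorant of the norm of
    [tht] and the squared norm of [tht]. Every integral estimate then says that an explicit scalar
    function is monotone along flows and satisfies one inequality at jumps, and the Gramian integral
    is compared with a difference of such potentials. The Cauchy-Schwarz step becomes AM-GM with a
    weight [be] that is fixed only after the rates have been summed. Flows and jumps are treated
    alike because durations are measured by [t + j]. The explicit constants act through a few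
    inequalities: two lower bounds on the denominator of [sigma],
    [p_M / p_m >= (Delta + 1) / sigma + 2], an upper bound on [omega] in terms of [p_M / p_m], and a
    lower bound on [rho]. *)

Section AbsCont.
Context {R : realType}.
Implicit Types (f g : R -> R) (I : set R) (a b : R).

Lemma ac_subset I J f : J `<=` I -> loc_abs_continuous I f ->
  loc_abs_continuous J f.
Proof. by move=> JI h a b ab; apply: h; apply: subset_trans JI. Qed.

Lemma ac_modulus I f a b : loc_abs_continuous I f -> `[a, b]%classic `<=` I ->
  forall e, 0 < e -> exists2 d, 0 < d & forall x y,
    a <= x -> x <= y -> y <= b -> y - x < d -> `|f y - f x| < e.
Proof.
move=> hf abI e e0; have [d d0 hd] := hf a b abI e e0.
exists d => // x y ax xy yb xyd.
have := hd 1%N (fun=> x) (fun=> y).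
rewrite !big_ord1; apply => //.
by move=> i j _ _ _; rewrite !ord1.
Qed.

(** Absolute continuity yields one [d] for the tolerance 1; walking from [a] in steps of [d / 2]
    raises the bound by at most 1 per step. *)
Lemma ac_bounded I f a b : loc_abs_continuous I f -> `[a, b]%classic `<=` I ->
  exists2 M, 0 < M & forall x, a <= x <= b -> `|f x| <= M.
Proof.
move=> hf abI; have [d d0 hd] := ac_modulus hf abI ltr01.
have step k x : a <= x <= b -> x <= a + k%:R * (d / 2) ->
    `|f x| <= `|f a| + k%:R.
  elim: k x => [|k IH] x /andP[ax xb].
    by rewrite mul0r !addr0 => xa; have -> : x = a by apply/le_anti/andP.
  move=> xk; have [xs|xs] := leP x (a + k%:R * (d / 2)).
    apply: (le_trans (IH x _ xs)); first by rewrite ax xb.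
    by rewrite lerD2l ler_nat.
  set y := a + k%:R * (d / 2) in xs.
  have ay : a <= y by rewrite lerDl mulr_ge0 // divr_ge0 // ltW.
  have := IH y; rewrite ay (le_trans (ltW xs) xb) lexx => /(_ isT isT) hy.
  have : `|f x - f y| < 1.
    apply: hd => //; first exact: ltW.
    move: xk; rewrite /y -natr1; lra.
  have := ler_normD (f y) (f x - f y); rewrite addrC subrK -natr1; lra.
pose k := Num.bound ((b - a) / (d / 2)).
exists (`|f a| + k%:R + 1); first by rewrite ltr_wpDl // addr_ge0.
move=> x xab; apply: (@le_trans _ _ (`|f a| + k%:R)); last by rewrite lerDl.
apply: step => //; move: xab => /andP[ax xb].
rewrite -lerBlDl -ler_pdivrMr ?divr_gt0//.
apply: (@le_trans _ _ ((b - a) / (d / 2))).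
  by rewrite ler_pM2r ?invr_gt0 ?divr_gt0// lerB.
apply/ltW/archi_boundP; by rewrite divr_ge0 ?subr_ge0 ?(le_trans ax xb) // divr_ge0 // ltW.
Qed.

Lemma ac_lipschitz I f K :
  (forall x y, I x -> I y -> x <= y -> `|f y - f x| <= K * (y - x)) ->
  loc_abs_continuous I f.
Proof.
move=> hK a b abI e e0; exists (e / (`|K| + 1)).
  by rewrite divr_gt0 // ltr_wpDl.
move=> N l r hlr _; rewrite ltr_pdivlMr ?ltr_wpDl// => hs.
apply: le_lt_trans hs; rewrite mulr_suml; apply: ler_sum => i _.
have [al [lr rb]] := hlr i.
apply: le_trans (hK _ _ _ _ lr) _.
- by apply: abI => /=; rewrite in_itv/= al (le_trans lr rb).
- by apply: abI => /=; rewrite in_itv/= rb (le_trans al lr).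
rewrite mulrC ler_wpM2l ?subr_ge0//.
by apply: (le_trans (ler_norm K)); rewrite lerDl.
Qed.

Lemma ac_cst I (c : R) : loc_abs_continuous I (fun _ : R => c).
Proof. by apply: (@ac_lipschitz _ _ 0) => x y _ _ _; rewrite subrr normr0 mul0r. Qed.

Lemma ac_id I : loc_abs_continuous I (fun x : R => x).
Proof.
by apply: (@ac_lipschitz _ _ 1) => x y _ _ xy; rewrite mul1r ger0_norm ?subr_ge0.
Qed.

Lemma ac_add I f g : loc_abs_continuous I f -> loc_abs_continuous I g ->
  loc_abs_continuous I (fun x => f x + g x).
Proof.
move=> hf hg a b abI e e0; have e20 : 0 < e / 2 by rewrite divr_gt0.
have [d1 d10 h1] := hf a b abI _ e20; have [d2 d20 h2] := hg a b abI _ e20.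
exists (Num.min d1 d2); first by rewrite lt_min d10.
move=> N l r hlr tr; rewrite lt_min => /andP[s1 s2].
have := h1 _ _ _ hlr tr s1; have := h2 _ _ _ hlr tr s2 => u2 u1.
rewrite [e]splitr; apply: le_lt_trans (ltrD u1 u2).
rewrite -big_split/=; apply: ler_sum => i _.
by rewrite opprD addrACA; exact: ler_normD.
Qed.

Lemma ac_mul I f g : loc_abs_continuous I f -> loc_abs_continuous I g ->
  loc_abs_continuous I (fun x => f x * g x).
Proof.
move=> hf hg a b abI e e0.
have [M1 M10 b1] := ac_bounded hf abI; have [M2 M20 b2] := ac_bounded hg abI.
have e10 : 0 < e / 2 / M2 by rewrite !divr_gt0.
have e20 : 0 < e / 2 / M1 by rewrite !divr_gt0.
have [d1 d10 h1] := hf a b abI _ e10; have [d2 d20 h2] := hg a b abI _ e20.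
exists (Num.min d1 d2); first by rewrite lt_min d10.
move=> N l r hlr tr; rewrite lt_min => /andP[s1 s2].
have := h1 _ _ _ hlr tr s1; have := h2 _ _ _ hlr tr s2.
rewrite (ltr_pdivlMr _ _ M10) (ltr_pdivlMr _ _ M20) => u2 u1.
rewrite [e]splitr; apply: le_lt_trans (ltrD u1 u2).
rewrite !mulr_suml -big_split/=; apply: ler_sum => i _.
have [al [lr rb]] := hlr i.
have -> : f (r i) * g (r i) - f (l i) * g (l i) =
  (f (r i) - f (l i)) * g (l i) + (g (r i) - g (l i)) * f (r i) by ring.
apply: le_trans (ler_normD _ _) _; rewrite !normrM.
apply: lerD; rewrite ler_wpM2l//.
  by apply: b2; rewrite al (le_trans lr rb).
by apply: b1; rewrite rb (le_trans al lr).
Qed.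

Lemma ac_sum I (T : Type) (s : seq T) (F : T -> R -> R) :
  (forall i, loc_abs_continuous I (F i)) ->
  loc_abs_continuous I (fun x => \sum_(i <- s) F i x).
Proof.
move=> hF; elim: s => [|i s IH].
  have -> : (fun x => \sum_(i <- [::]) F i x) = (fun=> 0).
    by apply/funext => x; rewrite big_nil.
  exact: ac_cst.
have -> : (fun x => \sum_(j <- i :: s) F j x) =
          (fun x => F i x + \sum_(j <- s) F j x).
  by apply/funext => x; rewrite big_cons.
exact: ac_add.
Qed.

Lemma ac_bounded_derivative f (df : R -> R) a b M :
  {within `[a, b], continuous f} ->
  (forall x, x \in `]a, b[%R -> is_derive x 1 f (df x)) ->
  (forall x, x \in `]a, b[%R -> `|df x| <= M) ->
  loc_abs_continuous `[a, b]%classic f.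
Proof.
move=> cf hdf hM; apply: (@ac_lipschitz _ _ M) => x y /=.
rewrite !in_itv/= => /andP[ax xb] /andP[ay yb]; rewrite le_eqVlt => /predU1P[->|xy].
  by rewrite !subrr normr0 mulr0.
have sub z : z \in `]x, y[%R -> z \in `]a, b[%R.
  by rewrite !in_itv/= => /andP[xz zy]; rewrite (le_lt_trans ax xz) (lt_le_trans zy yb).
have cxy : {within `[x, y], continuous f}.
  apply: continuous_subspaceW cf => z /=; rewrite !in_itv/= => /andP[xz zy].
  by rewrite (le_trans ax xz) (le_trans zy yb).
have [z zxy ->] := MVT xy (fun z hz => hdf z (sub z hz)) cxy.
by rewrite normrM (gtr0_norm (_ : 0 < y - x)) ?subr_gt0// ler_pM2r ?subr_gt0// hM// sub.
Qed.

End AbsCont.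

(** * Monotonicity from the sign of an almost everywhere derivative *)

Section Monotone.
Context {R : realType}.
Implicit Types (f : R -> R) (a b : R).
Local Notation mu := (@lebesgue_measure R).

(** Used at the supremum of the points of [[a, b]] lying in [S]: a point of [S] just below it is
    carried across to a point beyond it, unless the supremum is already [b]. *)
Lemma real_induction (S : set R) a b : a <= b -> S a ->
  (forall x, a <= x <= b -> exists2 d, 0 < d & forall y z,
     a <= y -> y <= x -> x <= z -> z <= b -> x - d < y -> z < x + d ->
     S y -> S z) ->
  S b.
Proof.
move=> ab Sa step; pose T := S `&` `[a, b]%classic.
have Ta : T a by split=> //=; rewrite in_itv/= lexx ab.
have ubT : ubound T b by move=> y [_]; rewrite /= in_itv/= => /andP[].
have supT : has_sup T by split; [exists a|exists b].
have ac : a <= sup T by apply: ub_le_sup => //; exists b.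
have cb : sup T <= b by apply: ge_sup => //; exists a.
have [|d d0 hd] := step (sup T); first by rewrite ac cb.
have [y [Sy]] := sup_adherent d0 supT; rewrite /= in_itv/= => /andP[ay yb] cdy.
have yc : y <= sup T.
  by apply: ub_le_sup => //; [exists b|split=> //=; rewrite in_itv/= ay].
pose z := Num.min b (sup T + d / 2).
have cz : sup T <= z by rewrite le_min cb lerDl divr_ge0// ltW.
have zb : z <= b by rewrite ge_min lexx.
have zd : z < sup T + d.
  by apply: (@le_lt_trans _ _ (sup T + d / 2)); [rewrite ge_min lexx orbT|lra].
have Sz : S z by apply: (hd y z).
have zc : z <= sup T.
  apply: ub_le_sup; first by exists b.
  by split=> //=; rewrite in_itv/= zb (le_trans ac cz).
suff <- : z = b by [].
move: zc; rewrite /z; case: (leP b (sup T + d / 2)) => // _; lra.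
Qed.

Lemma ac_nonincreasing f a b : a <= b ->
  loc_abs_continuous `[a, b]%classic f ->
  {ae mu, forall x, x \in `]a, b[%R ->
     exists2 df : R, is_derive x (1 : R) f df & df <= 0} ->
  f b <= f a.
Proof.
move=> ab acf [A [mA A0 NA]].
suff main e : 0 < e -> f b - f a <= e * (b - a) + e.
  rewrite -subr_le0; apply/ler_addgt0Pr => e e0; rewrite add0r.
  have h0 : 0 < e / (b - a + 1) by rewrite divr_gt0// ltr_wpDl// subr_ge0.
  apply: (le_trans (main _ h0)).
  rewrite -[X in _ + X]mulr1 -mulrDr mulfVK// gt_eqF// ltr_wpDl// subr_ge0//.
move=> e0; have [d d0 hd] := acf a b (@subset_refl _ _) e e0.
(* The end points join the exceptional null set, so that a point of [[a, b]] outside [U] is interior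
   and has a nonpositive derivative. *)
pose D := A `|` [set a] `|` [set b].
have mD : measurable D by apply: measurableU => //; apply: measurableU.
have D0 : mu D = 0%E.
  apply: measure_negligible => //.
  by rewrite /D; apply: negligibleU; first (apply: negligibleU);
    apply/negligibleP => //; exact: lebesgue_measure_set1.
have Doo : (mu D < +oo)%E by rewrite D0 ltry.
have [U [oU DU Ud]] := lebesgue_regularity_outer mD Doo d0.
have mU : measurable U by exact: measurable_realfun.open_measurable.
have {Ud} Ud : (mu U < d%:E)%E.
  apply: le_lt_trans Ud; rewrite -[X in mu X](setDUK DU).
  apply: (le_trans (measureU2 _ mD (measurableD mU mD))).
  by rewrite [X in (X + _)%E]D0 add0e.
(* [P c s]: up to slope [e], the growth of [f] on [a, c] is carried by the
   disjoint intervals [s], which lie in [U].  Near a point of [U] one adds an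
   interval to [s]; near any other point the derivative is [<= 0], so that the
   slope there is [< e].  At [c = b] absolute continuity bounds the sum over [s]. *)
pose P c (s : seq (R * R)) := [/\ a <= c <= b,
   (forall q, q \in s -> [/\ a <= q.1, q.1 <= q.2 & q.2 <= c]),
   pairwise (fun q1 q2 : R * R => q2.2 <= q1.1) s,
   ((\sum_(q <- s) (q.2 - q.1))%:E <= mu (U `&` `[a, c[%classic))%E &
   f c - f a <= e * (c - a) + \sum_(q <- s) `|f q.2 - f q.1|].
have : exists s, P b s.
  apply: (@real_induction (fun c => exists s, P c s) a b ab).
    exists [::]; split=> //; first by rewrite lexx ab.
      by rewrite big_nil measure_ge0.
    by rewrite big_nil !subrr mulr0 addr0.
  move=> x /andP[ax xb].
  have ext1 y z s : y <= z -> z <= b -> f z - f y <= e * (z - y) -> P y s -> P z s.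
    move=> yz zb fzy [/andP[ay yb] hs ps ms fs]; split => //.
    - by rewrite zb (le_trans ay).
    - by move=> q /hs[h1 h2 h3]; split=> //; exact: le_trans yz.
    - apply: (le_trans ms); apply: le_measure; rewrite ?inE.
      + by apply: measurableI => //; exact: measurable_itv.
      + by apply: measurableI => //; exact: measurable_itv.
      + apply: setIS => w /=; rewrite !in_itv/= => /andP[-> wy].
        exact: lt_le_trans yz.
    have -> : f z - f a = (f z - f y) + (f y - f a) by ring.
    apply: (le_trans (lerD fzy fs)).
    have -> : e * (z - y) + (e * (y - a) + \sum_(q <- s) `|f q.2 - f q.1|) =
       e * (z - a) + \sum_(q <- s) `|f q.2 - f q.1| by ring.
    by [].
  have ext2 y z s : y <= z -> z <= b -> `[y, z]%classic `<=` U -> P y s ->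
      P z ((y, z) :: s).
    move=> yz zb yzU [/andP[ay yb] hs ps ms fs]; split => //.
    - by rewrite zb (le_trans ay).
    - move=> q; rewrite inE => /predU1P[->//|/hs[h1 h2 h3]].
      by split=> //; exact: le_trans yz.
    - rewrite /= ps andbT; apply/allP => q /hs[_ _] //.
    - rewrite big_cons/= EFinD.
      have -> : U `&` `[a, z[%classic = `[y, z[%classic `|` (U `&` `[a, y[%classic).
        apply/seteqP; split=> w /=; rewrite !in_itv/=.
          move=> [Uw /andP[aw wz]]; have [yw|wy] := leP y w; first by left.
          by right; rewrite aw.
        move=> [/andP[yw wz]|[Uw /andP[aw wy]]].
          split; last by rewrite (le_trans ay yw).
          by apply: yzU; rewrite /= in_itv/= yw ltW.
        by split=> //; rewrite aw (lt_le_trans wy yz).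
      rewrite measureU//; last 2 first.
      + by apply: measurableI => //; exact: measurable_itv.
      + apply/seteqP; split=> w //=; rewrite !in_itv/=.
        by move=> [/andP[yw _] [_ /andP[_ wy]]]; move: (lt_le_trans wy yw); rewrite ltxx.
      apply: leeD => //; apply: (@le_trans _ _ (mu `[y, z[%classic)); last by [].
      rewrite lebesgue_measure_itv/= lte_fin.
      case: ltP => //; rewrite le_eqVlt ltNge yz orbF => /eqP ->.
      by rewrite subrr.
    rewrite big_cons/=.
    have -> : f z - f a = (f z - f y) + (f y - f a) by ring.
    have := ler_norm (f z - f y).
    have : e * (y - a) <= e * (z - a) by rewrite ler_pM2l// lerB.
    move: fs; lra.
  have [Ux|NUx] := pselect (U x).
    have /nbhs_ballP[/= r r0 rU] : nbhs x U by exact: open_nbhs_nbhs.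
    exists r => // y z ay yx xz zb ry zr [s Ps]; exists ((y, z) :: s).
    apply: ext2 => //; first exact: le_trans xz.
    move=> w /=; rewrite in_itv/= => /andP[yw wz]; apply: rU.
    rewrite ball_itv/= in_itv/=; apply/andP; split.
      exact: lt_le_trans yw.
    exact: le_lt_trans zr.
  have xa : x != a.
    by apply: contra_not_neq NUx => ->; apply: DU; left; right.
  have xnb : x != b.
    by apply: contra_not_neq NUx => ->; apply: DU; right.
  have /contrapT : ~ ~ (x \in `]a, b[%R ->
      exists2 df : R, is_derive x (1 : R) f df & df <= 0).
    by move=> h; apply: NUx; apply: DU; left; left; apply: NA.
  case.
    by rewrite in_itv/= !lt_neqAle ax xb xnb eq_sym xa.
  move=> df [dfx dfE] df0.
  have : h^-1 *: (f (h *: (1 : R) + x) - f x) @[h --> 0^'] --> df.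
    by rewrite -dfE; exact: dfx.
  move=> /cvgrPdist_lt /(_ e e0) /nbhs_ballP[/= r r0 hr].
  have slope h : h != 0 -> `|h| < r -> h^-1 * (f (h + x) - f x) < e.
    move=> h0 hlt; have := hr h; rewrite /ball/= sub0r normrN => /(_ hlt h0).
    rewrite /GRing.scale/= mulr1 ltr_norml => /andP[+ _]; lra.
  exists r => // y z ay yx xz zb ry zr [s Ps]; exists s.
  apply: ext1 Ps => //; first exact: le_trans xz.
  have -> : f z - f y = (f z - f x) + (f x - f y) by ring.
  have -> : e * (z - y) = e * (z - x) + e * (x - y) by ring.
  apply: lerD.
    move: xz; rewrite le_eqVlt => /predU1P[->|xz]; first by rewrite !subrr mulr0.
    have zx0 : 0 < z - x by rewrite subr_gt0.
    have := slope (z - x); rewrite subrK gt_eqF// gtr0_norm//.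
    rewrite ltrBlDl => /(_ isT zr).
    by rewrite mulrC ltr_pdivrMr// => /ltW.
  move: yx; rewrite le_eqVlt => /predU1P[->|yx]; first by rewrite !subrr mulr0.
  have zx0 : 0 < x - y by rewrite subr_gt0.
  have := slope (y - x); rewrite subrK lt_eqF ?subr_lt0// distrC gtr0_norm//.
  have xyr : x - y < r by move: ry; lra.
  move=> /(_ isT xyr).
  rewrite -opprB invrN mulNr -mulrN opprB mulrC ltr_pdivrMr// => /ltW //.
move=> [s [_ hs ps ms fs]].
apply: (le_trans fs); rewrite lerD2l.
pose l (i : 'I_(size s)) := (nth (0, 0) s i).1.
pose r (i : 'I_(size s)) := (nth (0, 0) s i).2.
have -> : \sum_(q <- s) `|f q.2 - f q.1| = \sum_i `|f (r i) - f (l i)|.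
  by rewrite (big_nth (0, 0)) big_mkord.
apply/ltW/hd.
- by move=> i; have [] := hs _ (mem_nth (0, 0) (ltn_ord i)).
- move=> i j _ _ [w [/=]]; rewrite !in_itv/= => /andP[li ri] /andP[lj rj].
  apply/val_inj/eqP; rewrite eqn_leq; apply/andP; split; rewrite leqNgt; apply/negP.
    move=> ij; have := (pairwiseP (0, 0) ps) j i (ltn_ord j) (ltn_ord i) ij.
    by rewrite leNgt (lt_trans lj ri).
  move=> ij; have := (pairwiseP (0, 0) ps) i j (ltn_ord i) (ltn_ord j) ij.
  by rewrite leNgt (lt_trans li rj).
have -> : \sum_i (r i - l i) = \sum_(q <- s) (q.2 - q.1).
  by rewrite [RHS](big_nth (0, 0)) big_mkord.
rewrite -lte_fin; apply: (le_lt_trans ms); apply: le_lt_trans Ud.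
apply: le_measure; rewrite ?inE//; apply: measurableI => //; exact: measurable_itv.
Qed.

End Monotone.

Section Derive1.
Context {R : realType}.
Implicit Types (f g : R -> R) (x : R).

Lemma is_derive1D f g x df dg : is_derive x (1 : R) f df ->
  is_derive x (1 : R) g dg -> is_derive x (1 : R) (fun s => f s + g s) (df + dg).
Proof. by move=> hf hg; exact: is_deriveD. Qed.

Lemma is_derive1M f g x df dg : is_derive x (1 : R) f df ->
  is_derive x (1 : R) g dg ->
  is_derive x (1 : R) (fun s => f s * g s) (df * g x + f x * dg).
Proof.
move=> hf hg; have h := is_deriveM hf hg.
by apply: (is_derive_eq h); rewrite addrC [df * _]mulrC.
Qed.

Lemma is_derive1_cst (c x : R) : is_derive x (1 : R) (fun=> c) 0.
Proof. exact: is_derive_cst. Qed.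

Lemma is_derive1Z (c : R) f x df : is_derive x (1 : R) f df ->
  is_derive x (1 : R) (fun s => c * f s) (c * df).
Proof.
move=> hf; apply: (is_derive_eq (is_derive1M (is_derive1_cst c x) hf)).
by rewrite mul0r add0r.
Qed.

Lemma is_derive1_sum (T : Type) (s : seq T) (F : T -> R -> R) (dF : T -> R) x :
  (forall i, is_derive x (1 : R) (F i) (dF i)) ->
  is_derive x (1 : R) (fun z => \sum_(i <- s) F i z) (\sum_(i <- s) dF i).
Proof.
move=> hF; elim: s => [|i s IH].
  have -> : (fun x => \sum_(i <- [::]) F i x) = (fun=> 0).
    by apply/funext => z; rewrite big_nil.
  by rewrite big_nil; exact: is_derive1_cst.
have -> : (fun x => \sum_(j <- i :: s) F j x) =
          (fun x => F i x + \sum_(j <- s) F j x).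
  by apply/funext => z; rewrite big_cons.
by rewrite big_cons; exact: is_derive1D.
Qed.

Lemma is_derive1_expRZ (c x : R) :
  is_derive x (1 : R) (fun s => expR (c * s)) (c * expR (c * x)).
Proof.
have h : is_derive x (1 : R) (fun s => c * s) c.
  by apply: (is_derive_eq (is_derive1Z c (is_derive_id x _))); rewrite mulr1.
have := @is_derive1_comp R expR (fun s => c * s) x _ _ (is_derive_expR _) h.
by rewrite mulrC.
Qed.

End Derive1.

(** * Differential inequalities and primitives *)

Section Comparison.
Context {R : realType}.
Implicit Types (f g u V : R -> R) (a b : R).
Local Notation mu := (@lebesgue_measure R).

Lemma ae_sub (P Q : R -> Prop) : {ae mu, forall x, P x} ->
  (forall x, P x -> Q x) -> {ae mu, forall x, Q x}.
Proof.
move=> hP PQ; apply: filterS hP; [exact: (ae_filter_ringOfSetsType mu)|exact: PQ].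
Qed.

Lemma ac_eq_on (I : set R) f g : (forall x, I x -> f x = g x) ->
  loc_abs_continuous I f -> loc_abs_continuous I g.
Proof.
move=> fg hf a b abI e e0; have [d d0 hd] := hf a b abI e e0.
exists d => // N l r hlr tr s; have := hd N l r hlr tr s.
congr (_ < _); apply: eq_bigr => i _; have [al [lr rb]] := hlr i.
by rewrite !fg//; apply: abI; rewrite /= in_itv/= ?al ?rb ?(le_trans lr rb) ?(le_trans al lr).
Qed.

Lemma ac_constant f a b : a <= b -> loc_abs_continuous `[a, b]%classic f ->
  {ae mu, forall x, x \in `]a, b[%R -> is_derive x (1 : R) f 0} -> f b = f a.
Proof.
move=> ab acf df; apply/le_anti/andP; split.
  apply: ac_nonincreasing => //; apply: (ae_sub df) => x dx /dx h.
  by exists 0.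
rewrite -lerN2 -[- f a]mulN1r -[- f b]mulN1r.
apply: (@ac_nonincreasing _ (fun s => -1 * f s)) => //.
  by apply: ac_mul => //; exact: ac_cst.
apply: (ae_sub df) => x dx /dx h; exists (-1 * 0); first exact: is_derive1Z.
by rewrite mulr0.
Qed.

Lemma ac_expRZ (c a b : R) : loc_abs_continuous `[a, b]%classic (fun s => expR (c * s)).
Proof.
apply: (@ac_bounded_derivative _ _ (fun s => c * expR (c * s)) _ _
  (`|c| * expR (`|c| * (`|a| + `|b|)))).
- apply: derivable_within_continuous => x _.
  by have [] := is_derive1_expRZ c x.
- by move=> x _; exact: is_derive1_expRZ.
move=> x; rewrite in_itv/= => /andP[ax xb].
rewrite normrM ler_wpM2l// ger0_norm ?expR_ge0// ler_expR.
apply: (le_trans (ler_norm _)); rewrite normrM ler_wpM2l//.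
have := ler_norm b; have := ler_norm (- a); have := normr_ge0 a; have := normr_ge0 b.
rewrite normrN ler_norml => *; apply/andP; split; lra.
Qed.

(** [expR (k * s)] is an integrating factor: its product with [u - c] is nonincreasing. *)
Lemma ac_linear_decay u (c k : R) a b : a <= b -> loc_abs_continuous `[a, b]%classic u ->
  {ae mu, forall x, x \in `]a, b[%R ->
     exists2 du, is_derive x (1 : R) u du & du <= - k * (u x - c)} ->
  u b - c <= expR (- k * (b - a)) * (u a - c).
Proof.
move=> ab acu hu.
have : expR (k * b) * (u b + - c) <= expR (k * a) * (u a + - c).
  apply: (@ac_nonincreasing _ (fun s => expR (k * s) * (u s + - c))) => //.
    apply: ac_mul; first exact: ac_expRZ.
    by apply: ac_add => //; exact: ac_cst.
  apply: (ae_sub hu) => x hx /hx[du ux dule].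
  exists (k * expR (k * x) * (u x + - c) + expR (k * x) * (du + 0)).
    exact: (is_derive1M (is_derive1_expRZ k x) (is_derive1D ux (is_derive1_cst _ x))).
  rewrite addr0 -mulrA mulrCA -mulrDr pmulr_rle0 ?expR_gt0//.
  by rewrite addrC -lerBrDr sub0r -mulNr.
have -> : - k * (b - a) = k * a - k * b by ring.
rewrite expRB mulrAC ler_pdivlMr ?expR_gt0//.
by rewrite mulrC.
Qed.

Lemma sqrt_growth V (f : R) a b : a <= b -> 0 <= f ->
  loc_abs_continuous `[a, b]%classic V -> (forall x, 0 <= V x) ->
  {ae mu, forall x, x \in `]a, b[%R ->
     exists2 dV, is_derive x (1 : R) V dV & dV <= 2 * f * Num.sqrt (V x)} ->
  Num.sqrt (V b) <= Num.sqrt (V a) + f * (b - a).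
Proof.
move=> ab f0 acV V0 hV; apply/ler_addgt0Pr => d d0.
(* [V / l - l] is nonincreasing, where [l] has slope [f] and [sqrt (V a) < l a];
   this avoids differentiating [sqrt V] at its zeros. *)
pose l s := (Num.sqrt (V a) + d - f * a) + f * s.
have lpos s : a <= s -> 0 < l s.
  move=> as_; have : 0 <= f * (s - a) by rewrite mulr_ge0// subr_ge0.
  have := sqrtr_ge0 (V a); rewrite /l; lra.
have dl x : is_derive x (1 : R) l f.
  apply: (is_derive_eq (is_derive1D (is_derive1_cst _ x)
    (is_derive1Z f (is_derive_id x _)))).
  by rewrite add0r mulr1.
have cl : continuous l.
  by move=> x; apply: differentiable_continuous; apply/derivable1_diffP; have [] := dl x.
have dli x : a <= x -> is_derive x (1 : R) (fun s => (l s)^-1) (- f / l x ^+ 2).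
  move=> ax; have lx : l x != 0 by rewrite gt_eqF ?lpos.
  apply: (is_derive_eq (is_deriveV lx (dl x))).
  by rewrite /GRing.scale/= !mulNr mulrC.
have acl : loc_abs_continuous `[a, b]%classic l.
  apply: ac_add; first exact: ac_cst.
  by apply: ac_mul; [exact: ac_cst|exact: ac_id].
have acli : loc_abs_continuous `[a, b]%classic (fun s => (l s)^-1).
  apply: (@ac_bounded_derivative _ _ (fun x => - f / l x ^+ 2) _ _ (f / d ^+ 2)).
  - apply: continuous_in_subspaceT => x; rewrite inE/= in_itv/= => /andP[ax xb].
    apply: differentiable_continuous; apply/derivable1_diffP.
    by have [] := dli x ax.
  - by move=> x; rewrite in_itv/= => /andP[/ltW ax _]; exact: dli.
  move=> x; rewrite in_itv/= => /andP[/ltW ax _].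
  rewrite normrM normrN (ger0_norm f0) ler_wpM2l// normfV ger0_norm ?sqr_ge0//.
  rewrite lef_pV2 ?posrE ?exprn_gt0 ?lpos//.
  rewrite ler_sqr ?nnegrE ?(ltW d0) ?(ltW (lpos _ ax))//.
  have : 0 <= f * (x - a) by rewrite mulr_ge0// subr_ge0.
  have := sqrtr_ge0 (V a); rewrite /l; lra.
have : V b * (l b)^-1 + (-1) * l b <= V a * (l a)^-1 + (-1) * l a.
  apply: (@ac_nonincreasing _ (fun s => V s * (l s)^-1 + (-1) * l s)) => //.
    apply: ac_add; first exact: ac_mul.
    by apply: ac_mul => //; exact: ac_cst.
  apply: (ae_sub hV) => x hx xab; have [dV Vx dVle] := hx xab.
  have ax : a <= x by move: xab; rewrite in_itv/= => /andP[/ltW].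
  exists (dV * (l x)^-1 + V x * (- f / l x ^+ 2) + (-1) * f).
    exact: (is_derive1D (is_derive1M Vx (dli x ax)) (is_derive1Z (-1) (dl x))).
  have lx := lpos x ax.
  have h1 : dV * (l x)^-1 <= 2 * f * Num.sqrt (V x) * (l x)^-1.
    by rewrite ler_pM2r// invr_gt0.
  have -> : V x * (- f / l x ^+ 2) = - f * (Num.sqrt (V x) * (l x)^-1) ^+ 2.
    rewrite exprMn sqr_sqrtr// exprVn; ring.
  (* In terms of [y] the derivative of [V / l - l] is at most
     [2 f y - f y^2 - f = - f (y - 1)^2]. *)
  set y := Num.sqrt (V x) * (l x)^-1.
  have : 0 <= f * (y - 1) ^+ 2 by rewrite mulr_ge0// sqr_ge0.
  move: h1; rewrite -mulrA -/y; lra.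
have la : l a = Num.sqrt (V a) + d by rewrite /l; ring.
have : V a * (l a)^-1 <= l a.
  rewrite ler_pdivrMr ?lpos// -expr2 -[leLHS]sqr_sqrtr// ler_sqr ?nnegrE ?sqrtr_ge0//.
    by rewrite la lerDl ltW.
  exact/ltW/lpos.
move=> h1 h2; have : V b * (l b)^-1 <= l b by lra.
rewrite ler_pdivrMr ?lpos// -expr2 -[leLHS]sqr_sqrtr// ler_sqr ?nnegrE ?sqrtr_ge0//.
  by move=> h; apply: (le_trans h); rewrite /l; lra.
exact/ltW/lpos.
Qed.

(** Clamping the argument to [[a, b]] extends [g] continuously to the whole line without changing
    its integrals from [a] to [x <= b]. The fundamental theorem of calculus applies to the
    extension, and boundedness of the derivative makes the primitive absolutely continuous. *)
Lemma ac_primitive g a b : a <= b -> loc_abs_continuous `[a, b]%classic g ->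
  let F x := \int[mu]_(s in `[a, x]) (g s) in
  loc_abs_continuous `[a, b]%classic F /\
  (forall x, x \in `]a, b[%R -> is_derive x (1 : R) F (g x)).
Proof.
move=> ab acg F.
pose cl (s : R) := Num.max a (Num.min b s).
have cl_in s : a <= cl s <= b by rewrite /cl le_max lexx ge_max ab ge_min lexx.
have cl_id s : a <= s <= b -> cl s = s.
  by move=> /andP[as_ sb]; rewrite /cl (min_idPr sb) (max_idPr as_).
have cl_lip x y : x <= y -> 0 <= cl y - cl x <= y - x.
  rewrite /cl; case: (leP b x); case: (leP b y) => h1 h2 h3; do ?case: (leP a _) => ?; apply/andP; split; lra.
pose G s := g (cl s).
have cG : continuous G.
  move=> x; apply/cvgrPdist_lt => e e0.
  have [d d0 hd] := ac_modulus acg (@subset_refl _ _) e0.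
  apply/nbhs_ballP; exists d => //= y; rewrite /ball/= => xyd.
  have /andP[? ?] := cl_in x; have /andP[? ?] := cl_in y.
  have [xy|/ltW yx] := leP x y.
    have /andP[h1 h2] := cl_lip _ _ xy; rewrite distrC.
    apply: hd => //; first by rewrite -subr_ge0.
    by apply: (le_lt_trans h2); rewrite -[ltLHS]ger0_norm ?subr_ge0// distrC.
  have /andP[h1 h2] := cl_lip _ _ yx.
  apply: hd => //; first by rewrite -subr_ge0.
  by apply: (le_lt_trans h2); rewrite -[ltLHS]ger0_norm ?subr_ge0.
pose FG x := \int[mu]_(s in `[a, x]) (G s).
have FGE x : x <= b -> FG x = F x.
  move=> xb; apply: eq_Rintegral => s; rewrite inE/= in_itv/= => /andP[as_ sx].
  by rewrite /G cl_id// as_ (le_trans sx).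
have intG : mu.-integrable `[a, b] (EFin \o G).
  apply: continuous_compact_integrable; first exact: segment_compact.
  exact: continuous_subspaceT.
have dFG x : x \in `]a, b[%R -> is_derive x (1 : R) FG (g x).
  rewrite in_itv/= => /andP[ax xb].
  have [dF dFE] := continuous_FTC1_closed xb intG ax (cG x).
  apply: DeriveDef => //.
  by rewrite -derive1E dFE /G cl_id// !ltW.
split; last first.
  move=> x xab; apply: near_eq_is_derive (dFG x xab) => //.
  move: xab; rewrite in_itv/= => /andP[ax xb].
  near=> y; apply: FGE; apply/ltW; near: y; exact: lt_nbhsl.
have [M M0 hM] := ac_bounded acg (@subset_refl _ _).
apply: (@ac_eq_on _ FG); first by move=> x /=; rewrite in_itv/= => /andP[_]; exact: FGE.
apply: (@ac_bounded_derivative _ _ g _ _ M) => //.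
  exact: parameterized_integral_continuous.
by move=> x; rewrite in_itv/= => /andP[ax xb]; apply: hM; rewrite !ltW.
Unshelve. all: by end_near. Qed.

End Comparison.

(** * Euclidean, Frobenius and induced norms *)

Section Norms.
Context {R : realType}.

Lemma Cauchy_Schwarz_sum (I : finType) (a b : I -> R) :
  \sum_i a i * b i <= Num.sqrt (\sum_i a i ^+ 2) * Num.sqrt (\sum_i b i ^+ 2).
Proof.
set A := \sum_i a i ^+ 2; set B := \sum_i b i ^+ 2; set C := \sum_i a i * b i.
have A0 : 0 <= A by apply: sumr_ge0 => i _; exact: sqr_ge0.
have B0 : 0 <= B by apply: sumr_ge0 => i _; exact: sqr_ge0.
suff h : C ^+ 2 <= A * B.
  rewrite -sqrtrM//; apply: (le_trans (ler_norm C)).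
  by rewrite -sqrtr_sqr; exact: ler_wsqrtr.
have [B1|B1] := eqVneq B 0.
  have b0 i : b i = 0.
    have /eqP := psumr_eq0P (fun j _ => sqr_ge0 (b j)) B1 (i := i) isT.
    by rewrite sqrf_eq0 => /eqP.
  rewrite /C big1 ?expr0n ?mulr_ge0//= => i _; by rewrite b0 mulr0.
have Bp : 0 < B by rewrite lt_neqAle eq_sym B1.
(* [B * a i - C * b i] is [B] times the component of [a] orthogonal to [b], so its squared norm
   measures the defect in the inequality. *)
have : 0 <= \sum_i (B * a i - C * b i) ^+ 2 by apply: sumr_ge0 => i _; exact: sqr_ge0.
have -> : \sum_i (B * a i - C * b i) ^+ 2 = B * (A * B - C ^+ 2).
  have -> : B * (A * B - C ^+ 2) = B ^+ 2 * A + (- 2 * B * C) * C + C ^+ 2 * B by ring.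
  have expand (x y z : R) : x * A + y * C + z * B =
      \sum_i (x * a i ^+ 2 + y * (a i * b i) + z * b i ^+ 2).
    by rewrite !mulr_sumr -!big_split.
  by rewrite expand; apply: eq_bigr => i _; ring.
by rewrite pmulr_rge0// subr_ge0.
Qed.

Definition dotv n (u v : 'cV[R]_n) : R := \sum_i u i 0 * v i 0.
Definition dotm n p (A B : 'M[R]_(n, p)) : R := \sum_i \sum_j A i j * B i j.

Section Vectors.
Context {n : nat}.
Implicit Types (u v w : 'cV[R]_n).

Lemma dotvC u v : dotv u v = dotv v u.
Proof. by apply: eq_bigr => i _; rewrite mulrC. Qed.

Lemma dotvDr u v w : dotv u (v + w) = dotv u v + dotv u w.
Proof. by rewrite -big_split/=; apply: eq_bigr => i _; rewrite mxE mulrDr. Qed.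

Lemma dotvDl u v w : dotv (u + v) w = dotv u w + dotv v w.
Proof. by rewrite dotvC dotvDr !(dotvC w). Qed.

Lemma dotvZr (c : R) u v : dotv u (c *: v) = c * dotv u v.
Proof. by rewrite mulr_sumr; apply: eq_bigr => i _; rewrite mxE mulrCA. Qed.

Lemma dotvZl (c : R) u v : dotv (c *: u) v = c * dotv u v.
Proof. by rewrite dotvC dotvZr dotvC. Qed.

Lemma dotvNr u v : dotv u (- v) = - dotv u v.
Proof. by rewrite -scaleN1r dotvZr mulN1r. Qed.

Lemma dotvNl u v : dotv (- u) v = - dotv u v.
Proof. by rewrite dotvC dotvNr dotvC. Qed.

Lemma dotv_ge0 u : 0 <= dotv u u.
Proof. by apply: sumr_ge0 => i _; rewrite -expr2 sqr_ge0. Qed.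

Lemma eucl_normE u : eucl_norm u = Num.sqrt (dotv u u).
Proof. by rewrite /eucl_norm; congr Num.sqrt; apply: eq_bigr => i _; rewrite expr2. Qed.

Lemma eucl_sqr u : eucl_norm u ^+ 2 = dotv u u.
Proof. by rewrite eucl_normE sqr_sqrtr// dotv_ge0. Qed.

Lemma eucl_ge0 u : 0 <= eucl_norm u.
Proof. exact: sqrtr_ge0. Qed.

Lemma dotv_le u v : dotv u v <= eucl_norm u * eucl_norm v.
Proof. exact: Cauchy_Schwarz_sum. Qed.

Lemma eucl_normN u : eucl_norm (- u) = eucl_norm u.
Proof. by rewrite !eucl_normE dotvNl dotvNr opprK. Qed.

Lemma dotv_geN u v : - (eucl_norm u * eucl_norm v) <= dotv u v.
Proof. by rewrite lerNl -dotvNl -(eucl_normN u) dotv_le. Qed.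

Lemma eucl_normZ (c : R) u : eucl_norm (c *: u) = `|c| * eucl_norm u.
Proof.
by rewrite !eucl_normE dotvZl dotvZr mulrA -expr2 sqrtrM ?sqr_ge0// sqrtr_sqr.
Qed.

Lemma eucl_sqrD u v :
  eucl_norm (u + v) ^+ 2 = eucl_norm u ^+ 2 + 2 * dotv u v + eucl_norm v ^+ 2.
Proof. rewrite !eucl_sqr dotvDl !dotvDr (dotvC v u); ring. Qed.

Lemma eucl_triangle u v : eucl_norm (u + v) <= eucl_norm u + eucl_norm v.
Proof.
rewrite -ler_sqr ?nnegrE ?addr_ge0 ?eucl_ge0// eucl_sqrD.
have := dotv_le u v; set x := eucl_norm u; set y := eucl_norm v.
have -> : (x + y) ^+ 2 = x ^+ 2 + 2 * (x * y) + y ^+ 2 by ring.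
lra.
Qed.

Lemma eucl_norm0 : eucl_norm (0 : 'cV[R]_n) = 0.
Proof. by rewrite -(scale0r 0) eucl_normZ normr0 mul0r. Qed.

Lemma eucl_norm_eq0 u : eucl_norm u = 0 -> u = 0.
Proof.
move=> h; have := eucl_sqr u; rewrite h expr0n/= => /esym/psumr_eq0P hu.
apply/colP => i; rewrite mxE; apply/eqP; rewrite -sqrf_eq0 expr2; apply/eqP.
by apply: hu => // j _; rewrite -expr2 sqr_ge0.
Qed.

Lemma eucl_sub_sqr u v :
  eucl_norm u ^+ 2 <= 2 * eucl_norm v ^+ 2 + 2 * eucl_norm (u - v) ^+ 2.
Proof.
have := sqr_ge0 (eucl_norm (v - (u - v))); rewrite (eucl_sqrD v) dotvNr eucl_normN.
have -> : eucl_norm u ^+ 2 = eucl_norm (v + (u - v)) ^+ 2 by rewrite addrC subrK.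
rewrite (eucl_sqrD v (u - v)); lra.
Qed.

End Vectors.

Section Matrices.
Context {n p : nat}.
Implicit Types (A B : 'M[R]_(n, p)).

Lemma dotv_mulmx A (u : 'cV[R]_p) (v : 'cV[R]_n) :
  dotv (A *m u) v = dotv u (A^T *m v).
Proof.
have -> : dotv (A *m u) v = \sum_i \sum_j A i j * u j 0 * v i 0.
  by apply: eq_bigr => i _; rewrite mxE mulr_suml.
rewrite exchange_big/=; apply: eq_bigr => j _.
by rewrite mxE mulr_sumr; apply: eq_bigr => i _; rewrite mxE; ring.
Qed.

Lemma frob_ge0 A : 0 <= frob_norm A.
Proof. exact: sqrtr_ge0. Qed.

Lemma frob_sqr A : frob_norm A ^+ 2 = dotm A A.
Proof.
rewrite sqr_sqrtr; last by do 2 apply: sumr_ge0 => ? _; exact: sqr_ge0.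
by apply: eq_bigr => i _; apply: eq_bigr => j _; rewrite expr2.
Qed.

Lemma frob_normZ (c : R) A : frob_norm (c *: A) = `|c| * frob_norm A.
Proof.
rewrite -sqrtr_sqr /frob_norm -sqrtrM ?sqr_ge0//; congr Num.sqrt.
rewrite mulr_sumr; apply: eq_bigr => i _; rewrite mulr_sumr.
by apply: eq_bigr => j _; rewrite mxE exprMn.
Qed.

Lemma dotm_le A B : dotm A B <= frob_norm A * frob_norm B.
Proof.
rewrite /dotm /frob_norm !pair_big/=.
exact: (Cauchy_Schwarz_sum (fun q : 'I_n * 'I_p => A q.1 q.2) (fun q => B q.1 q.2)).
Qed.

Lemma dotmDr A B C : dotm A (B + C) = dotm A B + dotm A C.
Proof.
rewrite -big_split/=; apply: eq_bigr => i _; rewrite -big_split/=.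
by apply: eq_bigr => j _; rewrite mxE mulrDr.
Qed.

Lemma dotmZr (c : R) A B : dotm A (c *: B) = c * dotm A B.
Proof.
rewrite mulr_sumr; apply: eq_bigr => i _; rewrite mulr_sumr.
by apply: eq_bigr => j _; rewrite mxE mulrCA.
Qed.

Lemma eucl_mulmx_frob A (v : 'cV[R]_p) :
  eucl_norm (A *m v) <= frob_norm A * eucl_norm v.
Proof.
have S0 : 0 <= \sum_i \sum_j A i j ^+ 2.
  by do 2 apply: sumr_ge0 => ? _; exact: sqr_ge0.
rewrite /eucl_norm /frob_norm -sqrtrM//; apply: ler_wsqrtr.
rewrite mulr_suml; apply: ler_sum => i _.
have h := Cauchy_Schwarz_sum (fun j => A i j) (fun j => v j 0).
have hN := Cauchy_Schwarz_sum (fun j => - A i j) (fun j => v j 0).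
have e : \sum_j (- A i j) ^+ 2 = \sum_j A i j ^+ 2.
  by apply: eq_bigr => j _; rewrite sqrrN.
have e' : \sum_j - A i j * v j 0 = - \sum_j A i j * v j 0.
  by rewrite -sumrN; apply: eq_bigr => j _; rewrite mulNr.
rewrite e e' in hN; rewrite mxE.
have a0 : 0 <= \sum_j A i j ^+ 2 by apply: sumr_ge0 => ? _; exact: sqr_ge0.
have b0 : 0 <= \sum_j v j 0 ^+ 2 by apply: sumr_ge0 => ? _; exact: sqr_ge0.
rewrite -(sqr_sqrtr a0) -(sqr_sqrtr b0) -exprMn -real_normK ?num_real//.
rewrite ler_sqr ?nnegrE ?normr_ge0 ?mulr_ge0 ?sqrtr_ge0//.
by rewrite ler_norml h lerNl hN.
Qed.

Let ball_image A := [set eucl_norm (A *m v) | v in [set v | eucl_norm v <= 1]].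

Let ball_image_has_sup A : has_sup (ball_image A).
Proof.
split; first by exists (eucl_norm (A *m 0)); exists 0 => //=; rewrite eucl_norm0.
exists (frob_norm A) => _ [v /= v1 <-]; apply: (le_trans (eucl_mulmx_frob A v)).
by rewrite ler_piMr ?frob_ge0.
Qed.

Lemma induced_ge0 A : 0 <= induced_norm A.
Proof.
apply: (@le_trans _ _ (eucl_norm (A *m 0))); first exact: eucl_ge0.
apply: ub_le_sup; first by have [] := ball_image_has_sup A.
by exists 0 => //=; rewrite eucl_norm0.
Qed.

Lemma induced_le_frob A : induced_norm A <= frob_norm A.
Proof.
apply: ge_sup; first by have [] := ball_image_has_sup A.
move=> _ [v /= v1 <-]; apply: (le_trans (eucl_mulmx_frob A v)).
by rewrite ler_piMr ?frob_ge0.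
Qed.

Lemma eucl_mulmx_induced A (v : 'cV[R]_p) :
  eucl_norm (A *m v) <= induced_norm A * eucl_norm v.
Proof.
have [v0|v0] := eqVneq (eucl_norm v) 0.
  by rewrite v0 mulr0 (eucl_norm_eq0 v0) mulmx0 eucl_norm0.
have vp : 0 < eucl_norm v by rewrite lt_neqAle eq_sym v0 eucl_ge0.
rewrite -ler_pdivrMr// mulrC; apply: ub_le_sup.
  by have [] := ball_image_has_sup A.
exists ((eucl_norm v)^-1 *: v) => /=.
  by rewrite eucl_normZ ger0_norm ?invr_ge0 ?(ltW vp)// mulVf.
by rewrite -scalemxAr eucl_normZ ger0_norm ?invr_ge0 ?(ltW vp).
Qed.

(** By duality [|A^T w|^2] is the inner product of [A (A^T w)] with [w]; bounding it through the
    norm of [A] lets one factor [|A^T w|] cancel. *)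
Lemma eucl_trmulmx_induced A (w : 'cV[R]_n) :
  eucl_norm (A^T *m w) <= induced_norm A * eucl_norm w.
Proof.
have [v0|v0] := eqVneq (eucl_norm (A^T *m w)) 0.
  by rewrite v0 mulr_ge0 ?induced_ge0 ?eucl_ge0.
have vp : 0 < eucl_norm (A^T *m w) by rewrite lt_neqAle eq_sym v0 eucl_ge0.
rewrite -(ler_pM2l vp) -expr2 eucl_sqr -dotv_mulmx.
apply: (le_trans (dotv_le _ _)); rewrite mulrCA mulrA.
by rewrite ler_wpM2r ?eucl_ge0// eucl_mulmx_induced.
Qed.

End Matrices.
End Norms.

(** * Hybrid time domains *)

Section Hybrid.
Context {R : realType}.
Implicit Types (E dom : set (R * nat)) (z : R * nat).

Lemma htd_arc dom z : hybrid_time_domain dom -> dom z -> exists t : nat -> R,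
  [/\ t 0%N = 0, t z.2.+1 = z.1,
      forall i j, (i <= j)%N -> (j <= z.2.+1)%N -> t i <= t j &
      forall s j, s <= z.1 -> (j <= z.2)%N -> dom (s, j) <-> t j <= s <= t j.+1].
Proof.
case: z => T J [dom0 hdom] dz; have [t [t0 tm tE]] := hdom T J dz.
have mono i j : (i <= j)%N -> (j <= J.+1)%N -> t i <= t j.
  elim: j => [|j IH]; first by rewrite leqn0 => /eqP->.
  rewrite leq_eqVlt ltnS => /predU1P[->//|ij jJ].
  by apply: le_trans (tm _ jJ); apply: IH => //; exact: ltnW.
have inE s j : (j <= J)%N -> t j <= s <= t j.+1 -> dom (s, j) /\ s <= T.
  move=> jJ tjs.
  have : (\bigcup_(j in [set j | (j <= J)%N])
            (`[t j, t j.+1]%classic `*` [set j])) (s, j).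
    by exists j => //; split => //=; rewrite in_itv.
  by rewrite -tE => -[? [/=]]; rewrite in_itv/= => /andP[_ ?] _.
have tJ : t J.+1 = T.
  apply/le_anti/andP; split.
    by have [] := inE (t J.+1) J (leqnn _) _; rewrite ?lexx ?tm.
  have : (dom `&` (`[0, T]%classic `*` [set j | (j <= J)%N])) (T, J).
    by split => //; split => //=; rewrite in_itv/= lexx (dom0 _ dz).
  by rewrite tE => -[j /= jJ [/=]]; rewrite in_itv/= => /andP[_ +] ->.
exists t; split => // s j /= sT jJ; split; last by move=> h; have [] := inE s j jJ h.
move=> ds; have : (dom `&` (`[0, T]%classic `*` [set j | (j <= J)%N])) (s, j).
  by split => //; split => //=; rewrite in_itv/= sT (dom0 _ ds).
by rewrite tE => -[j' /= jJ' [/=]]; rewrite in_itv/= => + ->.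
Qed.

(* Without the common upper bound [z] this fails: the definition of a hybrid
   time domain admits [0,1] x {0} together with (0, 1). *)
Lemma htd_order E z s j s' j' : hybrid_time_domain E -> E z ->
  E (s, j) -> E (s', j') -> s <= z.1 -> s' <= z.1 -> (j < j')%N -> (j' <= z.2)%N ->
  s <= s'.
Proof.
move=> hE Ez Es Es' sz s'z jj' j'z; have [t [_ _ mono tE]] := htd_arc hE Ez.
have /andP[_ h1] := (tE s j sz (leq_trans (ltnW jj') j'z)).1 Es.
have /andP[h2 _] := (tE s' j' s'z j'z).1 Es'.
apply: (le_trans h1); apply: le_trans h2; apply: mono => //.
by rewrite (leq_trans j'z).
Qed.

(** The sequence is that of [htd_arc] at [z1], with the entries up to index [z0.2] replaced by
    [z0.1], so that the first interval starts at [z0] and not at the preceding jump. *)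
Lemma htd_window dom z0 z1 : hybrid_time_domain dom -> dom z0 -> dom z1 ->
  z0.1 <= z1.1 -> (z0.2 <= z1.2)%N -> exists w : nat -> R,
  [/\ w z0.2 = z0.1, w z1.2.+1 = z1.1,
      forall j, (z0.2 <= j <= z1.2)%N -> w j <= w j.+1,
      forall j, (z0.2 <= j <= z1.2.+1)%N -> z0.1 <= w j <= z1.1 &
      forall j s, (z0.2 <= j <= z1.2)%N -> w j <= s <= w j.+1 -> dom (s, j)].
Proof.
case: z0 z1 => [s0 j0] [s1 j1] /= hdom d0 d1 s01 j01.
have [t [_ /= tJ mono tE]] := htd_arc hdom d1.
have /andP[t0 t0'] := (tE s0 j0 s01 j01).1 d0.
exists (fun j => if (j <= j0)%N then s0 else t j); split => //=.
- by rewrite leqnn.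
- by rewrite leqNgt ltnS j01.
- move=> j /andP[jj0 jj1]; case: (leqP j j0) => [h|h].
    have -> : j = j0 by apply/eqP; rewrite eqn_leq h jj0.
    by rewrite ltnn.
  by rewrite leqNgt (ltn_trans h)//; apply: mono.
- move=> j /andP[jj0 jj1]; case: (leqP j j0) => [h|h]; first by rewrite lexx s01.
  apply/andP; split; last by rewrite -tJ; exact: mono.
  by apply: (le_trans t0'); apply: mono.
move=> j s /andP[jj0 jj1]; case: (leqP j j0) => [h|h].
  have -> : j = j0 by apply/eqP; rewrite eqn_leq h jj0.
  rewrite ltnn => /andP[h1 h2]; apply/tE => //.
    by apply: (le_trans h2); rewrite -tJ; exact: mono.
  by rewrite h2 (le_trans t0).
rewrite leqNgt (ltn_trans h)// => /andP[h1 h2]; apply/tE => //; last by rewrite h1.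
by apply: (le_trans h2); rewrite -tJ; exact: mono.
Qed.

(** Between [z0] and [z1] the domain is a finite chain of flow intervals joined by jumps, so
    induction on the number of jumps reduces a claim along an arc to one compact flow interval and
    one jump. *)
Lemma hybrid_ind dom z0 z1 (P : R -> nat -> Prop) : hybrid_time_domain dom ->
  dom z0 -> dom z1 -> z0.1 <= z1.1 -> (z0.2 <= z1.2)%N ->
  (forall j a b, (z0.2 <= j <= z1.2)%N -> z0.1 <= a -> a <= b -> b <= z1.1 ->
     `[a, b]%classic `<=` flow_interval dom j -> P a j -> P b j) ->
  (forall s j, (z0.2 <= j < z1.2)%N -> z0.1 <= s -> s <= z1.1 ->
     dom (s, j) -> dom (s, j.+1) -> P s j -> P s j.+1) ->
  P z0.1 z0.2 -> P z1.1 z1.2.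
Proof.
move=> hdom d0 d1 s01 j01 hflow hjump P0.
have [w [w0 w1 wm wb wd]] := htd_window hdom d0 d1 s01 j01.
have wl j : (z0.2 <= j)%N -> (j <= z1.2.+1)%N -> z0.1 <= w j.
  by move=> h1 h2; have := wb j; rewrite h1 h2 => /(_ isT)/andP[].
have wr j : (z0.2 <= j)%N -> (j <= z1.2.+1)%N -> w j <= z1.1.
  by move=> h1 h2; have := wb j; rewrite h1 h2 => /(_ isT)/andP[].
have step j : (z0.2 <= j <= z1.2)%N -> P (w j) j -> P (w j.+1) j.
  move=> jj; have /andP[jj0 jj1] := jj; apply: hflow => //.
  - by apply: wl => //; exact: leqW.
  - exact: wm.
  - by apply: wr => //; exact: leqW.
  by move=> s /=; rewrite in_itv/= => h; apply: wd.
suff h k : (z0.2 + k <= z1.2)%N -> P (w (z0.2 + k)%N) (z0.2 + k)%N.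
  rewrite -w1; apply: step; first by rewrite j01 leqnn.
  by have := h (z1.2 - z0.2)%N; rewrite subnKC//; apply.
elim: k => [|k IH]; first by rewrite addn0 w0.
rewrite addnS => kz; have {}IH := step _ _ (IH (ltnW kz)).
have j1 : (z0.2 <= z0.2 + k <= z1.2)%N by rewrite leq_addr ltnW.
have j2 : (z0.2 <= (z0.2 + k).+1 <= z1.2)%N by rewrite leqW ?leq_addr.
apply: hjump.
- by rewrite leq_addr.
- by apply: wl; [exact/leqW/leq_addr|exact: leqW].
- by apply: wr; [exact/leqW/leq_addr|exact: leqW].
- by apply: wd => //; rewrite wm// lexx.
- by apply: wd => //; rewrite wm// lexx.
exact: IH.
Qed.

(** [t + j] moves continuously along flows and by exactly 1 at jumps, so its first passage above a
    level overshoots by less than 1. This accounts for the range from [Delta] to [Delta + 1] in the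
    excitation condition. *)
Lemma htd_crossing dom z0 z1 (D : R) : hybrid_time_domain dom ->
  dom z0 -> dom z1 -> z0.1 <= z1.1 -> (z0.2 <= z1.2)%N -> 0 < D ->
  D <= (z1.1 - z0.1) + (z1.2%:R - z0.2%:R) ->
  exists z, [/\ dom z, z0.1 <= z.1 <= z1.1, (z0.2 <= z.2 <= z1.2)%N &
    D <= (z.1 - z0.1) + (z.2%:R - z0.2%:R) < D + 1].
Proof.
move=> hdom d0 d1 s01 j01 D0 hD.
have [w [w0 w1 wm wb wd]] := htd_window hdom d0 d1 s01 j01.
pose S := z0.1 + z0.2%:R + D.
(* [Q j] says that the level [S] is reached by the end of the interval [j]. At the least such [j] it
   is reached either by the jump into that interval or during the flow, at time [S - j]. *)
pose Q j := (z0.2 <= j)%N && (S <= w j.+1 + j%:R).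
have exQ : exists j, Q j.
  by exists z1.2; rewrite /Q j01 w1 /S; lra.
case: (ex_minnP exQ) => j /andP[jz0 Sj] jmin.
have jz1 : (j <= z1.2)%N by apply: jmin; rewrite /Q j01 w1 /S; lra.
have jj : (z0.2 <= j <= z1.2)%N by rewrite jz0.
have [Swj|Swj] := leP S (w j + j%:R).
  exists (w j, j); split => //=.
  - by apply: wd => //; rewrite lexx wm.
  - by apply: wb; rewrite jz0 leqW.
  have lt : w j + j%:R < S + 1.
    move: jz0; rewrite leq_eqVlt => /predU1P[e|jz0].
      by move: Swj; rewrite -e w0 /S; lra.
    case: j jz0 Sj jmin jz1 jj Swj => // j jz0 _ jmin _ _ _.
    rewrite ltNge; apply/negP => h; suff /jmin : Q j by rewrite ltnn.
    rewrite /Q -ltnS jz0/=; move: h; rewrite -natr1; lra.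
  by move: lt Swj; rewrite /S; lra.
exists (S - j%:R, j); split => //=.
- by apply: wd => //; lra.
- have := wb j; rewrite jz0 leqW// => /(_ isT).
  have := wb j.+1; rewrite leqW// ltnS jz1 => /(_ isT); lra.
by rewrite /S; lra.
Qed.

End Hybrid.

(** * The excitation Gramian bounded by a difference of potentials *)

Section Gramian.
Context {R : realType} {n p : nat}.
Local Notation mu := (@lebesgue_measure R).

Lemma quadratic_formE (v : 'cV[R]_p) (B : 'M[R]_p) :
  (v^T *m B *m v) 0 0 = \sum_i \sum_k v i 0 * v k 0 * B i k.
Proof.
rewrite mxE exchange_big/=; apply: eq_bigr => k _.
rewrite mxE mulr_suml; apply: eq_bigr => i _; rewrite mxE; ring.
Qed.

Lemma quadratic_form_gram (v : 'cV[R]_p) (A : 'M[R]_(n, p)) :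
  (v^T *m (A^T *m A) *m v) 0 0 = eucl_norm (A *m v) ^+ 2.
Proof.
rewrite mulmxA -mulmxA -trmx_mul eucl_sqr mxE.
by apply: eq_bigr => i _; rewrite mxE.
Qed.

Lemma quadratic_form_scalar (v : 'cV[R]_p) (x : R) :
  (v^T *m x%:M *m v) 0 0 = x * eucl_norm v ^+ 2.
Proof.
rewrite mul_mx_scalar -scalemxAl mxE eucl_sqr mxE; congr (_ * _).
by apply: eq_bigr => i _; rewrite mxE.
Qed.

(** With a variable upper end point, the quadratic form of the integral is a function [Q] with
    [Q a = 0] and derivative [|M v|^2]; the decrease of [H] pays for its growth, so [Q + H] is
    nonincreasing. *)
Lemma mx_integral_gram_le (M : R -> 'M[R]_(n, p)) (v : 'cV[R]_p) (H : R -> R)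
    (a b : R) : a <= b ->
  (forall i k, loc_abs_continuous `[a, b]%classic (fun s => M s i k)) ->
  loc_abs_continuous `[a, b]%classic H ->
  {ae mu, forall x, x \in `]a, b[%R -> exists2 dH, is_derive x (1 : R) H dH &
     dH <= - eucl_norm (M x *m v) ^+ 2} ->
  (v^T *m mx_integral `[a, b]%classic (fun s => (M s)^T *m M s) *m v) 0 0
    <= H a - H b.
Proof.
move=> ab acM acH hH.
pose g i k s := ((M s)^T *m M s) i k.
have acg i k : loc_abs_continuous `[a, b]%classic (g i k).
  have -> : g i k = fun s => \sum_l M s l i * M s l k.
    by apply/funext => s; rewrite /g mxE; apply: eq_bigr => l _; rewrite mxE.
  by apply: ac_sum => l; apply: ac_mul.
pose F i k x := \int[mu]_(s in `[a, x]) (g i k s).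
pose Q x := \sum_i \sum_k (v i 0 * v k 0) * F i k x.
have FP i k : loc_abs_continuous `[a, b]%classic (F i k) /\
    (forall x, x \in `]a, b[%R -> is_derive x (1 : R) (F i k) (g i k x)).
  exact: ac_primitive.
have acQ : loc_abs_continuous `[a, b]%classic Q.
  apply: ac_sum => i; apply: ac_sum => k; apply: ac_mul; first exact: ac_cst.
  by have [] := FP i k.
have : Q b + H b <= Q a + H a.
  apply: (@ac_nonincreasing _ (fun s => Q s + H s)) => //; first exact: ac_add.
  apply: (ae_sub hH) => x hx xab; have [dH Hx dHle] := hx xab.
  have dQ : is_derive x (1 : R) Q (eucl_norm (M x *m v) ^+ 2).
    rewrite -quadratic_form_gram quadratic_formE.
    apply: is_derive1_sum => i; apply: is_derive1_sum => k.
    by apply: is_derive1Z; have [_] := FP i k; apply.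
  exists (eucl_norm (M x *m v) ^+ 2 + dH); first exact: is_derive1D.
  lra.
have -> : Q a = 0.
  rewrite /Q big1// => i _; rewrite big1// => k _.
  by rewrite /F set_itv1 Rintegral_set1 mulr0.
have -> : (v^T *m mx_integral `[a, b]%classic (fun s => (M s)^T *m M s) *m v) 0 0 = Q b.
  rewrite quadratic_formE; apply: eq_bigr => i _; apply: eq_bigr => k _.
  by rewrite mxE.
lra.
Qed.

Lemma mx_integral_set0 (M : R -> 'M[R]_p) : mx_integral set0 M = 0.
Proof. by apply/matrixP => i k; rewrite !mxE Rintegral_set0. Qed.

Lemma quadratic_formD (v : 'cV[R]_p) (A B : 'M[R]_p) :
  (v^T *m (A + B) *m v) 0 0 = (v^T *m A *m v) 0 0 + (v^T *m B *m v) 0 0.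
Proof. by rewrite mulmxDr mulmxDl mxE. Qed.

Lemma quadratic_form_sum (v : 'cV[R]_p) (j0 j1 : nat) (F : nat -> 'M[R]_p) :
  (v^T *m (\sum_(j0 <= j < j1) F j) *m v) 0 0 =
  \sum_(j0 <= j < j1) (v^T *m F j *m v) 0 0.
Proof. by rewrite mulmx_sumr mulmx_suml summxE. Qed.

Lemma telescope_flow_jump_le (G S a b : nat -> R) (j0 j1 : nat) : (j0 <= j1)%N ->
  (forall j, (j0 <= j <= j1)%N -> G j <= a j - b j) ->
  (forall j, (j0 <= j < j1)%N -> S j <= b j - a j.+1) ->
  \sum_(j0 <= j < j1.+1) G j + \sum_(j0 <= j < j1) S j <= a j0 - b j1.
Proof.
elim: j1 => [|j1 IH].
  rewrite leqn0 => /eqP -> hG _; rewrite big_nat1 big_geq// addr0; exact: hG.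
rewrite leq_eqVlt => /predU1P[-> hG _|].
  by rewrite big_nat1 big_geq// addr0; apply: hG; rewrite !leqnn.
rewrite ltnS => j01 hG hS.
rewrite (big_nat_recr j1.+1)/=; last exact: leqW.
rewrite [X in _ + X <= _](big_nat_recr j1)//=.
have := hG j1.+1; rewrite leqnn (leqW j01) => /(_ isT).
have := hS j1; rewrite j01 ltnSn => /(_ isT).
have : \sum_(j0 <= i < j1.+1) G i + \sum_(j0 <= i < j1) S i <= a j0 - b j1.
  by apply: IH => // j /andP[q1 q2]; [apply: hG|apply: hS]; rewrite q1 leqW.
lra.
Qed.

(** [w] is the least time of its flow interval: times up to [z1.1] are ordered by [htd_order], and
    later ones exceed [w] anyway. This identifies the break points of a solution with the jump times
    that the Gramian reads from [E]. *)
Lemma jump_time_window (E : set (R * nat)) z1 (w : R) (j : nat) : hybrid_time_domain E -> E z1 ->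
  w <= z1.1 -> (j < z1.2)%N -> E (w, j) -> E (w, j.+1) ->
  jump_time E j.+1 = w%:E.
Proof.
move=> hE E1 wz jz Ew Ew'; rewrite /jump_time.
have -> : `[< flow_interval E j.+1 !=set0 >] by apply/asboolP; exists w.
apply/le_anti/andP; split.
  by apply: ereal_inf_lbound; exists w.
apply: le_ereal_inf_tmp => _ [s Es <-]; rewrite lee_fin.
have [sz|zs] := leP s z1.1; last exact/ltW/(le_lt_trans wz).
exact: (htd_order hE E1 Ew Es).
Qed.

Lemma jump_time_le (E : set (R * nat)) z : E z -> (jump_time E z.2 <= z.1%:E)%E.
Proof.
move=> Ez; rewrite /jump_time.
have -> : `[< flow_interval E z.2 !=set0 >].
  by apply/asboolP; exists z.1; rewrite /flow_interval/= -surjective_pairing.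
by apply: ereal_inf_lbound; exists z.1 => //; rewrite /flow_interval/= -surjective_pairing.
Qed.

(* [jump_time E z1.2.+1] may be less than [z1.1] when [E] branches beyond [z1];
   the last integral of the Gramian is then only over a smaller interval. *)
Lemma hybrid_gramian_le (E dom : set (R * nat)) (psi : R * nat -> 'M[R]_(n, p))
    (z0 z1 : R * nat) (v : 'cV[R]_p) (H : R -> nat -> R) :
  hybrid_time_domain E -> hybrid_time_domain dom -> dom `<=` E ->
  dom z0 -> dom z1 -> z0.1 <= z1.1 -> (z0.2 <= z1.2)%N ->
  (forall j i k, loc_abs_continuous (flow_interval dom j) (fun s => psi (s, j) i k)) ->
  (forall j a b, (z0.2 <= j <= z1.2)%N -> z0.1 <= a -> a <= b -> b <= z1.1 ->
    `[a, b]%classic `<=` flow_interval dom j ->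
    loc_abs_continuous `[a, b]%classic (H^~ j) /\
    {ae mu, forall x, x \in `]a, b[%R -> exists2 dH, is_derive x (1 : R) (H^~ j) dH &
       dH <= - eucl_norm (psi (x, j) *m v) ^+ 2}) ->
  (forall s j, (z0.2 <= j < z1.2)%N -> z0.1 <= s -> s <= z1.1 ->
     dom (s, j) -> dom (s, j.+1) ->
     H s j.+1 <= H s j - eucl_norm (psi (s, j.+1) *m v) ^+ 2) ->
  (v^T *m hybrid_gramian E psi z0 z1 *m v) 0 0 <= H z0.1 z0.2 - H z1.1 z1.2.
Proof.
move=> hE hdom domE d0 d1 s01 j01 acpsi hflow hjump.
have [w [w0 w1 wm wb wd]] := htd_window hdom d0 d1 s01 j01.
have wl j : (z0.2 <= j)%N -> (j <= z1.2.+1)%N -> z0.1 <= w j.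
  by move=> h1 h2; have := wb j; rewrite h1 h2 => /(_ isT)/andP[].
have wr j : (z0.2 <= j)%N -> (j <= z1.2.+1)%N -> w j <= z1.1.
  by move=> h1 h2; have := wb j; rewrite h1 h2 => /(_ isT)/andP[].
have jt j : (z0.2 <= j < z1.2)%N -> jump_time E j.+1 = (w j.+1)%:E.
  move=> /andP[h1 h2]; apply: (@jump_time_window _ z1) => //.
  - exact: domE.
  - by apply: wr; rewrite ltnW.
  - have hj : (z0.2 <= j <= z1.2)%N by rewrite h1 ltnW.
    by apply/domE/(wd j) => //; rewrite lexx wm.
  - have hj : (z0.2 <= j.+1 <= z1.2)%N by rewrite leqW.
    by apply/domE/(wd j.+1) => //; rewrite lexx wm.
rewrite quadratic_formD !quadratic_form_sum.
rewrite -[X in H X z0.2]w0 -[X in H X z1.2]w1.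
apply: (@telescope_flow_jump_le _ _ (fun j => H (w j) j) (fun j => H (w j.+1) j)) => //.
  move=> j jj; have /andP[jz0 jz1] := jj.
  have subd : `[w j, w j.+1]%classic `<=` flow_interval dom j.
    by move=> s /=; rewrite in_itv/= => h; apply: wd.
  have lower : maxe z0.1%:E (jump_time E j) = (w j)%:E.
    move: (jz0); rewrite leq_eqVlt => /predU1P[<-|z0j].
      rewrite w0; apply/max_idPl; exact/jump_time_le/domE.
    case: j z0j jz0 jz1 jj {subd} => // j z0j jz0 jz1 jj.
    rewrite jt; last by rewrite -ltnS z0j.
    by apply/max_idPr; rewrite lee_fin; apply: wl => //; exact: leqW.
  set c := mine z1.1%:E (jump_time E j.+1).
  have upper : (c <= (w j.+1)%:E)%E.
    move: (jz1); rewrite leq_eqVlt => /predU1P[->|jz1'].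
      by rewrite w1 ge_min lexx.
    by rewrite /c jt ?jz0// ge_min lexx orbT.
  (* An empty range of integration can arise only on the last interval; there the integral vanishes
     and it is enough that [H] does not increase. *)
  have [ltc|lec] := ltP c (w j)%:E.
    have -> : [set s : R | (maxe z0.1%:E (jump_time E j) <= s%:E <= c)%E] = set0.
      apply/seteqP; split => s //=; rewrite lower => /andP[h1 h2].
      by have := lt_le_trans ltc (le_trans h1 h2); rewrite ltxx.
    rewrite mx_integral_set0 mulmx0 mul0mx mxE subr_ge0.
    have [acH hH] := hflow j (w j) (w j.+1) jj (wl _ jz0 (leqW jz1)) (wm _ jj)
      (wr _ (leqW jz0) jz1) subd.
    apply: (@ac_nonincreasing _ (H^~ j)) => //; first exact: wm.
    apply: (ae_sub hH) => x hx /hx[dH Hx dHle]; exists dH => //.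
    by apply: (le_trans dHle); rewrite oppr_le0 sqr_ge0.
  have [r cE] : exists r, c = r%:E.
    by case: (c) lec upper => [r _ _||]//; exists r.
  rewrite cE !lee_fin in lec upper.
  have -> : [set s : R | (maxe z0.1%:E (jump_time E j) <= s%:E <= c)%E] = `[w j, r]%classic.
    by apply/seteqP; split => s /=; rewrite lower cE !lee_fin in_itv.
  have subr_ : `[w j, r]%classic `<=` `[w j, w j.+1]%classic.
    by move=> s /=; rewrite !in_itv/= => /andP[-> h]; exact: le_trans upper.
  have [acH hH] := hflow j (w j) (w j.+1) jj (wl _ jz0 (leqW jz1)) (wm _ jj)
    (wr _ (leqW jz0) jz1) subd.
  have [acH' hH'] := hflow j (w j) r jj (wl _ jz0 (leqW jz1)) lec
    (le_trans upper (wr _ (leqW jz0) jz1)) (subset_trans subr_ subd).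
  (* The integral is paid for on [[w j, r]]; on the remainder up to [w j.+1] the potential can only
     drop further. *)
  apply: (@le_trans _ _ (H (w j) j - H r j)).
    apply: (mx_integral_gram_le (H := H^~ j) (M := fun s => psi (s, j))) => //.
    by move=> i k; apply: ac_subset (acpsi j i k); exact: subset_trans subd.
  rewrite lerD2l lerN2.
  apply: (@ac_nonincreasing _ (H^~ j)) => //.
    apply: ac_subset acH => s /=; rewrite !in_itv/= => /andP[h ->].
    by rewrite (le_trans lec h).
  apply: (ae_sub hH) => x hx; rewrite in_itv/= => /andP[rx xw].
  have [|dH Hx dHle] := hx.
    by rewrite in_itv/= xw (le_lt_trans lec rx).
  exists dH => //; apply: (le_trans dHle); by rewrite oppr_le0 sqr_ge0.
move=> j jj; have /andP[jz0 jz1] := jj.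
rewrite jt//= quadratic_form_gram lerBrDl -lerBrDr.
have h : (z0.2 <= j <= z1.2)%N by rewrite jz0 ltnW.
apply: hjump => //.
- by apply: wl; [exact: leqW|exact: ltnW].
- by apply: wr; [exact: leqW|exact: ltnW].
- by apply: wd => //; rewrite lexx wm.
have h' : (z0.2 <= j.+1 <= z1.2)%N by rewrite leqW.
by apply: wd => //; rewrite lexx wm.
Qed.

End Gramian.

(** * The error system *)

Section Coordinates.
Context {R : realType}.

Lemma prod_norm_fst (U V : normedModType R) (w : U * V) : `|w.1| <= `|w|.
Proof. by rewrite [leRHS]prod_normE le_max lexx. Qed.

Lemma prod_norm_snd (U V : normedModType R) (w : U * V) : `|w.2| <= `|w|.
Proof. by rewrite [leRHS]prod_normE le_max lexx orbT. Qed.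

Lemma mx_norm_coord m n (A : 'M[R]_(m, n)) i j : `|A i j| <= `|A|.
Proof.
rewrite [leRHS]/Num.norm/= mx_normrE.
exact: (@le_bigmax_cond _ _ _ 0 (i, j) xpredT (fun q : 'I_m * 'I_n => `|A q.1 q.2|)).
Qed.

(** These are the linear functionals bounded by the norm. Composition with one of them turns
    absolute continuity and derivatives of vector-valued arcs into scalar statements, the only ones
    that the monotonicity argument handles. *)
Definition coordinate (V : normedModType R) (L : V -> R) :=
  [/\ forall u v, L (u - v) = L u - L v,
      forall (a : R) v, L (a *: v) = a * L v &
      forall v, `|L v| <= `|v|].

Lemma coordinate_ac (V : normedModType R) (L : V -> R) I (f : R -> V) :
  coordinate L -> loc_abs_continuous I f ->
  loc_abs_continuous I (fun s => L (f s)).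
Proof.
move=> [LB _ Ln] hf a b abI e e0; have [d d0 hd] := hf a b abI e e0.
exists d => // N l r hlr tr s; apply: le_lt_trans (hd N l r hlr tr s).
by apply: ler_sum => i _; rewrite -LB.
Qed.

Lemma coordinate_is_derive (V : normedModType R) (L : V -> R) t (f : R -> V) df :
  coordinate L -> is_derive t (1 : R) f df ->
  is_derive t (1 : R) (fun s => L (f s)) (L df).
Proof.
move=> [LB LZ Ln] [fd fE].
have cvL : h^-1 *: (L (f (h *: (1 : R) + t)) - L (f t)) @[h --> 0^'] --> L df.
  have : h^-1 *: (f (h *: (1 : R) + t) - f t) @[h --> 0^'] --> df.
    by rewrite -fE; exact: fd.
  move=> /cvgrPdist_lt hf; apply/cvgrPdist_lt => e e0.
  apply: filterS (hf e e0) => h; apply: le_lt_trans.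
  by rewrite -LB [X in `|_ - X|]/GRing.scale/= -LZ -LB.
apply: DeriveDef; first by apply/cvg_ex; exists (L df).
by apply/cvg_lim; first exact: Rhausdorff.
Qed.

End Coordinates.

Lemma coordinate_mx {R : realType} m n i j :
  coordinate (fun A : 'M[R]_(m, n) => A i j).
Proof.
by split=> [A B|a A|A]; [rewrite !mxE|rewrite mxE|exact: mx_norm_coord].
Qed.

(* The state space is abstracted into a product of arbitrary normed modules:
   on [gstate] itself conversion has to unfold the instances on matrices. *)
Section ProductCoordinates.
Context {R : realType} (U1 U2 U3 U4 U5 U6 : normedModType R).
Local Notation T := (U1 * U2 * U3 * U4 * U5 * U6)%type.

Lemma coordinate_fst (U V : normedModType R) (L : U -> R) : coordinate L ->
  coordinate (fun w : U * V => L w.1).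
Proof.
move=> [LB LZ Ln]; split=> [u v|a v|v]; [exact: LB|exact: LZ|].
exact: le_trans (Ln _) (prod_norm_fst v).
Qed.

Lemma coordinate_snd (U V : normedModType R) (L : V -> R) : coordinate L ->
  coordinate (fun w : U * V => L w.2).
Proof.
move=> [LB LZ Ln]; split=> [u v|a v|v]; [exact: LB|exact: LZ|].
exact: le_trans (Ln _) (prod_norm_snd v).
Qed.

Lemma coordinate_prod1 (L : U1 -> R) : coordinate L ->
  coordinate (fun s : T => L s.1.1.1.1.1).
Proof.
move=> hL.
have h2 := @coordinate_fst U1 U2 L hL.
have h3 := @coordinate_fst (U1 * U2)%type U3 _ h2.
have h4 := @coordinate_fst (U1 * U2 * U3)%type U4 _ h3.
have h5 := @coordinate_fst (U1 * U2 * U3 * U4)%type U5 _ h4.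
exact: (@coordinate_fst (U1 * U2 * U3 * U4 * U5)%type U6 _ h5).
Qed.

Lemma coordinate_prod2 (L : U2 -> R) : coordinate L ->
  coordinate (fun s : T => L s.1.1.1.1.2).
Proof.
move=> hL.
have h2 := @coordinate_snd (U1)%type U2 L hL.
have h3 := @coordinate_fst (U1 * U2)%type U3 _ h2.
have h4 := @coordinate_fst (U1 * U2 * U3)%type U4 _ h3.
have h5 := @coordinate_fst (U1 * U2 * U3 * U4)%type U5 _ h4.
exact: (@coordinate_fst (U1 * U2 * U3 * U4 * U5)%type U6 _ h5).
Qed.

Lemma coordinate_prod3 (L : U3 -> R) : coordinate L ->
  coordinate (fun s : T => L s.1.1.1.2).
Proof.
move=> hL.
have h3 := @coordinate_snd (U1 * U2)%type U3 L hL.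
have h4 := @coordinate_fst (U1 * U2 * U3)%type U4 _ h3.
have h5 := @coordinate_fst (U1 * U2 * U3 * U4)%type U5 _ h4.
exact: (@coordinate_fst (U1 * U2 * U3 * U4 * U5)%type U6 _ h5).
Qed.

Lemma coordinate_prod4 (L : U4 -> R) : coordinate L ->
  coordinate (fun s : T => L s.1.1.2).
Proof.
move=> hL.
have h4 := @coordinate_snd (U1 * U2 * U3)%type U4 L hL.
have h5 := @coordinate_fst (U1 * U2 * U3 * U4)%type U5 _ h4.
exact: (@coordinate_fst (U1 * U2 * U3 * U4 * U5)%type U6 _ h5).
Qed.

Lemma coordinate_prod5 (L : U5 -> R) : coordinate L ->
  coordinate (fun s : T => L s.1.2).
Proof.
move=> hL.
have h5 := @coordinate_snd (U1 * U2 * U3 * U4)%type U5 L hL.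
exact: (@coordinate_fst (U1 * U2 * U3 * U4 * U5)%type U6 _ h5).
Qed.

End ProductCoordinates.

Section StateCoordinates.
Context {R : realType} {n p : nat}.
Local Notation S := (gstate R n p).

Lemma coordinate_x i : coordinate (fun s : S => st_x s i 0).
Proof. exact: coordinate_prod1 (coordinate_mx i 0). Qed.

Lemma coordinate_thetahat i : coordinate (fun s : S => st_thetahat s i 0).
Proof. exact: coordinate_prod2 (coordinate_mx i 0). Qed.

Lemma coordinate_psi i j : coordinate (fun s : S => st_psi s i j).
Proof. exact: coordinate_prod3 (coordinate_mx i j). Qed.

Lemma coordinate_eta i : coordinate (fun s : S => st_eta s i 0).
Proof. exact: coordinate_prod4 (coordinate_mx i 0). Qed.

Lemma coordinate_id : coordinate (fun x : R => x).
Proof. by split. Qed.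

Lemma coordinate_tau : coordinate (@st_tau R n p).
Proof. exact: coordinate_prod5 coordinate_id. Qed.

Lemma coordinate_k : coordinate (@st_k R n p).
Proof. exact: coordinate_snd coordinate_id. Qed.

End StateCoordinates.

Section ErrorSystem.
Context {R : realType} {n p : nat}.
Local Notation mu := (@lebesgue_measure R).

(* The closed loop in the coordinates [theta - thetahat] and
   [epsilon = x + eta - psi theta], from which the plant maps f_c and g_d have
   cancelled. *)
Record error_arc (g : gains R) (phiM : R) (dom : set (R * nat))
    (psi : R * nat -> 'M[R]_(n, p)) (tht : R * nat -> 'cV[R]_p)
    (ep : R * nat -> 'cV[R]_n) : Prop := {
  ea_dom : hybrid_time_domain dom;
  ea_psi_ac : forall j i k,
    loc_abs_continuous (flow_interval dom j) (fun s => psi (s, j) i k);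
  ea_tht_ac : forall j i,
    loc_abs_continuous (flow_interval dom j) (fun s => tht (s, j) i 0);
  ea_ep_ac : forall j i,
    loc_abs_continuous (flow_interval dom j) (fun s => ep (s, j) i 0);
  ea_psi_flow : forall j, {ae mu, forall t, interior (flow_interval dom j) t ->
    exists2 phi : 'M[R]_(n, p), frob_norm phi <= phiM &
    forall i k, is_derive t (1 : R) (fun s => psi (s, j) i k)
      ((- lambda_c g *: psi (t, j) + phi) i k)};
  ea_tht_flow : forall j, {ae mu, forall t, interior (flow_interval dom j) t ->
    forall i, is_derive t (1 : R) (fun s => tht (s, j) i 0)
      ((- gamma_c g *: ((psi (t, j))^T *m (psi (t, j) *m tht (t, j) + ep (t, j)))) i 0)};
  ea_ep_flow : forall j, {ae mu, forall t, interior (flow_interval dom j) t ->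
    forall i, is_derive t (1 : R) (fun s => ep (s, j) i 0)
      (- lambda_c g * ep (t, j) i 0)};
  ea_psi_jump : forall s j, dom (s, j) -> dom (s, j.+1) ->
    exists2 phi : 'M[R]_(n, p), frob_norm phi <= phiM &
    psi (s, j.+1) = (1 - lambda_d g) *: psi (s, j) + phi;
  ea_tht_jump : forall s j, dom (s, j) -> dom (s, j.+1) ->
    tht (s, j.+1) = tht (s, j) -
      (gamma_d g + induced_norm (psi (s, j.+1)) ^+ 2)^-1 *:
      ((psi (s, j.+1))^T *m (psi (s, j.+1) *m tht (s, j) + ep (s, j.+1)));
  ea_ep_jump : forall s j, dom (s, j) -> dom (s, j.+1) ->
    ep (s, j.+1) = (1 - lambda_d g) *: ep (s, j) }.

Lemma itvoo_interior (I : set R) (a b x : R) : `[a, b]%classic `<=` I ->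
  x \in `]a, b[%R -> interior I x.
Proof.
move=> abI xab; have : nbhs x (`]a, b[%classic : set R).
  by apply: open_nbhs_nbhs; split; [exact: interval_open|].
apply: filterS => y /=; rewrite in_itv/= => /andP[ay yb].
by apply: abI; rewrite /= in_itv/= !ltW.
Qed.

Lemma htd_origin (dom : set (R * nat)) z : hybrid_time_domain dom -> dom z ->
  dom (0, 0%N).
Proof.
move=> hdom dz; have [t [t0 _ mono tE]] := htd_arc hdom dz.
have z0 : 0 <= z.1 by case: hdom => + _; apply.
by apply/tE => //; rewrite t0 lexx/= -{1}t0 mono.
Qed.

(** Here [a] stands for the plant map, [b] for the regressor term [phi theta], and [c], [d] for the
    linear parts coming from [x + eta] and [psi theta]. One identity removes the unknown terms from
    [epsilon] both along flows and at jumps. *)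
Lemma plant_cancel (V : zmodType) (a b c d : V) :
  a + b + (c - a) - (d + b) = c - d.
Proof.
have -> : a + b + (c - a) = b + c by rewrite (addrC a b) -addrA (addrC a) subrK.
by rewrite (addrC d) opprD addrACA subrr add0r.
Qed.

Lemma col_addsub_coord k (a b c : 'cV[R]_k) i :
  (a + b - c) i 0 = a i 0 + b i 0 + -1 * c i 0.
Proof. by rewrite !mxE mulN1r. Qed.

(** This expresses the measurable residual [y - psi thetahat] in the error coordinates, as
    [psi tht + ep]. *)
Lemma residual_error (A : 'M[R]_(n, p)) (th thh : 'cV[R]_p) (y : 'cV[R]_n) :
  A *m (th - thh) + (y - A *m th) = y - A *m thh.
Proof. by rewrite mulmxBr addrC addrA subrK. Qed.

Section Solution.
Context {m : nat} (E : set (R * nat)) (P : plant R n p m) (g : gains R).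
Context (dom : set (R * nat)) (xi : R * nat -> gstate R n p).
Hypothesis hsol : Hg_solution E P g dom xi.

(** Only the derivatives and jumps of the clock components are prescribed. On a flow interval
    [tau - t] and [k] are absolutely continuous with zero derivative almost everywhere, hence
    constant. *)
Lemma sol_time z : dom z -> st_tau (xi z) = z.1 /\ st_k (xi z) = z.2%:R.
Proof.
have [sol tau0 k0] := hsol; have hdom := sol_dom sol => dz.
have z0 : 0 <= z.1 by case: hdom => + _; apply.
case: z dz z0 => s1 j1 dz /= z0.
apply: (@hybrid_ind _ dom (0, 0%N) (s1, j1)
  (fun s j => st_tau (xi (s, j)) = s /\ st_k (xi (s, j)) = j%:R)) => //=.
- exact: htd_origin hdom dz.
- move=> j a b _ _ ab _ abd [ta ka].
  have acc L : coordinate L -> loc_abs_continuous `[a, b]%classic (fun s => L (xi (s, j))).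
    by move=> hL; apply: (ac_subset abd); exact: coordinate_ac hL (sol_ac sol (j := j)).
  split.
    have : st_tau (xi (b, j)) + -1 * b = st_tau (xi (a, j)) + -1 * a.
      apply: (@ac_constant _ (fun s => st_tau (xi (s, j)) + -1 * s)) => //.
        apply: ac_add; first exact: acc coordinate_tau.
        by apply: ac_mul; [exact: ac_cst|exact: ac_id].
      apply: (ae_sub (sol_flow sol j)) => x hx /(itvoo_interior abd)/hx h.
      have h1 := coordinate_is_derive coordinate_tau h.
      apply: (is_derive_eq (is_derive1D h1 (is_derive1Z (-1) (is_derive_id x 1)))).
      by rewrite mulr1 /st_tau/= subrr.
    rewrite ta; lra.
  rewrite -ka; apply: (@ac_constant _ (fun s => st_k (xi (s, j)))) => //.
    exact: acc coordinate_k.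
  apply: (ae_sub (sol_flow sol j)) => x hx /(itvoo_interior abd)/hx h.
  exact: coordinate_is_derive coordinate_k h.
move=> s j _ _ _ d0 d1 [ts ks]; have [_ ->] := sol_jump sol (conj d0 d1 : Upsilon dom (s, j)).
by split; [rewrite -[RHS]ts|rewrite -natr1 -ks].
Qed.

(** Membership in [X_g] places the clock reading of the state in [E], and by [sol_time] this reading
    is the actual hybrid time. *)
Lemma sol_subset : dom `<=` E.
Proof.
move=> z dz; have [sol _ _] := hsol; have [tz kz] := sol_time dz.
have [j kj] := sol_state sol dz; rewrite tz.
have -> : j = z.2 by apply/eqP; rewrite -(eqr_nat R) -kj kz.
by rewrite -surjective_pairing.
Qed.

Lemma sol_st_time z : dom z -> st_time (xi z) = z.
Proof.
move=> dz; have [tz kz] := sol_time dz.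
by rewrite /st_time tz kz natrK -surjective_pairing.
Qed.

Lemma sol_error_arc (phiM : R) :
  (forall z, E z -> frob_norm (phi_c P z) <= phiM) ->
  (forall z, Upsilon E z -> frob_norm (phi_d P z) <= phiM) ->
  error_arc g phiM dom (fun z => st_psi (xi z))
    (fun z => theta P - st_thetahat (xi z))
    (fun z => st_x (xi z) + st_eta (xi z) - st_psi (xi z) *m theta P).
Proof.
move=> hc hd; have [sol _ _] := hsol.
have acc j L : coordinate L ->
    loc_abs_continuous (flow_interval dom j) (fun s => L (xi (s, j))).
  by move=> hL; exact: coordinate_ac hL (sol_ac sol (j := j)).
have thtE j i : (fun s => (theta P - st_thetahat (xi (s, j))) i 0) =
    (fun s => theta P i 0 + -1 * st_thetahat (xi (s, j)) i 0).
  by apply/funext => s; rewrite !mxE mulN1r.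
have epE j i : (fun s => (st_x (xi (s, j)) + st_eta (xi (s, j)) -
      st_psi (xi (s, j)) *m theta P) i 0) =
    (fun s => (st_x (xi (s, j)) i 0 + st_eta (xi (s, j)) i 0) +
      -1 * \sum_k (theta P k 0 * st_psi (xi (s, j)) i k)).
  apply/funext => s; rewrite col_addsub_coord; congr (_ + -1 * _).
  by rewrite mxE; apply: eq_bigr => k _; rewrite mulrC.
split.
- exact: sol_dom sol.
- by move=> j i k; exact: acc (coordinate_psi i k).
- move=> j i; rewrite thtE; apply: ac_add; first exact: ac_cst.
  by apply: ac_mul; [exact: ac_cst|exact: acc (coordinate_thetahat i)].
- move=> j i; rewrite epE; apply: ac_add.
    by apply: ac_add; [exact: acc (coordinate_x i)|exact: acc (coordinate_eta i)].
  apply: ac_mul; first exact: ac_cst.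
  by apply: ac_sum => k; apply: ac_mul; [exact: ac_cst|exact: acc (coordinate_psi i k)].
- move=> j; apply: (ae_sub (sol_flow sol j)) => t ht ti.
  have dt : dom (t, j) by exact: interior_subset ti.
  exists (phi_c P (t, j)); first exact/hc/sol_subset.
  move=> i k; apply: (is_derive_eq (coordinate_is_derive (coordinate_psi i k) (ht ti))).
  by rewrite /F_g sol_st_time.
- move=> j; apply: (ae_sub (sol_flow sol j)) => t ht ti i.
  rewrite thtE; apply: (is_derive_eq (is_derive1D (is_derive1_cst _ _)
    (is_derive1Z (-1) (coordinate_is_derive (coordinate_thetahat i) (ht ti))))).
  by rewrite add0r mulN1r residual_error scaleNr [RHS]mxE.
- move=> j; apply: (ae_sub (sol_flow sol j)) => t ht ti i.
  rewrite epE; apply: (is_derive_eq (is_derive1D (is_derive1D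
    (coordinate_is_derive (coordinate_x i) (ht ti))
    (coordinate_is_derive (coordinate_eta i) (ht ti)))
    (is_derive1Z (-1) (is_derive1_sum _ (fun k => is_derive1Z (theta P k 0)
      (coordinate_is_derive (coordinate_psi i k) (ht ti))))))).
  set F := F_g P g (xi (t, j)).
  have -> : \sum_k theta P k 0 * st_psi F i k = (st_psi F *m theta P) i 0.
    by rewrite mxE; apply: eq_bigr => k _; rewrite mulrC.
  rewrite -col_addsub_coord; have -> : st_x F + st_eta F - st_psi F *m theta P = - lambda_c g *:
      (st_x (xi (t, j)) + st_eta (xi (t, j)) - st_psi (xi (t, j)) *m theta P).
    rewrite scalerBr scalemxAl -[RHS](@plant_cancel _
      (f_c P (st_x (xi (t, j))) (input P (st_time (xi (t, j)))))
      (phi_c P (st_time (xi (t, j))) *m theta P)).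
    by rewrite -mulmxDl.
  by rewrite mxE.
- move=> s j d0 d1; have [_ ->] := sol_jump sol (conj d0 d1 : Upsilon dom (s, j)).
  exists (phi_d P (s, j)); first by apply: hd; split; exact: sol_subset.
  by rewrite /G_g sol_st_time.
- move=> s j d0 d1; have [_ ->] := sol_jump sol (conj d0 d1 : Upsilon dom (s, j)).
  rewrite residual_error -[LHS]/(theta P - (st_thetahat (xi (s, j)) + _)).
  by rewrite opprD addrA.
move=> s j d0 d1; have [_ ->] := sol_jump sol (conj d0 d1 : Upsilon dom (s, j)).
rewrite scalerBr scalemxAl -[RHS](@plant_cancel _
  (g_d P (st_x (xi (s, j))) (input P (st_time (xi (s, j)))))
  (phi_d P (st_time (xi (s, j))) *m theta P)).
by rewrite -mulmxDl.
Qed.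

End Solution.
End ErrorSystem.

(** * Contraction over one window of persistent excitation *)

Section ContractionArithmetic.
Context {R : realType}.

(** [Q] is the denominator of [sigma] and [D + 1] the length of a window. With [x = D + 1], the cube
    [(x + 1)^3] exceeds [6 x^2], which supplies the numerical slack; the additive 3 comes from the
    cross term of the square. *)
Lemma contraction_constant_ge (A D : R) : 0 <= A -> 0 < D ->
  let Q := (1 + Num.sqrt ((A + 2) * (D + 2) ^+ 3 * (A * (D + 2) + 2^-1))) ^+ 2 in
  3 + 6 * ((A + 2^-1) * (A + 2) * (D + 1) ^+ 2) <= Q /\
  12 * ((A + 2^-1) * (D + 1)) <= Q.
Proof.
move=> A0 D0 Q; rewrite {}/Q; set x := D + 1; have x1 : 1 <= x by rewrite lerDr ltW.
set X := (A + 2) * _ * _; set Q := (1 + _) ^+ 2.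
have a2 : 0 < A + 2 by rewrite ltr_wpDl.
have ah : 0 < A + 2^-1 by rewrite ltr_wpDl// invr_gt0.
have hc : 6 * x ^+ 2 <= (D + 2) ^+ 3.
  have -> : D + 2 = x + 1 by rewrite /x; ring.
  have : 0 <= (x - 1) ^+ 3 by rewrite exprn_ge0// subr_ge0.
  have -> : (x + 1) ^+ 3 = (x - 1) ^+ 3 + 6 * x ^+ 2 + 2 by ring.
  lra.
have hd : A + 2^-1 <= A * (D + 2) + 2^-1.
  by rewrite lerD2r ler_peMr//; lra.
have hX : 6 * ((A + 2^-1) * (A + 2) * x ^+ 2) <= X.
  apply: (@le_trans _ _ ((A + 2) * (6 * x ^+ 2) * (A + 2^-1))).
    by rewrite le_eqVlt; apply/orP; left; apply/eqP; ring.
  apply: ler_pM => //; [|exact: ltW|by rewrite ler_pM2l].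
  by rewrite mulr_ge0 ?(ltW a2)// mulr_ge0 ?sqr_ge0.
have x2 : x <= x ^+ 2 by rewrite expr2 ler_peMr// (le_trans _ x1).
have hX12 : 12 * ((A + 2^-1) * x) <= X.
  apply: le_trans hX; have -> : 12 * ((A + 2^-1) * x) = 6 * ((A + 2^-1) * 2 * x) by ring.
  rewrite ler_pM2l//; apply: ler_pM => //.
  - by rewrite mulr_ge0// ltW.
  - exact: le_trans x1.
  by rewrite ler_pM2l//; lra.
have X4 : 4 <= X.
  apply: le_trans hX12; have : 2^-1 * 1 <= (A + 2^-1) * x.
    by apply: ler_pM => //; rewrite lerDr.
  lra.
have X0 : 0 <= X by lra.
have s2 : 2 <= Num.sqrt X.
  by rewrite -(ler_sqr (x := 2)) ?nnegrE ?sqrtr_ge0// sqr_sqrtr//; lra.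
have QE : Q = 1 + 2 * Num.sqrt X + X.
  by rewrite /Q sqrrD sqr_sqrtr//; ring.
by rewrite QE; split; lra.
Qed.

(** [N] is the initial norm of [tht], [V] its final square, [F] the accumulated forcing and [Z] the
    dissipation. The excitation hypothesis gives [2 Z >= 3/2 sg N^2 - 2 F^2], and AM-GM gives
    [2 N F <= sg/2 N^2 + 2/sg F^2]. In total [F^2] has the coefficient [2/sg + 3], which is at most
    [5/sg] because [sg <= 1]. *)
Lemma contraction_arith (A D N F Z sg mm V : R) : 0 <= A -> 0 < D -> 0 <= F ->
  0 <= N -> 0 <= Z -> 0 < sg <= 1 ->
  sg * (1 + Num.sqrt ((A + 2) * (D + 2) ^+ 3 * (A * (D + 2) + 2^-1))) ^+ 2 = 2 * mm ->
  mm * N ^+ 2 <= 2 * Z + 2 * (A + 2^-1) *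
     (2 * ((A + 2) * (D + 1)) * Z + 4 * F ^+ 2) * (D + 1) ->
  V <= (N + F) ^+ 2 - 2 * Z ->
  V <= (1 - sg) * N ^+ 2 + 5 / sg * F ^+ 2.
Proof.
move=> A0 D0 F0 N0 Z0 /andP[sg0 sg1] hsg hN hV.
have [] := contraction_constant_ge A0 D0.
set Q := (1 + _) ^+ 2 in hsg *; set M := (A + 2^-1) * (A + 2) * (D + 1) ^+ 2.
set M2 := (A + 2^-1) * (D + 1) => hQ1 hQ2.
have Q0 : 0 < Q.
  apply: lt_le_trans hQ1; rewrite ltr_wpDr// /M mulr_ge0// mulr_ge0 ?sqr_ge0//.
  by rewrite mulr_ge0 ?addr_ge0 ?invr_ge0.
have e1 : 2 * (A + 2^-1) * (2 * ((A + 2) * (D + 1)) * Z + 4 * F ^+ 2) * (D + 1) =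
  4 * M * Z + 8 * M2 * F ^+ 2 by rewrite /M /M2; ring.
have e2 : mm = sg * Q / 2 by rewrite hsg; lra.
rewrite e1 e2 in hN.
have h1 : (2 + 4 * M) * Z <= 2 / 3 * Q * Z by rewrite ler_wpM2r//; lra.
have h2 : 8 * M2 * F ^+ 2 <= 2 / 3 * Q * F ^+ 2 by rewrite ler_wpM2r ?sqr_ge0//; lra.
have h3 : Q * (sg / 2 * N ^+ 2) <= Q * (2 / 3 * (Z + F ^+ 2)) by lra.
rewrite ler_pM2l// in h3.
have h4 : 0 <= (sg / 2 * N - F) ^+ 2 * (2 / sg) by rewrite mulr_ge0 ?sqr_ge0// divr_ge0// ltW.
have sgi : sg * sg^-1 = 1 by rewrite divff// gt_eqF.
have h5 : (sg / 2 * N - F) ^+ 2 * (2 / sg) =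
  sg / 2 * N ^+ 2 * (sg * sg^-1) - 2 * N * F * (sg * sg^-1) + 2 / sg * F ^+ 2.
  by move: (sg^-1) => i; field.
rewrite h5 sgi in h4.
have h6 : F ^+ 2 <= F ^+ 2 * sg^-1.
  by rewrite ler_peMr ?sqr_ge0// -invr1 lef_pV2 ?posrE.
move: hV h3 h4 h6; rewrite sqrrD; lra.
Qed.

End ContractionArithmetic.

(** * Energy and displacement estimates along the error system *)

Section WindowEstimate.
Context {R : realType} {n p : nat}.
Local Notation mu := (@lebesgue_measure R).

Lemma ac_dotv k (I : set R) (u v : R -> 'cV[R]_k) :
  (forall i, loc_abs_continuous I (fun s => u s i 0)) ->
  (forall i, loc_abs_continuous I (fun s => v s i 0)) ->
  loc_abs_continuous I (fun s => dotv (u s) (v s)).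
Proof. by move=> hu hv; apply: ac_sum => i; exact: ac_mul. Qed.

Lemma is_derive1_dotv k (x : R) (u v : R -> 'cV[R]_k) (du dv : 'cV[R]_k) :
  (forall i, is_derive x (1 : R) (fun s => u s i 0) (du i 0)) ->
  (forall i, is_derive x (1 : R) (fun s => v s i 0) (dv i 0)) ->
  is_derive x (1 : R) (fun s => dotv (u s) (v s)) (dotv du (v x) + dotv (u x) dv).
Proof.
move=> hu hv; rewrite -big_split/=; apply: is_derive1_sum => i.
exact: (is_derive1M (hu i) (hv i)).
Qed.

Lemma ae_and (P Q : R -> Prop) : {ae mu, forall x, P x} -> {ae mu, forall x, Q x} ->
  {ae mu, forall x, P x /\ Q x}.
Proof.
by move=> hP hQ; apply: filterS2 hP hQ => //; exact: (ae_filter_ringOfSetsType mu).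
Qed.

Lemma hybrid_nonincreasing (dom : set (R * nat)) z0 z1 (W : R -> nat -> R) :
  hybrid_time_domain dom -> dom z0 -> dom z1 -> z0.1 <= z1.1 -> (z0.2 <= z1.2)%N ->
  (forall j a b, (z0.2 <= j <= z1.2)%N -> z0.1 <= a -> a <= b -> b <= z1.1 ->
    `[a, b]%classic `<=` flow_interval dom j ->
    loc_abs_continuous `[a, b]%classic (W^~ j) /\
    {ae mu, forall x, x \in `]a, b[%R ->
      exists2 dW, is_derive x (1 : R) (W^~ j) dW & dW <= 0}) ->
  (forall s j, (z0.2 <= j < z1.2)%N -> z0.1 <= s -> s <= z1.1 ->
     dom (s, j) -> dom (s, j.+1) -> W s j.+1 <= W s j) ->
  W z1.1 z1.2 <= W z0.1 z0.2.
Proof.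
move=> hdom d0 d1 s01 j01 hflow hjump.
apply: (@hybrid_ind _ dom z0 z1 (fun s j => W s j <= W z0.1 z0.2)) => //.
  move=> j a b hj sa ab bs abd; apply: le_trans.
  have [acW dW] := hflow j a b hj sa ab bs abd.
  exact: (@ac_nonincreasing _ (W^~ j)).
by move=> s j hj h0 h1 ds ds'; apply: le_trans; exact: hjump.
Qed.

Context (g : gains R) (phiM : R) (dom : set (R * nat)).
Context (psi : R * nat -> 'M[R]_(n, p)) (tht : R * nat -> 'cV[R]_p)
  (ep : R * nat -> 'cV[R]_n).
Hypothesis ea : error_arc g phiM dom psi tht ep.
Hypotheses (gc0 : 0 < gamma_c g) (lc0 : 0 < lambda_c g) (gd0 : 0 < gamma_d g).

Let hdom : hybrid_time_domain dom := ea_dom ea.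

Let ac_tht j a b i : `[a, b]%classic `<=` flow_interval dom j ->
  loc_abs_continuous `[a, b]%classic (fun s => tht (s, j) i 0).
Proof. by move=> h; apply: (ac_subset h); exact: (ea_tht_ac ea). Qed.

(** The two conditions on [r] make the Frobenius ball of radius [r] invariant: the first under
    flows, where the damping dominates [phi] at that radius, the second under jumps. *)
Lemma psi_bound (r : R) z : phiM / lambda_c g <= r ->
  `|1 - lambda_d g| * r + phiM <= r ->
  frob_norm (psi (0, 0%N)) <= r -> dom z -> frob_norm (psi z) <= r.
Proof.
move=> hr1 hr2 h0 dz.
have z0 : 0 <= z.1 by case: hdom => + _; apply.
have r0 : 0 <= r := le_trans (frob_ge0 _) h0.
case: z dz z0 => s1 j1 dz /= z0.
apply: (@hybrid_ind _ dom (0, 0%N) (s1, j1) (fun s j => frob_norm (psi (s, j)) <= r)) => //=.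
- exact: htd_origin hdom dz.
- (* Pairing with the fixed matrix [psi (b, j)] gives a scalar linear
     differential inequality, without differentiating the norm. *)
  move=> j a b _ _ ab _ abd ha; set W := psi (b, j); set w := frob_norm W.
  have w0 : 0 <= w by exact: frob_ge0.
  pose c := w * phiM / lambda_c g.
  have : dotm W (psi (b, j)) - c <=
      expR (- lambda_c g * (b - a)) * (dotm W (psi (a, j)) - c).
    apply: (@ac_linear_decay _ (fun s => dotm W (psi (s, j)))) => //.
      apply: (ac_subset abd); apply: ac_sum => i; apply: ac_sum => k.
      by apply: ac_mul; [exact: ac_cst|exact: (ea_psi_ac ea)].
    apply: (ae_sub (ea_psi_flow ea j)) => x hx /(itvoo_interior abd)/hx[phi hphi dpsi].
    exists (dotm W (- lambda_c g *: psi (x, j) + phi)).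
      by apply: is_derive1_sum => i; apply: is_derive1_sum => k; exact: is_derive1Z.
    have hW : dotm W phi <= w * phiM.
      by apply: (le_trans (dotm_le _ _)); rewrite ler_wpM2l.
    rewrite dotmDr dotmZr mulrBr lerD2l mulNr opprK mulrC divfK//.
    by rewrite gt_eqF.
  rewrite -frob_sqr -/w.
  have hWa : dotm W (psi (a, j)) <= w * r.
    by apply: (le_trans (dotm_le _ _)); rewrite ler_wpM2l.
  have hc : c <= w * r by rewrite /c -mulrA ler_wpM2l.
  set e := expR _; have e0 : 0 <= e by exact: expR_ge0.
  have e1 : e <= 1.
    by rewrite /e -expR0 ler_expR mulNr oppr_le0 mulr_ge0 ?subr_ge0// ltW.
  move=> h; have h2 : w ^+ 2 <= w * r.
    have : e * (dotm W (psi (a, j)) - c) <= e * (w * r - c).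
      by rewrite ler_wpM2l// lerB.
    have : e * (w * r - c) <= 1 * (w * r - c) by rewrite ler_wpM2r// subr_ge0.
    by move: h; lra.
  move: w0; rewrite le_eqVlt => /predU1P[<-//|w0].
  by move: h2; rewrite expr2 ler_pM2l.
move=> s j _ _ _ ds ds' hs.
have [phi hphi psiE] := ea_psi_jump ea ds ds'.
set w := frob_norm (psi (s, j.+1)); have w0 : 0 <= w by exact: frob_ge0.
(* As along flows, pairing the update with the new matrix itself bounds the square of its norm by
   [w * r]. *)
have h2 : w ^+ 2 <= w * r.
  rewrite frob_sqr [X in dotm _ X]psiE dotmDr.
  apply: le_trans (lerD (dotm_le _ _) (dotm_le _ _)) _.
  rewrite frob_normZ -/w -mulrDr ler_wpM2l//.
  apply: le_trans hr2; apply: lerD => //.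
  by rewrite ler_wpM2l.
move: w0; rewrite le_eqVlt => /predU1P[<-//|w0].
by move: h2; rewrite expr2 ler_pM2l.
Qed.

(** [exp (2 b (t + j)) |ep|^2] never increases: along flows because [b <= lambda_c], at jumps
    because the second hypothesis bounds its growth factor by 1. *)
Lemma ep_decay (b : R) z0 z1 : b <= lambda_c g ->
  (1 - lambda_d g) ^+ 2 * expR (2 * b) <= 1 ->
  dom z0 -> dom z1 -> z0.1 <= z1.1 -> (z0.2 <= z1.2)%N ->
  eucl_norm (ep z1) <=
    expR (- b * (z1.1 + z1.2%:R - (z0.1 + z0.2%:R))) * eucl_norm (ep z0).
Proof.
move=> hb hbd d0 d1 s01 j01.
pose W s j := expR (2 * b * s) * (expR (2 * b * j%:R) * dotv (ep (s, j)) (ep (s, j))).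
have hW : W z1.1 z1.2 <= W z0.1 z0.2.
  apply: (hybrid_nonincreasing hdom) => //.
    move=> j a b' _ _ ab _ abd.
    have acep i : loc_abs_continuous `[a, b']%classic (fun s => ep (s, j) i 0).
      by apply: (ac_subset abd); exact: (ea_ep_ac ea).
    split.
      apply: ac_mul; first exact: ac_expRZ.
      by apply: ac_mul; [exact: ac_cst|exact: ac_dotv].
    apply: (ae_sub (ea_ep_flow ea j)) => x hx /(itvoo_interior abd)/hx dep.
    have dep' i : is_derive x (1 : R) (fun s => ep (s, j) i 0)
        ((- lambda_c g *: ep (x, j)) i 0) by rewrite mxE.
    pose D := dotv (ep (x, j)) (ep (x, j)).
    eexists.
      exact: (is_derive1M (is_derive1_expRZ (2 * b) x)
        (is_derive1Z (expR (2 * b * j%:R)) (is_derive1_dotv dep' dep'))).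
    rewrite dotvZl dotvZr -/D.
    have -> : 2 * b * expR (2 * b * x) * (expR (2 * b * j%:R) * D) +
      expR (2 * b * x) * (expR (2 * b * j%:R) * (- lambda_c g * D + - lambda_c g * D))
      = expR (2 * b * x) * (expR (2 * b * j%:R) * (2 * (b - lambda_c g) * D)) by ring.
    do 2 apply: (mulr_ge0_le0 (expR_ge0 _)).
    by apply: mulr_le0_ge0; [rewrite pmulr_rle0// subr_le0|exact: dotv_ge0].
  move=> s j _ _ _ ds ds'; rewrite /W (ea_ep_jump ea ds ds') dotvZl dotvZr.
  rewrite -[j.+1%:R]natr1 mulrDr expRD mulr1 ler_wpM2l ?expR_ge0//.
  have -> : expR (2 * b * j%:R) * expR (2 * b) * ((1 - lambda_d g) *
    ((1 - lambda_d g) * dotv (ep (s, j)) (ep (s, j)))) =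
    ((1 - lambda_d g) ^+ 2 * expR (2 * b)) *
     (expR (2 * b * j%:R) * dotv (ep (s, j)) (ep (s, j))) by ring.
  by rewrite ler_piMl// mulr_ge0 ?expR_ge0// dotv_ge0.
rewrite -ler_sqr ?nnegrE ?mulr_ge0 ?eucl_ge0 ?expR_ge0//.
rewrite exprMn -expRM_natr !eucl_sqr.
move: hW; rewrite /W -!surjective_pairing !mulrA -!expRD => hW.
rewrite -(ler_pM2l (expR_gt0 (2 * b * z1.1 + 2 * b * z1.2%:R))).
apply: (le_trans hW); rewrite mulrA -expRD ler_wpM2r ?dotv_ge0// ler_expR.
by rewrite le_eqVlt; apply/orP; left; apply/eqP; ring.
Qed.

Let dV x j := 2 * dotv (tht (x, j)) (- gamma_c g *: ((psi (x, j))^T *m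
     (psi (x, j) *m tht (x, j) + ep (x, j)))).

Let flow_V j : {ae mu, forall x, interior (flow_interval dom j) x ->
  is_derive x (1 : R) (fun s => dotv (tht (s, j)) (tht (s, j))) (dV x j)}.
Proof.
apply: (ae_sub (ea_tht_flow ea j)) => x hx /hx h.
apply: (is_derive_eq (is_derive1_dotv h h)).
by rewrite (dotvC _ (tht (x, j))) -mulr2n -mulr_natl.
Qed.

Context (psiM a e : R).
Hypothesis hpsi : forall z, dom z -> induced_norm (psi z) <= psiM.
Hypotheses (ha1 : gamma_c g * psiM <= a) (ha2 : (2 * Num.sqrt (gamma_d g))^-1 <= a).
Hypothesis e0 : 0 <= e.

Let psiM0 z : dom z -> 0 <= psiM.
Proof. by move=> dz; exact: le_trans (induced_ge0 _) (hpsi dz). Qed.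

Let a0 : 0 <= a.
Proof.
by apply: le_trans ha2; rewrite invr_ge0 mulr_ge0// sqrtr_ge0.
Qed.

Let forcing_flow (w : 'cV[R]_p) z : dom z -> eucl_norm (ep z) <= e ->
  gamma_c g * - dotv w ((psi z)^T *m ep z) <= a * e * eucl_norm w.
Proof.
move=> dz he.
have h1 : - dotv w ((psi z)^T *m ep z) <= eucl_norm w * (psiM * e).
  rewrite lerNl; apply: le_trans (dotv_geN _ _); rewrite lerN2 ler_wpM2l ?eucl_ge0//.
  apply: (le_trans (eucl_trmulmx_induced _ _)).
  by apply: ler_pM => //; [exact: induced_ge0|exact: eucl_ge0|exact: hpsi].
apply: (@le_trans _ _ (gamma_c g * (eucl_norm w * (psiM * e)))).
  by rewrite ler_pM2l.
have -> : gamma_c g * (eucl_norm w * (psiM * e)) =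
  (gamma_c g * psiM) * (e * eucl_norm w) by ring.
by rewrite -(mulrA a) ler_wpM2r// mulr_ge0// eucl_ge0.
Qed.

Let dV_le x j : dom (x, j) -> eucl_norm (ep (x, j)) <= e ->
  dV x j <= - (2 * gamma_c g * eucl_norm (psi (x, j) *m tht (x, j)) ^+ 2) +
            2 * (a * e) * eucl_norm (tht (x, j)).
Proof.
move=> dx he; rewrite /dV dotvZr mulmxDr dotvDr -dotv_mulmx eucl_sqr.
have := forcing_flow (tht (x, j)) dx he; lra.
Qed.

Let G z := (gamma_d g + induced_norm (psi z) ^+ 2)^-1.
Let h z := G z *: ((psi z)^T *m ep z).

Let G0 z : 0 < G z.
Proof. by rewrite invr_gt0 ltr_wpDr// sqr_ge0. Qed.

Let Gc1 z : G z * induced_norm (psi z) ^+ 2 <= 1.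
Proof.
by rewrite mulrC ler_pdivrMr ?mul1r ?lerDr ?(ltW gd0)// ltr_wpDr// sqr_ge0.
Qed.

(** By AM-GM [c / (gamma_d + c^2) <= 1 / (2 sqrt gamma_d)] for every [c >= 0]; this is the second
    term in the maximum defining [a_gain], the first being the gain along flows. *)
Let forcing_jump z : eucl_norm (ep z) <= e -> eucl_norm (h z) <= a * e.
Proof.
move=> he; rewrite eucl_normZ ger0_norm ?(ltW (G0 z))//.
set c := induced_norm (psi z).
have c0 : 0 <= c by exact: induced_ge0.
apply: (@le_trans _ _ (G z * (c * e))).
  rewrite ler_pM2l//; apply: (le_trans (eucl_trmulmx_induced _ _)).
  by rewrite ler_wpM2l.
rewrite mulrA ler_wpM2r//; apply: le_trans ha2.
rewrite /G -/c mulrC ler_pdivrMr; last by rewrite ltr_wpDr// sqr_ge0.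
set q := Num.sqrt (gamma_d g).
have q0 : 0 < q by rewrite sqrtr_gt0.
have -> : gamma_d g = q ^+ 2 by rewrite sqr_sqrtr// ltW.
rewrite mulrC ler_pdivlMr ?mulr_gt0//.
have := sqr_ge0 (q - c); rewrite sqrrB; lra.
Qed.

(** [u] is the update without forcing. Expanding its square gives [- 2 G |psi tht|^2] plus a
    quadratic term, and the normalization [G |psi|^2 <= 1] lets that term consume only half of the
    decrease. *)
Let jump_split s j : dom (s, j) -> dom (s, j.+1) ->
  exists2 u, tht (s, j.+1) = u - h (s, j.+1) &
  eucl_norm u ^+ 2 <= eucl_norm (tht (s, j)) ^+ 2 -
     G (s, j.+1) * eucl_norm (psi (s, j.+1) *m tht (s, j)) ^+ 2.
Proof.
move=> ds ds'; set z := (s, j.+1); set t := tht (s, j).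
exists (t - G z *: ((psi z)^T *m (psi z *m t))).
  by rewrite (ea_tht_jump ea ds ds') mulmxDr scalerDr opprD addrA.
set v := _ *: _; set x := eucl_norm (psi z *m t).
have hv : dotv t v = G z * x ^+ 2 by rewrite dotvZr -dotv_mulmx eucl_sqr.
have hv2 : eucl_norm v ^+ 2 <= G z * x ^+ 2.
  rewrite eucl_normZ ger0_norm ?(ltW (G0 z))// exprMn expr2 -mulrA ler_pM2l//.
  apply: (@le_trans _ _ (G z * (induced_norm (psi z) * x) ^+ 2)).
    rewrite ler_pM2l// ler_sqr ?nnegrE ?eucl_ge0 ?mulr_ge0 ?induced_ge0 ?eucl_ge0//.
    exact: eucl_trmulmx_induced.
  by rewrite exprMn mulrA ler_piMl ?sqr_ge0.
rewrite eucl_sqrD dotvNr eucl_normN hv; lra.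
Qed.

Section Window.
Context (z0 z1 : R * nat).
Hypotheses (d0 : dom z0) (d1 : dom z1) (s01 : z0.1 <= z1.1) (j01 : (z0.2 <= z1.2)%N).
Hypothesis hep : forall z, dom z -> z0.1 <= z.1 <= z1.1 -> (z0.2 <= z.2 <= z1.2)%N ->
  eucl_norm (ep z) <= e.

Let f := a * e.
Let f0 : 0 <= f. Proof. exact: mulr_ge0. Qed.
Let el s (j : nat) := s - z0.1 + (j%:R - z0.2%:R).
(** The linear majorant of the norm of [tht]: the unforced motion does not increase the norm, and
    the forcing adds at most [f] per unit of flow time or per jump. *)
Let l s j := eucl_norm (tht z0) + f * el s j.

Let el_ge0 s j : z0.1 <= s -> (z0.2 <= j)%N -> 0 <= el s j.
Proof. by move=> hs hj; rewrite addr_ge0// subr_ge0// ler_nat. Qed.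

Let tht_growth s j : dom (s, j) -> z0.1 <= s <= z1.1 -> (z0.2 <= j <= z1.2)%N ->
  eucl_norm (tht (s, j)) <= l s j.
Proof.
move=> ds /andP[s0 s1] /andP[j0 j1].
apply: (@hybrid_ind _ dom z0 (s, j) (fun s j => eucl_norm (tht (s, j)) <= l s j)) => //=.
- move=> i x y /andP[i0 i1] x0 xy ys xyd hx.
  have acV : loc_abs_continuous `[x, y]%classic (fun s => dotv (tht (s, i)) (tht (s, i))).
    by apply: ac_dotv => k; exact: ac_tht.
  have hV : {ae mu, forall r, r \in `]x, y[%R ->
      exists2 v, is_derive r (1 : R) (fun s => dotv (tht (s, i)) (tht (s, i))) v &
      v <= 2 * f * Num.sqrt (dotv (tht (r, i)) (tht (r, i)))}.
    apply: (ae_sub (flow_V i)) => r hr rxy; have ri := itvoo_interior xyd rxy.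
    exists (dV r i); first exact: hr.
    have dr : dom (r, i) by exact: interior_subset ri.
    move: rxy; rewrite in_itv/= => /andP[xr ry].
    have he : eucl_norm (ep (r, i)) <= e.
      apply: hep => //=; last by rewrite i0 (leq_trans i1).
      by rewrite (le_trans x0 (ltW xr)) (le_trans (ltW ry) (le_trans ys s1)).
    apply: (le_trans (dV_le dr he)); rewrite -eucl_normE -/f gerDr oppr_le0.
    by rewrite mulr_ge0 ?sqr_ge0// mulr_ge0// ltW.
  have := sqrt_growth xy f0 acV (fun r => dotv_ge0 _) hV.
  rewrite -!eucl_normE; move: hx; rewrite /l /el; lra.
- move=> r i /andP[i0 i1] r0 rs dr dr' hr.
  have [u uE hu] := jump_split dr dr'.
  have he : eucl_norm (ep (r, i.+1)) <= e.
    apply: hep => //=; last by rewrite leqW//= (leq_trans i1).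
    by rewrite r0 (le_trans rs).
  rewrite uE; apply: (le_trans (eucl_triangle _ _)); rewrite eucl_normN.
  have h1 := forcing_jump he.
  have h2 : eucl_norm u <= eucl_norm (tht (r, i)).
    rewrite -ler_sqr ?nnegrE ?eucl_ge0//; apply: (le_trans hu).
    by rewrite gerDl oppr_le0 mulr_ge0 ?sqr_ge0// ltW.
  move: h1 hr; rewrite /l /el -[i.+1%:R]natr1 -/f; lra.
by rewrite /l /el !subrr addr0 mulr0 addr0 -surjective_pairing.
Qed.

Lemma tht_growth_window : eucl_norm (tht z1) <=
  eucl_norm (tht z0) + a * e * (z1.1 - z0.1 + (z1.2%:R - z0.2%:R)).
Proof.
rewrite [X in tht X]surjective_pairing.
by apply: tht_growth; rewrite ?lexx ?leqnn ?s01 ?j01 -?surjective_pairing.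
Qed.

(* [Z] dominates the energy dissipated since [z0]: along the arc it grows at
   least as fast as the integral of [gamma_c |psi tht|^2] plus the sum of
   [G |psi tht|^2 / 2] over the jumps. *)
Let Z s j := 2^-1 * (l s j * l s j + -1 * dotv (tht (s, j)) (tht (s, j))).

Let is_derive_l j r : is_derive r (1 : R) (l^~ j) f.
Proof.
apply: (is_derive_eq (is_derive1D (is_derive1_cst _ r) (is_derive1Z f
  (is_derive1D (is_derive1D (is_derive_id r 1) (is_derive1_cst _ r))
     (is_derive1_cst _ r))))).
by rewrite !addr0 add0r mulr1.
Qed.

Let ac_el I j : loc_abs_continuous I (el^~ j).
Proof.
by apply: ac_add; last exact: ac_cst; apply: ac_add; [exact: ac_id|exact: ac_cst].
Qed.

Let ac_l I j : loc_abs_continuous I (l^~ j).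
Proof.
by apply: ac_add; [exact: ac_cst|apply: ac_mul; [exact: ac_cst|exact: ac_el]].
Qed.

Let window_point j x y r : (z0.2 <= j <= z1.2)%N -> z0.1 <= x -> y <= z1.1 ->
  `[x, y]%classic `<=` flow_interval dom j -> r \in `]x, y[%R ->
  [/\ interior (flow_interval dom j) r, dom (r, j), z0.1 <= r <= z1.1 &
      eucl_norm (ep (r, j)) <= e].
Proof.
move=> hj x0 y1 xyd rxy; have ri := itvoo_interior xyd rxy.
have dr : dom (r, j) by exact: interior_subset ri.
have r01 : z0.1 <= r <= z1.1.
  move: rxy; rewrite in_itv/= => /andP[xr ry].
  by rewrite (le_trans x0 (ltW xr)) (le_trans (ltW ry) y1).
by split => //; exact: hep.
Qed.

(** The forcing contributes at most [f |tht|] to the derivative of half of [|tht|^2]; since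
    [|tht| <= l], this is covered by [f l], the derivative of half of [l^2], and the dissipation is
    left over. *)
Let energy_flow j x y : (z0.2 <= j <= z1.2)%N -> z0.1 <= x -> x <= y -> y <= z1.1 ->
  `[x, y]%classic `<=` flow_interval dom j ->
  loc_abs_continuous `[x, y]%classic (Z^~ j) /\
  {ae mu, forall r, r \in `]x, y[%R -> exists2 dZ, is_derive r (1 : R) (Z^~ j) dZ &
    gamma_c g * eucl_norm (psi (r, j) *m tht (r, j)) ^+ 2 <= dZ}.
Proof.
move=> hj x0 xy y1 xyd; split.
  apply: ac_mul; first exact: ac_cst.
  apply: ac_add; first by apply: ac_mul; exact: ac_l.
  apply: ac_mul; first exact: ac_cst.
  by apply: ac_dotv => k; exact: ac_tht.
apply: (ae_sub (flow_V j)) => r hr rxy.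
have [ri dr r01 he] := window_point hj x0 y1 xyd rxy.
eexists.
  exact: (is_derive1Z 2^-1 (is_derive1D (is_derive1M (is_derive_l j r) (is_derive_l j r))
    (is_derive1Z (-1) (hr ri)))).
have h1 := dV_le dr he.
have : f * eucl_norm (tht (r, j)) <= f * l r j by rewrite ler_wpM2l// tht_growth.
move: h1; rewrite -/f; lra.
Qed.

(** The discrete counterpart: passing from [l] to [l + f] adds [2 f l + f^2] to [l^2], and the
    forcing adds at most [2 f |u| + f^2] to [|u|^2], with [|u| <= l]. *)
Let energy_jump s j : (z0.2 <= j < z1.2)%N -> z0.1 <= s -> s <= z1.1 ->
  dom (s, j) -> dom (s, j.+1) ->
  2^-1 * (G (s, j.+1) * eucl_norm (psi (s, j.+1) *m tht (s, j)) ^+ 2)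
    <= Z s j.+1 - Z s j.
Proof.
move=> /andP[j0 j1] s0 s1 ds ds'.
have [u uE hu] := jump_split ds ds'.
set B := eucl_norm (psi (s, j.+1) *m tht (s, j)) in hu *.
have he : eucl_norm (ep (s, j.+1)) <= e by apply: hep => //=; rewrite ?s0// leqW.
have h1 := forcing_jump he.
have hl : eucl_norm (tht (s, j)) <= l s j by apply: tht_growth; rewrite ?s0 ?j0 ?(ltnW j1).
have hut : eucl_norm u <= eucl_norm (tht (s, j)).
  rewrite -ler_sqr ?nnegrE ?eucl_ge0//; apply: (le_trans hu).
  by rewrite gerDl oppr_le0 mulr_ge0 ?sqr_ge0// ltW.
have hlE : l s j.+1 = l s j + f by rewrite /l /el -[j.+1%:R]natr1; ring.
have ht : eucl_norm (tht (s, j.+1)) <= eucl_norm u + f.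
  by rewrite uE; apply: (le_trans (eucl_triangle _ _)); rewrite eucl_normN lerD2l.
have ht2 : dotv (tht (s, j.+1)) (tht (s, j.+1)) <= (eucl_norm u + f) ^+ 2.
  by rewrite -eucl_sqr ler_sqr ?nnegrE ?eucl_ge0// addr_ge0// eucl_ge0.
rewrite /Z hlE; rewrite (eucl_sqr (tht (s, j))) (eucl_sqr u) in hu.
have : f * eucl_norm u <= f * l s j by rewrite ler_wpM2l// (le_trans hut).
have hu2 := eucl_sqr u.
move: hu ht2; rewrite sqrrD hu2; lra.
Qed.

Let Z0 : Z z0.1 z0.2 = 0.
Proof.
rewrite /Z /l /el !subrr addr0 mulr0 addr0 -surjective_pairing -eucl_sqr; ring.
Qed.

Let Z_mono s j s' j' : dom (s, j) -> dom (s', j') -> z0.1 <= s -> s <= s' -> s' <= z1.1 ->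
  (z0.2 <= j)%N -> (j <= j')%N -> (j' <= z1.2)%N -> Z s j <= Z s' j'.
Proof.
move=> ds ds' s0 ss' s1 j0 jj' j1; rewrite -lerN2 -[- Z s j]mulN1r -[- Z s' j']mulN1r.
apply: (@hybrid_nonincreasing dom (s, j) (s', j') (fun s j => -1 * Z s j)) => //=.
  move=> i x y /andP[i0 i1] x0 xy y1 xyd.
  have hi : (z0.2 <= i <= z1.2)%N by rewrite (leq_trans j0 i0) (leq_trans i1 j1).
  have [acZ dZ] := energy_flow hi (le_trans s0 x0) xy (le_trans y1 s1) xyd.
  split; first by apply: ac_mul; [exact: ac_cst|].
  apply: (ae_sub dZ) => r hr /hr[v hv vge]; exists (-1 * v); first exact: is_derive1Z.
  rewrite mulN1r oppr_le0; apply: le_trans vge.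
  by rewrite mulr_ge0 ?sqr_ge0// ltW.
move=> r i /andP[i0 i1] r0 r1 dr dr'; rewrite !mulN1r lerN2 -subr_ge0.
have hi : (z0.2 <= i < z1.2)%N by rewrite (leq_trans j0 i0) (leq_trans i1 j1).
apply: le_trans (energy_jump hi (le_trans s0 r0) (le_trans r1 s1) dr dr').
by rewrite mulr_ge0 ?invr_ge0// mulr_ge0 ?sqr_ge0// ltW.
Qed.

Let aM := gamma_c g * psiM ^+ 2.

Let aM0 : 0 <= aM.
Proof. by rewrite mulr_ge0 ?sqr_ge0// ltW. Qed.

(* The rates of the linear functional [dotv w tht] are split by AM-GM between
   [|w|^2] and the growth of [Z]; [w] is later taken to be the displacement. *)
Let displacement_functional (w : 'cV[R]_p) (be : R) s j : 0 < be -> dom (s, j) ->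
  z0.1 <= s <= z1.1 -> (z0.2 <= j <= z1.2)%N ->
  dotv w (tht (s, j) - tht z0) <=
    (be / 2 * (aM + 2) * eucl_norm w ^+ 2 + f * eucl_norm w) * el s j
    + (2 * be)^-1 * Z s j.
Proof.
move=> be0 ds /andP[s0 s1] /andP[j0 j1].
set K := be / 2 * _ * _ + _; set k := (2 * be)^-1.
have kbe : k * be = 2^-1 by rewrite /k invfM -mulrA mulVf ?mulr1// gt_eqF.
have k0 : 0 < k by rewrite invr_gt0 mulr_gt0.
have young A B C : 0 <= C -> C * (A * B) <= C * (be / 2 * A ^+ 2) + k * (C * B ^+ 2).
  move=> C0.
  have : 0 <= C * k * (be * A - B) ^+ 2.
    by rewrite mulr_ge0 ?sqr_ge0// mulr_ge0// ltW.
  have -> : C * k * (be * A - B) ^+ 2 = C * A ^+ 2 * be * (k * be)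
    - 2 * C * A * B * (k * be) + k * (C * B ^+ 2) by ring.
  rewrite kbe; lra.
pose W s j := dotv w (tht (s, j)) + -1 * (K * el s j + k * Z s j).
have : W s j <= W z0.1 z0.2.
  apply: (@hybrid_nonincreasing dom z0 (s, j) W) => //=.
    move=> i x y /andP[i0 i1] x0 xy ys xyd.
    have hi : (z0.2 <= i <= z1.2)%N by rewrite i0 (leq_trans i1 j1).
    have y1 := le_trans ys s1.
    have [acZ dZ] := energy_flow hi x0 xy y1 xyd.
    split.
      apply: ac_add.
        by apply: ac_dotv => q; [exact: ac_cst|exact: ac_tht].
      apply: ac_mul; first exact: ac_cst.
      apply: ac_add; first by apply: ac_mul; [exact: ac_cst|exact: ac_el].
      by apply: ac_mul; first exact: ac_cst.
    apply: (ae_sub (ae_and dZ (ea_tht_flow ea i))) => r [hr ht] rxy.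
    have [ri dr r01 he] := window_point hi x0 y1 xyd rxy.
    have [v hv vge] := hr rxy.
    have del : is_derive r (1 : R) (el^~ i) 1.
      apply: (is_derive_eq (is_derive1D (is_derive1D (is_derive_id r 1)
        (is_derive1_cst _ r)) (is_derive1_cst _ r))).
      by rewrite !addr0.
    have dw q : is_derive r (1 : R) (fun=> w q 0) ((0 : 'cV[R]_p) q 0).
      by rewrite mxE; exact: is_derive1_cst.
    eexists.
      exact: (is_derive1D (is_derive1_dotv dw (ht ri))
        (is_derive1Z (-1) (is_derive1D (is_derive1Z K del) (is_derive1Z k hv)))).
    have -> : dotv 0 (tht (r, i)) = 0 by rewrite -(scale0r 0) dotvZl mul0r.
    rewrite dotvZr mulmxDr dotvDr -dotv_mulmx.
    have h1 := forcing_flow w dr he.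
    have h2 := dotv_geN (psi (r, i) *m w) (psi (r, i) *m tht (r, i)).
    have psi0 := psiM0 dr.
    have h3 : eucl_norm (psi (r, i) *m w) <= psiM * eucl_norm w.
      apply: (le_trans (eucl_mulmx_induced _ _)).
      by rewrite ler_wpM2r ?eucl_ge0// hpsi.
    set B := eucl_norm (psi (r, i) *m tht (r, i)) in h2 vge *.
    have B0 : 0 <= B by exact: eucl_ge0.
    have h4 : eucl_norm (psi (r, i) *m w) * B <= psiM * eucl_norm w * B.
      by rewrite ler_wpM2r.
    have h5 := young (psiM * eucl_norm w) B (gamma_c g) (ltW gc0).
    have h6 : gamma_c g * - dotv (psi (r, i) *m w) (psi (r, i) *m tht (r, i)) <=
        gamma_c g * (psiM * eucl_norm w * B).
      by rewrite ler_pM2l// lerNl; apply: le_trans h2; rewrite lerN2.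
    have h7 : k * (gamma_c g * B ^+ 2) <= k * v by rewrite ler_pM2l.
    have h8 : 0 <= be * eucl_norm w ^+ 2 by rewrite mulr_ge0 ?sqr_ge0// ltW.
    have h9 : gamma_c g * (be / 2 * (psiM * eucl_norm w) ^+ 2) =
       be / 2 * aM * eucl_norm w ^+ 2 by rewrite /aM; ring.
    rewrite h9 in h5; move: h1 h5 h6 h7 h8; rewrite /K -/f; lra.
  move=> r i /andP[i0 i1] r0 rs dr dr'.
  have hi : (z0.2 <= i < z1.2)%N by rewrite i0 (leq_trans i1 j1).
  have r1 := le_trans rs s1.
  have he : eucl_norm (ep (r, i.+1)) <= e.
    by apply: hep => //=; [rewrite r0|rewrite leqW// (leq_trans i1 j1)].
  have hZ := energy_jump hi r0 r1 dr dr'.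
  have h1 : - dotv w (h (r, i.+1)) <= f * eucl_norm w.
    rewrite lerNl; apply: le_trans (dotv_geN _ _); rewrite lerN2 mulrC.
    by rewrite ler_wpM2r ?eucl_ge0// forcing_jump.
  set B := eucl_norm (psi (r, i.+1) *m tht (r, i)) in hZ *.
  have B0 : 0 <= B by exact: eucl_ge0.
  set c := induced_norm (psi (r, i.+1)).
  have c0 : 0 <= c by exact: induced_ge0.
  set q := G (r, i.+1) in hZ *.
  have q0 : 0 < q by exact: G0.
  have h3 : eucl_norm (psi (r, i.+1) *m w) <= c * eucl_norm w.
    exact: eucl_mulmx_induced.
  have h2 : - (q * dotv (psi (r, i.+1) *m w) (psi (r, i.+1) *m tht (r, i))) <=
      q * (c * eucl_norm w * B).
    rewrite -mulrN ler_pM2l// lerNl; apply: le_trans (dotv_geN _ _).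
    by rewrite lerN2 ler_wpM2r.
  (* At a jump [Z] gains only half of [q B^2], so the AM-GM weight is doubled. With [q c^2 <= 1] the
     cost is [be |w|^2], which is the origin of the 2 in [aM + 2]; the [aM] is the cost along
     flows. *)
  have h5 : q * (c * eucl_norm w * B) <=
      be * (q * c ^+ 2) * eucl_norm w ^+ 2 + k * (2^-1 * (q * B ^+ 2)).
    have : 0 <= q * k * (2 * be * (c * eucl_norm w) - B) ^+ 2.
      by rewrite mulr_ge0 ?sqr_ge0// mulr_ge0// ltW.
    have -> : q * k * (2 * be * (c * eucl_norm w) - B) ^+ 2 =
      4 * q * (c * eucl_norm w) ^+ 2 * be * (k * be)
      - 4 * (q * (c * eucl_norm w * B)) * (k * be) + k * (q * B ^+ 2) by ring.
    rewrite kbe exprMn; lra.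
  have h6 : be * (q * c ^+ 2) * eucl_norm w ^+ 2 <= be * 1 * eucl_norm w ^+ 2.
    by rewrite ler_wpM2r ?sqr_ge0// ler_pM2l// Gc1.
  have h7 : k * (2^-1 * (q * B ^+ 2)) <= k * (Z r i.+1 - Z r i) by rewrite ler_pM2l.
  have h8 : 0 <= be * aM * eucl_norm w ^+ 2.
    by rewrite mulr_ge0 ?sqr_ge0// mulr_ge0// ltW.
  have thtE : dotv w (tht (r, i.+1)) = dotv w (tht (r, i)) -
      q * dotv (psi (r, i.+1) *m w) (psi (r, i.+1) *m tht (r, i)) - dotv w (h (r, i.+1)).
    rewrite (ea_tht_jump ea dr dr') mulmxDr scalerDr opprD addrA !dotvDr !dotvNr.
    by rewrite [dotv w (_ *: ((psi (r, i.+1))^T *m (psi (r, i.+1) *m _)))]dotvZr -dotv_mulmx.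
  rewrite /W thtE.
  have elE : el r i.+1 = el r i + 1 by rewrite /el -[i.+1%:R]natr1; ring.
  rewrite elE; move: h1 h2 h5 h6 h7 h8; rewrite /K; lra.
rewrite /W Z0 mulr0 /el !subrr !addr0 !mulr0 addr0 -surjective_pairing dotvDr dotvNr.
rewrite -/(el s j); lra.
Qed.

Context (L : R).
Hypotheses (L0 : 0 < L) (hL : el z1.1 z1.2 <= L).

Let Z1 := Z z1.1 z1.2.
Let B2 := 2 * ((aM + 2) * L) * Z1 + 4 * (f * L) ^+ 2.

Let el_le s j : s <= z1.1 -> (j <= z1.2)%N -> el s j <= L.
Proof.
move=> hs hj; apply: le_trans hL; rewrite /el.
have : j%:R <= z1.2%:R :> R by rewrite ler_nat.
lra.
Qed.

Let Z_le s j : dom (s, j) -> z0.1 <= s <= z1.1 -> (z0.2 <= j <= z1.2)%N -> Z s j <= Z1.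
Proof.
move=> ds /andP[s0 s1] /andP[j0 j1]; apply: Z_mono => //.
by rewrite -surjective_pairing.
Qed.

Let Z1_ge0 : 0 <= Z1.
Proof. by rewrite -Z0; apply: Z_le; rewrite ?lexx ?leqnn ?s01 ?j01// -surjective_pairing. Qed.

Let B2_ge0 : 0 <= B2.
Proof.
apply: addr_ge0; last by rewrite mulr_ge0// sqr_ge0.
by rewrite mulr_ge0// mulr_ge0// mulr_ge0 ?(ltW L0)// addr_ge0.
Qed.

(** With [w] the displacement itself, the functional equals [|w|^2]. The weight
    [be = 1 / ((aM + 2) L)] turns the quadratic cost over the window into half of [|w|^2], which is
    absorbed; the linear term [f L |w|] is absorbed by a further AM-GM. *)
Let displacement s j : dom (s, j) -> z0.1 <= s <= z1.1 -> (z0.2 <= j <= z1.2)%N ->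
  eucl_norm (tht (s, j) - tht z0) ^+ 2 <= B2.
Proof.
move=> ds hs hj; set w := tht (s, j) - tht z0; set x := eucl_norm w.
have x0 : 0 <= x by exact: eucl_ge0.
have a20 : 0 < aM + 2 by rewrite ltr_wpDl.
set k2 := (aM + 2) * L; have k20 : 0 < k2 by rewrite mulr_gt0.
have k2i0 : 0 < k2^-1 by rewrite invr_gt0.
have := displacement_functional w k2i0 ds hs hj.
rewrite -/w -eucl_sqr -/x.
have -> : (2 * k2^-1)^-1 = k2 / 2 by rewrite invfM invrK mulrC.
set K := k2^-1 / 2 * _ * _ + _.
have K0 : 0 <= K.
  apply: addr_ge0; last by rewrite mulr_ge0.
  by rewrite mulr_ge0 ?sqr_ge0// mulr_ge0 ?(ltW a20)// divr_ge0// ltW.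
have h1 : K * el s j <= K * L.
  by rewrite ler_wpM2l// el_le//; [case/andP: hs|case/andP: hj].
have h2 : K * L = 2^-1 * x ^+ 2 + f * L * x.
  have e1 : k2^-1 * k2 = 1 by rewrite mulVf// gt_eqF.
  have -> : K * L = 2^-1 * (k2^-1 * k2) * x ^+ 2 + f * L * x by rewrite /K /k2; ring.
  by rewrite e1 mulr1.
have h3 : k2 / 2 * Z s j <= k2 / 2 * Z1 by rewrite ler_pM2l ?divr_gt0// Z_le.
have h4 := sqr_ge0 (x / 2 - f * L).
move: h1 h2 h3 h4; rewrite /B2 -/k2 sqrrB; lra.
Qed.

Context (m : R).
Hypotheses (m0 : 0 < m) (hm1 : m <= gamma_c g)
  (hm2 : m <= (2 * (gamma_d g + psiM ^+ 2))^-1).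

Let window_gramian_le (E : set (R * nat)) : hybrid_time_domain E -> dom `<=` E ->
  m * ((tht z0)^T *m hybrid_gramian E psi z0 z1 *m tht z0) 0 0 <=
    2 * Z1 + 2 * (aM + 2^-1) * B2 * L.
Proof.
(* The exchange of vectors costs at most [2 aM B2] per unit of flow time and [B2] per jump; [K] is
   the sum of both, so it serves for either kind of step. *)
move=> hE domE; set v := tht z0; set K := 2 * (aM + 2^-1) * B2.
have K0 : 0 <= K by rewrite mulr_ge0// mulr_ge0// addr_ge0// invr_ge0.
have mi0 : 0 < m^-1 by rewrite invr_gt0.
(* Replacing [tht z0] by [tht] in [|psi (tht z0)|^2] costs at most [B2], and
   what remains is dissipation, hence accounted for by [Z]. *)
pose H s j := m^-1 * (-2 * Z s j + - K * el s j).
have key (A : 'M[R]_(n, p)) s j : dom (s, j) -> z0.1 <= s <= z1.1 ->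
    (z0.2 <= j <= z1.2)%N ->
    eucl_norm (A *m v) ^+ 2 <= 2 * eucl_norm (A *m tht (s, j)) ^+ 2 +
      2 * (induced_norm A ^+ 2 * B2).
  move=> ds hs hj; apply: (le_trans (eucl_sub_sqr (A *m v) (A *m tht (s, j)))).
  rewrite lerD2l ler_pM2l// -mulmxBr -eucl_normN -mulmxN opprB.
  apply: (@le_trans _ _ ((induced_norm A * eucl_norm (tht (s, j) - v)) ^+ 2)).
    rewrite ler_sqr ?nnegrE ?eucl_ge0 ?mulr_ge0 ?induced_ge0 ?eucl_ge0//.
    exact: eucl_mulmx_induced.
  by rewrite exprMn ler_wpM2l ?sqr_ge0// displacement.
have hgram : (v^T *m hybrid_gramian E psi z0 z1 *m v) 0 0 <= H z0.1 z0.2 - H z1.1 z1.2.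
  apply: (hybrid_gramian_le hE hdom domE d0 d1 s01 j01).
  - by move=> j i k; exact: (ea_psi_ac ea).
  - move=> j x y hj x0 xy y1 xyd.
    have [acZ dZ] := energy_flow hj x0 xy y1 xyd.
    split.
      apply: ac_mul; first exact: ac_cst.
      apply: ac_add; first by apply: ac_mul; first exact: ac_cst.
      by apply: ac_mul; [exact: ac_cst|exact: ac_el].
    apply: (ae_sub dZ) => r hr rxy.
    have [ri dr r01 he] := window_point hj x0 y1 xyd rxy.
    have [u hu uge] := hr rxy.
    have del : is_derive r (1 : R) (el^~ j) 1.
      apply: (is_derive_eq (is_derive1D (is_derive1D (is_derive_id r 1)
        (is_derive1_cst _ r)) (is_derive1_cst _ r))).
      by rewrite !addr0.
    eexists.
      exact: (is_derive1Z m^-1 (is_derive1D (is_derive1Z (-2) hu)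
        (is_derive1Z (- K) del))).
    rewrite -lerN2 opprK -mulrN [leRHS]mulrC ler_pdivlMr// mulrC.
    apply: (@le_trans _ _ (gamma_c g * eucl_norm (psi (r, j) *m v) ^+ 2)).
      by rewrite ler_wpM2r ?sqr_ge0.
    have h1 := key (psi (r, j)) r j dr r01 hj.
    have h2 : induced_norm (psi (r, j)) ^+ 2 * B2 <= psiM ^+ 2 * B2.
      rewrite ler_wpM2r// ler_sqr ?nnegrE ?induced_ge0 ?(psiM0 dr)//.
      exact: hpsi.
    have h3 : gamma_c g * eucl_norm (psi (r, j) *m v) ^+ 2 <= gamma_c g *
        (2 * eucl_norm (psi (r, j) *m tht (r, j)) ^+ 2 + 2 * (psiM ^+ 2 * B2)).
      by rewrite ler_pM2l//; apply: (le_trans h1); rewrite lerD2l ler_pM2l.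
    apply: (le_trans h3).
    have h4 : gamma_c g * (2 * (psiM ^+ 2 * B2)) = 2 * aM * B2 by rewrite /aM; ring.
    rewrite mulrDr h4; move: uge B2_ge0; rewrite /K; lra.
  move=> s j hj s0 s1 ds ds'; have /andP[j0 j1] := hj.
  have hZ := energy_jump hj s0 s1 ds ds'.
  set A := psi (s, j.+1) in hZ *; set q := G (s, j.+1) in hZ *.
  have q0 : 0 < q by exact: G0.
  have hs : z0.1 <= s <= z1.1 by rewrite s0.
  have hj' : (z0.2 <= j <= z1.2)%N by rewrite j0 ltnW.
  have h1 := key A s j ds hs hj'.
  have mq : m <= 2^-1 * q.
    apply: (le_trans hm2); rewrite invfM ler_pM2l ?invr_gt0//.
    rewrite /q /G lef_pV2 ?posrE ?ltr_wpDr ?sqr_ge0// lerD2l.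
    by rewrite ler_sqr ?nnegrE ?induced_ge0 ?(psiM0 ds')// hpsi.
  have h2 : m * eucl_norm (A *m v) ^+ 2 <= 2^-1 * q *
      (2 * eucl_norm (A *m tht (s, j)) ^+ 2 + 2 * (induced_norm A ^+ 2 * B2)).
    by rewrite ler_pM ?sqr_ge0// ltW.
  have h3 : q * induced_norm A ^+ 2 * B2 <= 1 * B2 by rewrite ler_wpM2r// Gc1.
  have h5 : 0 <= aM * B2 by rewrite mulr_ge0.
  have elE : el s j.+1 = el s j + 1 by rewrite /el -[j.+1%:R]natr1; ring.
  rewrite /H elE -subr_ge0.
  set Y := eucl_norm (A *m v) ^+ 2 in h2 *.
  have -> : m^-1 * (-2 * Z s j + - K * el s j) - Y -
      m^-1 * (-2 * Z s j.+1 + - K * (el s j + 1)) =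
      m^-1 * (2 * (Z s j.+1 - Z s j) + K - m * Y) + (m^-1 * m - 1) * Y by ring.
  rewrite mulVf ?gt_eqF// subrr mul0r addr0 mulr_ge0 ?(ltW mi0)// subr_ge0.
  apply: (le_trans h2); move: hZ h3 h5; rewrite /K; lra.
have := hgram; rewrite -(ler_pM2l m0) => {}hgram.
apply: (le_trans hgram).
have -> : m * (H z0.1 z0.2 - H z1.1 z1.2) = (m * m^-1) * (2 * (Z1 - Z z0.1 z0.2) +
    K * (el z1.1 z1.2 - el z0.1 z0.2)) by rewrite /H /Z1; ring.
rewrite divff ?gt_eqF// mul1r Z0 subr0.
have -> : el z0.1 z0.2 = 0 by rewrite /el !subrr addr0.
by rewrite subr0 lerD2l ler_wpM2l.
Qed.

(** By definition of [Z] the final [|tht|^2] equals [l^2 - 2 Z1], so the lower bound on [Z1] forced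
    by excitation turns directly into contraction. *)
Lemma window_contraction (E : set (R * nat)) (muE D sg : R) :
  hybrid_time_domain E -> dom `<=` E -> 0 < D -> L = D + 1 -> 0 < sg <= 1 ->
  sg * (1 + Num.sqrt ((aM + 2) * (D + 2) ^+ 3 * (aM * (D + 2) + 2^-1))) ^+ 2 =
    2 * (m * muE) ->
  muE * eucl_norm (tht z0) ^+ 2 <=
    ((tht z0)^T *m hybrid_gramian E psi z0 z1 *m tht z0) 0 0 ->
  eucl_norm (tht z1) ^+ 2 <=
    (1 - sg) * eucl_norm (tht z0) ^+ 2 + 5 / sg * (a * e * L) ^+ 2.
Proof.
move=> hE domE D0 LE sg01 hsg hPE.
have := le_trans (ler_wpM2l (ltW m0) hPE) (window_gramian_le hE domE).
rewrite mulrA => hN.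
have V1 : eucl_norm (tht z1) ^+ 2 = l z1.1 z1.2 ^+ 2 - 2 * Z1.
  by rewrite /Z1 /Z -surjective_pairing -eucl_sqr; field.
have F0 : 0 <= f * L by rewrite mulr_ge0// ltW.
apply: (contraction_arith aM0 D0 F0 (eucl_ge0 (tht z0)) Z1_ge0 sg01 hsg).
  by move: hN; rewrite /B2 LE.
rewrite V1 lerD2r ler_sqr ?nnegrE.
- by rewrite lerD2l ler_wpM2l.
- by rewrite addr_ge0 ?eucl_ge0// mulr_ge0// el_ge0.
by rewrite addr_ge0 ?eucl_ge0.
Qed.

End Window.
End WindowEstimate.

(** * Iteration over windows *)

Section Iteration.
Context {R : realType} {n p : nat}.
Context (g : gains R) (phiM : R) (E dom : set (R * nat)).
Context (psi : R * nat -> 'M[R]_(n, p)) (tht : R * nat -> 'cV[R]_p)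
  (ep : R * nat -> 'cV[R]_n).
Hypothesis ea : error_arc g phiM dom psi tht ep.
Hypotheses (gc0 : 0 < gamma_c g) (gd0 : 0 < gamma_d g).
Context (psiM a m muE D sg : R).
Hypothesis hpsi : forall z, dom z -> induced_norm (psi z) <= psiM.
Hypotheses (ha1 : gamma_c g * psiM <= a) (ha2 : (2 * Num.sqrt (gamma_d g))^-1 <= a).
Hypotheses (m0 : 0 < m) (hm1 : m <= gamma_c g)
  (hm2 : m <= (2 * (gamma_d g + psiM ^+ 2))^-1).
Hypotheses (hE : hybrid_time_domain E) (domE : dom `<=` E).
Hypotheses (D0 : 0 < D) (sg0 : 0 < sg) (sg1 : sg <= 1).
Let aM := gamma_c g * psiM ^+ 2.
Hypothesis hsg :
  sg * (1 + Num.sqrt ((aM + 2) * (D + 2) ^+ 3 * (aM * (D + 2) + 2^-1))) ^+ 2 =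
    2 * (m * muE).
Hypothesis hPE : persistently_exciting E dom psi D muE.
Context (b lam r : R).
Hypotheses (b0 : 0 <= b) (hb : b <= lambda_c g)
  (hbd : (1 - lambda_d g) ^+ 2 * expR (2 * b) <= 1).
Hypotheses (lam0 : 0 <= lam) (lamb : lam <= b) (hlam : lam * (D + 1) <= sg / 8).
Hypothesis hr : (D + 1) / sg <= r.

Let hdom : hybrid_time_domain dom := ea_dom ea.
Let T (z : R * nat) : R := z.1 + z.2%:R.
Let V z := eucl_norm (tht z) ^+ 2.
Let y z := expR (2 * lam * T z) * V z.
Let e0 := eucl_norm (ep (0, 0%N)).
(** A level that no window lets [y] exceed. One window multiplies [y] by at most [1 - sg / 2] and
    adds at most [10 sg B^2] with [B = a r e0]; the coefficient 20 makes the addition at most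
    [sg / 2] times [Y]. *)
Let Y := y (0, 0%N) + 20 * (a * r * e0) ^+ 2.
Let L := D + 1.

Let a0 : 0 <= a.
Proof. by apply: le_trans ha2; rewrite invr_ge0 mulr_ge0// sqrtr_ge0. Qed.

Let L0 : 0 < L. Proof. by rewrite ltr_wpDr. Qed.

Let Lr : L <= sg * r.
Proof. by rewrite mulrC -ler_pdivrMr. Qed.

Let r0 : 0 <= r.
Proof. by apply: le_trans hr; rewrite divr_ge0// ltW. Qed.

Let V_ge0 z : 0 <= V z. Proof. exact: sqr_ge0. Qed.

Lemma ep_decay_origin z : dom z -> eucl_norm (ep z) <= expR (- b * T z) * e0.
Proof.
move=> dz; have z0 : 0 <= z.1 by case: hdom => + _; apply.
have := ep_decay ea hb hbd (htd_origin hdom dz) dz z0 (leq0n _).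
by rewrite /= addr0 subr0.
Qed.

Let ep_window z0 z : dom z0 -> dom z -> z0.1 <= z.1 -> (z0.2 <= z.2)%N ->
  eucl_norm (ep z) <= expR (- b * T z0) * e0.
Proof.
move=> d0 dz s0 j0; apply: (le_trans (ep_decay_origin dz)).
rewrite ler_wpM2r ?eucl_ge0// ler_expR !mulNr lerN2 ler_wpM2l//.
by rewrite lerD// ler_nat.
Qed.

(** From [lam L <= sg / 8] the weight is at most [exp (sg / 4) <= 1 / (1 - sg / 4)], and
    [1 - sg <= (1 - sg / 4) (1 - sg / 2)]: half of the contraction survives the exponential
    weight. *)
Let expR_window d : d <= L ->
  expR (2 * lam * d) * (1 - sg) <= 1 - sg / 2 /\ expR (2 * lam * d) <= 2.
Proof.
move=> dL; have h1 : expR (2 * lam * d) <= expR (sg / 4).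
  rewrite ler_expR; apply: (@le_trans _ _ (2 * (lam * L))).
    by rewrite -mulrA ler_pM2l// ler_wpM2l.
  by move: hlam; rewrite -/L; lra.
have h2 : expR (sg / 4) * (1 - sg / 4) <= 1.
  have := expR_ge1Dx (- (sg / 4)); rewrite expRN => h.
  by rewrite mulrC -ler_pdivlMr ?expR_gt0// mul1r.
set q := expR (2 * lam * d) in h1 *.
have q0 : 0 < q by exact: expR_gt0.
have h3 : q * (1 - sg / 4) <= 1.
  by apply: le_trans h2; rewrite ler_wpM2r//; move: sg1; lra.
split; last first.
  have : q * (1 - 4^-1) <= q * (1 - sg / 4) by rewrite ler_pM2l//; move: sg1; lra.
  by move: h3; lra.
have h4 : q * (1 - sg) <= q * ((1 - sg / 4) * (1 - sg / 2)).
  rewrite ler_pM2l//; have := sqr_ge0 sg; move: sg0.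
  have -> : (1 - sg / 4) * (1 - sg / 2) = 1 - 3 / 4 * sg + 8^-1 * sg ^+ 2 by field.
  lra.
apply: (le_trans h4); rewrite mulrA -[leRHS]mul1r ler_wpM2r//.
by move: sg1; lra.
Qed.

(** Since [lam <= b], the decay of [ep] outweighs the exponential weight. Trading [L] for [sg r]
    produces the factor [sg^2] that compensates the [5 / sg] of the contraction estimate. *)
Let forcing_window z0 :
  expR (2 * lam * T z0) * (a * (expR (- b * T z0) * e0) * L) ^+ 2 <=
    (sg * (a * r * e0)) ^+ 2 \/ T z0 < 0.
Proof.
have [Tz|Tz] := leP 0 (T z0); [left|by right].
have -> : expR (2 * lam * T z0) = expR (lam * T z0) ^+ 2.
  by rewrite -expRM_natr; congr expR; ring.
rewrite -exprMn ler_sqr ?nnegrE; last 2 first.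
- by rewrite !mulr_ge0 ?expR_ge0 ?eucl_ge0// ltW.
- by rewrite !mulr_ge0 ?eucl_ge0// ltW.
have -> : expR (lam * T z0) * (a * (expR (- b * T z0) * e0) * L) =
  (expR (lam * T z0) * expR (- b * T z0)) * (a * e0 * L) by ring.
rewrite -expRD -mulrDl.
apply: (@le_trans _ _ (1 * (a * e0 * L))).
  rewrite ler_wpM2r ?mulr_ge0 ?eucl_ge0 ?(ltW L0)// -expR0 ler_expR.
  by rewrite mulr_le0_ge0// subr_le0.
have -> : sg * (a * r * e0) = a * e0 * (sg * r) by ring.
by rewrite mul1r ler_wpM2l// mulr_ge0// eucl_ge0.
Qed.

Let T_ge0 z : dom z -> 0 <= T z.
Proof. by move=> dz; rewrite addr_ge0//; case: hdom => + _; apply. Qed.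

Let yE z0 z : y z = expR (2 * lam * (T z - T z0)) * (expR (2 * lam * T z0) * V z).
Proof. by rewrite /y mulrA -expRD -mulrDr subrK. Qed.

Let window_step z0 z1 : dom z0 -> dom z1 -> z0.1 <= z1.1 -> (z0.2 <= z1.2)%N ->
  D <= (z1.1 - z0.1) + (z1.2%:R - z0.2%:R) < D + 1 -> y z0 <= Y -> y z1 <= Y.
Proof.
move=> d0 d1 s01 j01 hD hy; set e := expR (- b * T z0) * e0.
have e_ge0 : 0 <= e by rewrite mulr_ge0 ?expR_ge0 ?eucl_ge0.
have hPE' : muE * eucl_norm (tht z0) ^+ 2 <=
    ((tht z0)^T *m hybrid_gramian E psi z0 z1 *m tht z0) 0 0.
  have := hPE d0 d1 hD (tht z0).
  by rewrite mulmxBr mulmxBl mxE [X in _ + X]mxE quadratic_form_scalar subr_ge0.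
have hL : z1.1 - z0.1 + (z1.2%:R - z0.2%:R) <= L by case/andP: hD => _ /ltW.
have hep z : dom z -> z0.1 <= z.1 <= z1.1 -> (z0.2 <= z.2 <= z1.2)%N ->
    eucl_norm (ep z) <= e.
  by move=> dz /andP[h1 _] /andP[h2 _]; exact: ep_window.
have sg01 : 0 < sg <= 1 by rewrite sg0.
have hV := window_contraction ea gc0 gd0 hpsi ha1 ha2 e_ge0 d0 d1 s01 j01 hep
  L0 hL m0 hm1 hm2 hE domE D0 (erefl : L = D + 1) sg01 hsg hPE'.
have dT : T z1 - T z0 <= L by move: hL; rewrite /T; lra.
have [q1 q2] := expR_window dT.
have := forcing_window z0 => -[|]; last by rewrite ltNge T_ge0.
rewrite -/e => hF.
rewrite (yE z0); set q := expR (2 * lam * (T z1 - T z0)) in q1 q2 *.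
have q0 : 0 <= q by exact: expR_ge0.
set w := expR (2 * lam * T z0) in hF *.
have w0 : 0 < w by exact: expR_gt0.
set B := a * r * e0 in hF *.
have h1 : w * V z1 <= (1 - sg) * y z0 + 5 / sg * (w * (a * e * L) ^+ 2).
  have -> : (1 - sg) * y z0 + 5 / sg * (w * (a * e * L) ^+ 2) =
    w * ((1 - sg) * V z0 + 5 / sg * (a * e * L) ^+ 2) by rewrite /y -/w; ring.
  by rewrite ler_pM2l.
have h2 : 5 / sg * (w * (a * e * L) ^+ 2) <= 5 * sg * B ^+ 2.
  apply: (@le_trans _ _ (5 / sg * (sg * B) ^+ 2)).
    by rewrite ler_wpM2l// divr_ge0// ltW.
  have -> : 5 / sg * (sg * B) ^+ 2 = 5 * sg * B ^+ 2 * (sg^-1 * sg) by ring.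
  by rewrite mulVf ?mulr1// gt_eqF.
have y00 : 0 <= y z0 by rewrite mulr_ge0 ?expR_ge0.
have B0 : 0 <= sg * B ^+ 2 by rewrite mulr_ge0 ?sqr_ge0// ltW.
have h3 : q * (w * V z1) <= q * ((1 - sg) * y z0 + 5 * sg * B ^+ 2).
  by rewrite ler_wpM2l//; apply: (le_trans h1); rewrite lerD2l.
apply: (le_trans h3).
have h4 : q * (1 - sg) * y z0 <= (1 - sg / 2) * y z0 by rewrite ler_wpM2r.
have h5 : q * (sg * B ^+ 2) <= 2 * (sg * B ^+ 2) by rewrite ler_wpM2r.
have h6 : (1 - sg / 2) * y z0 <= (1 - sg / 2) * Y.
  by rewrite ler_wpM2l//; move: sg1; lra.
have h7 : sg * Y = sg * y (0, 0%N) + 20 * (sg * B ^+ 2) by rewrite /Y -/B; ring.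
have h8 : 0 <= sg * y (0, 0%N) by rewrite mulr_ge0 ?(ltW sg0)// /y mulr_ge0 ?expR_ge0 ?V_ge0.
move: h4 h5 h6 h7 h8; lra.
Qed.

(** [k] bounds the number of windows still to be crossed, as each advances [t + j] by at least [D].
    What remains at the end is at most [L] long and may carry no excitation. *)
Let window_reach k z0 z : dom z0 -> dom z -> z0.1 <= z.1 -> (z0.2 <= z.2)%N ->
  T z - T z0 <= k%:R * D -> y z0 <= Y ->
  exists z1, [/\ dom z1, z1.1 <= z.1, (z1.2 <= z.2)%N, y z1 <= Y & T z - T z1 <= L].
Proof.
elim: k z0 => [|k IH] z0 d0 dz s0 j0 hk hy.
  exists z0; split => //; apply: (le_trans hk); rewrite mul0r; exact: ltW.
have [hD|/ltW hD] := leP D (T z - T z0); last first.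
  by exists z0; split => //; apply: (le_trans hD); rewrite lerDl.
have [|z1 [d1 /andP[s1 s1'] /andP[j1 j1'] hz1]] :=
    htd_crossing hdom d0 dz s0 j0 D0.
  by move: hD; rewrite /T; lra.
apply: (IH z1) => //; last exact: (window_step d0 d1).
by move: hk hz1; rewrite -[k.+1%:R]natr1 /T; lra.
Qed.

(** On the final incomplete window only the growth bound is available. Squaring the sum of two terms
    costs a factor 2 and the exponential weight another, so the bound is [4 Y + 4 B^2], and
    [84 = 4 * 20 + 4]. *)
Lemma tht_decay z : dom z ->
  expR (2 * lam * (z.1 + z.2%:R)) * eucl_norm (tht z) ^+ 2 <=
    4 * eucl_norm (tht (0, 0%N)) ^+ 2 + 84 * (a * r * eucl_norm (ep (0, 0%N))) ^+ 2.
Proof.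
move=> dz; have z0 : 0 <= z.1 by case: hdom => + _; apply.
have y0 : y (0, 0%N) = eucl_norm (tht (0, 0%N)) ^+ 2.
  by rewrite /y /T /= addr0 mulr0 expR0 mul1r.
have [||z1 [d1 s1 j1 hy dT]] := @window_reach (Num.bound (T z / D)) _ _
    (htd_origin hdom dz) dz z0 (leq0n _).
- rewrite {2}/T/= addr0 subr0 -ler_pdivrMr//.
  by apply/ltW/archi_boundP; rewrite divr_ge0 ?T_ge0// ltW.
- by rewrite /Y lerDl mulr_ge0// sqr_ge0.
set e := expR (- b * T z1) * e0.
have e_ge0 : 0 <= e by rewrite mulr_ge0 ?expR_ge0 ?eucl_ge0.
have hep z' : dom z' -> z1.1 <= z'.1 <= z.1 -> (z1.2 <= z'.2 <= z.2)%N ->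
    eucl_norm (ep z') <= e.
  by move=> dz' /andP[h1 _] /andP[h2 _]; exact: ep_window.
have hN := tht_growth_window ea gc0 gd0 hpsi ha1 ha2 e_ge0 d1 dz s1 j1 hep.
have {}hN : eucl_norm (tht z) <= eucl_norm (tht z1) + a * e * L.
  apply: (le_trans hN); rewrite lerD2l ler_wpM2l ?(mulr_ge0 a0 e_ge0)//.
  by move: dT; rewrite /T; lra.
have hV : V z <= 2 * V z1 + 2 * (a * e * L) ^+ 2.
  apply: (@le_trans _ _ ((eucl_norm (tht z1) + a * e * L) ^+ 2)).
    rewrite ler_sqr ?nnegrE ?eucl_ge0// addr_ge0 ?eucl_ge0//.
    by rewrite (mulr_ge0 (mulr_ge0 a0 e_ge0))// ltW.
  have := sqr_ge0 (eucl_norm (tht z1) - a * e * L); rewrite /V.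
  by move: (eucl_norm _) (a * e * L) => u v; rewrite sqrrB sqrrD; lra.
have [_ q2] := expR_window dT.
have := forcing_window z1 => -[|]; last by rewrite ltNge T_ge0.
rewrite -/e => hF.
rewrite -/(T z) -/(V z) -/(y z) (yE z1).
set q := expR (2 * lam * (T z - T z1)) in q2 *.
have q0 : 0 <= q by exact: expR_ge0.
set w := expR (2 * lam * T z1) in hF *.
have w0 : 0 < w by exact: expR_gt0.
rewrite -/e0; set B := a * r * e0 in hF *.
have h1 : w * V z <= 2 * y z1 + 2 * (w * (a * e * L) ^+ 2).
  have -> : 2 * y z1 + 2 * (w * (a * e * L) ^+ 2) =
    w * (2 * V z1 + 2 * (a * e * L) ^+ 2) by rewrite /y -/w; ring.
  by rewrite ler_pM2l.
have h2 : (sg * B) ^+ 2 <= B ^+ 2.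
  rewrite exprMn ler_piMl ?sqr_ge0// expr_le1//; exact: ltW.
have h3 : q * (w * V z) <= 2 * (w * V z).
  by rewrite ler_wpM2r// mulr_ge0 ?V_ge0// ltW.
have hY : Y = eucl_norm (tht (0, 0%N)) ^+ 2 + 20 * B ^+ 2 by rewrite /Y y0.
move: h1 h2 h3 hF hy; rewrite hY; lra.
Qed.

End Iteration.

(** * Explicit constants *)

Section Constants.
Context {R : realType}.
Context (g : gains R) (c : bounds R).
Hypotheses (gc0 : 0 < gamma_c g) (lc0 : 0 < lambda_c g) (gd0 : 0 < gamma_d g)
  (ld02 : 0 < lambda_d g < 2).
Hypotheses (phiM0 : 0 < phi_M c) (D0 : 0 < Delta c) (mu0 : 0 < mu c)
  (psi00 : 0 <= psi_0 c) (qm0 : 0 < q_m c) (qmM : q_m c <= q_M c)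
  (zeta01 : 0 < zeta c < 1).

Let ld := lambda_d g.
Let ell := ld * (2 - ld).

Let ellE : ell = 1 - (1 - ld) ^+ 2.
Proof. by rewrite /ell; ring. Qed.

Let ell_gt0 : 0 < ell.
Proof. by case/andP: ld02 => l0 l2; rewrite mulr_gt0// subr_gt0. Qed.

Lemma psi_M_flow : phi_M c / lambda_c g <= psi_M g c.
Proof.
apply: (@le_trans _ _ (Num.max (lambda_c g)^-1 (Num.sqrt (2 * ell + 16) / ell) * phi_M c)).
  by rewrite mulrC ler_pM2r// le_max lexx.
by rewrite /psi_M lerDr.
Qed.

(** With [q = |1 - lambda_d|] the claim is [phi_M <= (1 - q) psi_M]. Since [ell = (1 - q) (1 + q)]
    and the square root is at least 4, the coefficient of [phi_M] in [psi_M], multiplied by [1 - q],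
    is at least [4 / (1 + q) >= 1]. *)
Lemma psi_M_jump : `|1 - lambda_d g| * psi_M g c + phi_M c <= psi_M g c.
Proof.
rewrite -/ld; set q := `|1 - ld|.
have q0 : 0 <= q by exact: normr_ge0.
have ellq : ell = (1 - q) * (1 + q).
  by rewrite ellE /q -[(1 - ld) ^+ 2]real_normK ?num_real//; ring.
have q1 : 0 < 1 - q.
  by move: ell_gt0; rewrite ellq pmulr_lgt0// ltr_wpDr.
rewrite -lerBrDl -[X in X - _]mul1r -mulrBl /psi_M -/ell.
set B := Num.max _ _.
have hB : 4 / ell <= B.
  rewrite /B le_max; apply/orP; right; rewrite ler_pM2r ?invr_gt0//.
  rewrite -[4]ger0_norm// -sqrtr_sqr ler_wsqrtr//.
  have -> : 4 ^+ 2 = 16 :> R by rewrite -natrX.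
  by rewrite lerDr mulr_ge0// ltW.
have hB1 : 1 <= (1 - q) * B.
  have e1 : (1 - q) * (4 / ell) = 4 / (1 + q).
    have h1 : 1 - q != 0 by rewrite gt_eqF.
    have h2 : 1 + q != 0 by rewrite gt_eqF// ltr_wpDr.
    by rewrite ellq; field; rewrite h1 h2.
  apply: (@le_trans _ _ (4 / (1 + q))).
    by rewrite ler_pdivlMr ?ltr_wpDr// mul1r; move: q1; lra.
  by rewrite -e1 ler_pM2l.
rewrite mulrDr mulrA; apply: (@le_trans _ _ (1 * phi_M c)); first by rewrite mul1r.
by rewrite -[leLHS]add0r lerD ?mulr_ge0 ?(ltW q1)// ler_pM2r.
Qed.

Lemma psi_0_le : psi_0 c <= psi_M g c.
Proof.
rewrite /psi_M lerDl mulr_ge0 ?(ltW phiM0)// le_max invr_ge0 (ltW lc0)//.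
Qed.

Let psiM := psi_M g c.
Let psiM0 : 0 <= psiM. Proof. exact: le_trans psi_0_le. Qed.
Let m := Num.min (gamma_c g) (2 * (gamma_d g + psiM ^+ 2))^-1.
Let Q := (1 + Num.sqrt ((a_M g c + 2) * (Delta c + 2) ^+ 3 *
                 (a_M g c * (Delta c + 2) + 2^-1))) ^+ 2.

Let m_gt0 : 0 < m.
Proof. by rewrite lt_min gc0 invr_gt0 mulr_gt0// ltr_wpDr// sqr_ge0. Qed.

Let Q_gt0 : 0 < Q.
Proof. by rewrite exprn_gt0// ltr_wpDr// sqrtr_ge0. Qed.

Lemma sigmaE : sigma g c * Q = 2 * (m * mu c).
Proof. by rewrite /sigma -/Q mulfVK// gt_eqF. Qed.

Lemma sigma_gt0 : 0 < sigma g c.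
Proof. by rewrite divr_gt0// mulr_gt0// mulr_gt0. Qed.

Lemma b_rateP : [/\ 0 < b_rate g, b_rate g <= lambda_c g &
  (1 - lambda_d g) ^+ 2 * expR (2 * b_rate g) <= 1].
Proof.
rewrite /b_rate -/ld -/ell.
have -> : 1 - ell = (1 - ld) ^+ 2 by rewrite ellE; ring.
(* For [lambda_d = 1] a jump erases [ep], the logarithm contributes [+oo], and the minimum is
   [lambda_c]. *)
have [->|ld1] := eqVneq ((1 - ld) ^+ 2) 0.
  rewrite le0_lneNy ?lexx//= (min_idPl _) ?leey//= mul0r; split => //.
    by rewrite mulr_gt0// invr_gt0.
  by move: lc0; lra.
have x0 : 0 < (1 - ld) ^+ 2 by rewrite lt_neqAle eq_sym ld1 sqr_ge0.
have x1 : (1 - ld) ^+ 2 < 1 by move: ell_gt0; rewrite ellE subr_gt0.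
rewrite lne_EFin//= -EFin_min/=.
set M := Num.min _ _.
have M0 : 0 < M by rewrite lt_min lc0 oppr_gt0 ln_lt0// x0.
have Ml : M <= lambda_c g by rewrite ge_min lexx.
have Mx : M <= - ln ((1 - ld) ^+ 2) by rewrite ge_min lexx orbT.
split; [by rewrite mulr_gt0// invr_gt0|by move: M0 Ml; lra|].
rewrite mulrA divff// mul1r -[X in X * _]lnK ?posrE// -expRD -[leRHS]expR0 ler_expR.
by rewrite addrC -lerBrDr sub0r.
Qed.

Hypothesis sg1 : sigma g c < 1.
Let sg := sigma g c.
Let r := p_M g c / p_m c.

Let sg0 : 0 < sg := sigma_gt0.
Let sg1' : 0 < 1 - sg. Proof. by rewrite subr_gt0. Qed.

Let kappa0_sqr : kappa_0 g c ^+ 2 = (1 - sg)^-1.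
Proof. by rewrite /kappa_0 sqr_sqrtr div1r// invr_ge0 ltW. Qed.

Let lnsg : 0 < - ln (1 - sg) <= sg / (1 - sg).
Proof.
rewrite oppr_gt0 ln_lt0 ?sg1' ?ltrBlDr ?ltrDl//= -lnV ?posrE//.
have e : (1 - sg)^-1 = 1 + sg / (1 - sg).
  have h : 1 - sg != 0 by rewrite gt_eqF.
  by field.
rewrite [X in ln X]e; apply: le_ln1Dx; apply: (@lt_le_trans _ _ 0) => //.
by rewrite divr_ge0// ltW.
Qed.

(** The first and third summands of [p_M] are each at least [q_m]. In the second,
    [kappa_0^2 / (2 lambda_0)] equals [(Delta + 1) / ((1 - sg) (- ln (1 - sg)))], and
    [- ln (1 - sg) <= sg / (1 - sg)]. Thus [r = p_M / p_m] dominates the ratio of window length to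
    contraction required by the iteration. *)
Lemma p_M_ge : q_m c * ((Delta c + 1) / sg + 2) <= p_M g c.
Proof.
case/andP: lnsg => ln0 lnle.
have L0 : 0 < Delta c + 1 by rewrite ltr_wpDl// ltW.
have lam0 : 0 < lambda_0 g c by rewrite divr_gt0// mulr_gt0.
rewrite /p_M; set e2 := expR _.
have e21 : 1 < e2 by rewrite -expR0 ltr_expR mulr_gt0.
have k0 : 1 <= kappa_0 g c ^+ 2.
  rewrite kappa0_sqr -[leLHS]invr1 lef_pV2 ?posrE// gerDl oppr_le0; exact: ltW.
have qM0 : 0 < q_M c by exact: lt_le_trans qmM.
have h1 : q_m c * ((Delta c + 1) / sg) <=
    q_M c * kappa_0 g c ^+ 2 / (2 * lambda_0 g c).
  rewrite -mulrA; apply: ler_pM => //; first exact: ltW.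
    by rewrite divr_ge0// ltW.
  rewrite kappa0_sqr /lambda_0 -/sg.
  have lne0 : ln (1 - sg) != 0 by rewrite lt_eqF// -oppr_gt0.
  have sgn0 : 1 - sg != 0 by rewrite gt_eqF.
  have Ln0 : Delta c + 1 != 0 by rewrite gt_eqF.
  have -> : (1 - sg)^-1 / (2 * (- ln (1 - sg) / (2 * (Delta c + 1)))) =
     (Delta c + 1) / ((1 - sg) * - ln (1 - sg)).
    by field; rewrite lne0 sgn0 Ln0.
  rewrite ler_pM2l// lef_pV2 ?posrE//; last by rewrite mulr_gt0.
  by rewrite mulrC -ler_pdivlMr.
have h2 : q_m c <= q_M c * kappa_0 g c ^+ 2 * e2 / (e2 - 1).
  rewrite -mulrA -mulrA -[leLHS]mulr1; apply: ler_pM => //; first exact: ltW.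
  rewrite -[leLHS]mulr1; apply: ler_pM => //.
  by rewrite ler_pdivlMr ?subr_gt0// mul1r gerDl oppr_le0.
rewrite mulrDr; move: h1 h2; lra.
Qed.

Let r_ge : (Delta c + 1) / sg + 2 <= r.
Proof. by rewrite /r ler_pdivlMr// mulrC p_M_ge. Qed.

Let r_ge2 : 2 <= r.
Proof.
apply: le_trans r_ge; rewrite lerDr divr_ge0//; last exact: ltW.
by rewrite addr_ge0// ltW.
Qed.

Let p_M_gt0 : 0 < p_M g c.
Proof.
by have := lt_le_trans (ltr0Sn R 1) r_ge2; rewrite /r pmulr_lgt0// invr_gt0.
Qed.

Let omegaP : 0 < omega g c /\ omega g c <= (4 * r)^-1.
Proof.
case/andP: zeta01 => z0 z1; rewrite /omega; set d := q_m c / _ * _.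
have dE : d = (1 - zeta c) / (2 * r).
  have h1 : p_M g c != 0 by rewrite gt_eqF.
  have h2 : q_m c != 0 by rewrite gt_eqF.
  by rewrite /d /r /p_m; field; rewrite h1 h2.
have r0 : 0 < r by exact: lt_le_trans r_ge2.
have d0 : 0 < d by rewrite dE divr_gt0 ?subr_gt0// mulr_gt0.
have dr : d <= (2 * r)^-1.
  have i0 : 0 <= (2 * r)^-1 by rewrite invr_ge0 mulr_ge0// ltW.
  by rewrite dE ler_piMl// gerDl oppr_le0 ltW.
have d1 : d < 1.
  apply: (le_lt_trans dr); have r20 : 0 < 2 * r by rewrite mulr_gt0.
  rewrite -[ltRHS]invr1 ltf_pV2 ?posrE//.
  by move: r_ge2; lra.
split.
  rewrite mulr_gt0 ?invr_gt0// lt_min d0 oppr_gt0 ln_lt0// subr_gt0 d1 /=.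
  by rewrite gtrDl oppr_lt0.
have -> : (4 * r)^-1 = 2^-1 * (2 * r)^-1.
  by rewrite -invfM; congr (_^-1); ring.
by rewrite ler_pM2l ?invr_gt0//; apply: le_trans dr; rewrite ge_min lexx.
Qed.

(** [lambda_g] is at most half of [omega], hence at most [1 / (8 r)]; as [r >= (Delta + 1) / sg],
    this is exactly the smallness of the rate that the iteration demands. *)
Lemma lambda_gP : [/\ 0 < lambda_g g c, lambda_g g c <= b_rate g &
  lambda_g g c * (Delta c + 1) <= sg / 8].
Proof.
have [om0 omr] := omegaP; have [b0 _ _] := b_rateP.
have r0 : 0 < r by exact: lt_le_trans r_ge2.
split; first by rewrite lt_min b0 andbT mulr_gt0 ?invr_gt0// lt_min om0.
  by rewrite ge_min lexx orbT.
have h1 : lambda_g g c <= 2^-1 * (4 * r)^-1.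
  apply: (@le_trans _ _ (lambda_r g c)); first by rewrite ge_min lexx.
  rewrite ler_pM2l ?invr_gt0//; apply: le_trans omr; by rewrite ge_min lexx.
have L0 : 0 < Delta c + 1 by rewrite ltr_wpDl// ltW.
apply: (@le_trans _ _ (2^-1 * (4 * r)^-1 * (Delta c + 1))).
  by rewrite ler_pM2r.
have -> : 2^-1 * (4 * r)^-1 * (Delta c + 1) = (Delta c + 1) / (8 * r).
  have rn : r != 0 by rewrite gt_eqF.
  by field.
have r8 : 0 < 8 * r by rewrite mulr_gt0.
rewrite ler_pdivrMr//.
have -> : sg / 8 * (8 * r) = r * sg by field.
rewrite -ler_pdivrMr//; apply: le_trans r_ge; by rewrite lerDl.
Qed.

Hypothesis pM1 : 1 <= p_M g c.

Let a := a_gain g c.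
Let a_ge0 : 0 <= a.
Proof. by rewrite /a le_max mulr_ge0// ltW. Qed.

(** [rho^2 r = (p_M / zeta) (4 r^4 + 2 r^3)]. All factors but [p_M] depend only on ratios and
    [zeta], so this is where the normalization [1 <= p_M] enters. *)
Let rho_ge : 2 * r ^+ 2 <= rho g c * Num.sqrt r.
Proof.
case/andP: zeta01 => z0 z1; have r0 : 0 < r by exact: lt_le_trans r_ge2.
rewrite /rho -sqrtrM; last first.
  rewrite mulr_ge0//.
    by rewrite divr_ge0 ?mulr_ge0 ?exprn_ge0 ?(ltW p_M_gt0) ?(ltW qm0) ?(ltW z0).
  by rewrite addr_ge0// divr_ge0 ?mulr_ge0 ?(ltW p_M_gt0) ?(ltW qm0).
have l0 : 0 <= 2 * r ^+ 2 by rewrite mulr_ge0// exprn_ge0// ltW.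
rewrite -[leLHS](ger0_norm l0) -sqrtr_sqr.
apply: ler_wsqrtr.
have -> : 2 * p_M g c ^+ 3 / (q_m c * p_m c * zeta c) * (2 * p_M g c / q_m c + 1) * r =
  (p_M g c / zeta c) * (2 * r ^+ 3 * (2 * r + 1)).
  have h1 : zeta c != 0 by rewrite gt_eqF.
  have h2 : q_m c != 0 by rewrite gt_eqF.
  by rewrite /r /p_m; field; rewrite h1 h2.
apply: (@le_trans _ _ (1 * (2 * r ^+ 3 * (2 * r + 1)))).
  rewrite mul1r; have -> : 2 * r ^+ 3 * (2 * r + 1) = (2 * r ^+ 2) ^+ 2 + 2 * r ^+ 3 by ring.
  by rewrite lerDl mulr_ge0// exprn_ge0// ltW.
rewrite ler_wpM2r//.
  have r3 : 0 <= r ^+ 3 by rewrite exprn_ge0// ltW.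
  by rewrite mulr_ge0 ?(mulr_ge0 _ r3)// addr_ge0// mulr_ge0// ltW.
rewrite ler_pdivlMr// mul1r; apply: le_trans pM1; exact: ltW.
Qed.

Let kappa_ge : 2 * r <= kappa_r g c /\ 4 * a * r ^+ 2 <= kappa_r g c.
Proof.
rewrite /kappa_r -/r -/a; split; first by rewrite ler_pM2l// le_max lexx.
have -> : 4 * a * r ^+ 2 = 2 * (a * (2 * r ^+ 2)) by ring.
rewrite ler_pM2l// le_max; apply/orP; right.
by rewrite -mulrA ler_wpM2l.
Qed.

Lemma kappa_g_gt0 : 0 < kappa_g g c.
Proof.
rewrite mulr_gt0 ?sqrtr_gt0//; apply: lt_le_trans kappa_ge.1.
by rewrite mulr_gt0//; exact: lt_le_trans r_ge2.
Qed.

(** Since [r >= 2], both [4] and [8 a r] are at most [kappa_r]. Hence [4 N0^2], [84 (a r E0)^2] and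
    the contribution of [E] together stay below [3 kappa_r^2 (N0^2 + E0^2)], which accounts for the
    factor [sqrt 3] in [kappa_g]. *)
Lemma decay_combine (N0 E0 N E t : R) : 0 <= E0 -> 0 <= t -> 0 <= N -> 0 <= E ->
  expR (2 * lambda_g g c * t) * N ^+ 2 <= 4 * N0 ^+ 2 + 84 * (a * r * E0) ^+ 2 ->
  E <= expR (- b_rate g * t) * E0 ->
  Num.sqrt (N ^+ 2 + E ^+ 2) <=
    kappa_g g c * expR (- lambda_g g c * t) * Num.sqrt (N0 ^+ 2 + E0 ^+ 2).
Proof.
move=> E00 t0 N_0 E_0 hN hE; have [lam0 lamb _] := lambda_gP.
set k := kappa_r g c; have [k1 k2] := kappa_ge; rewrite -/k in k1 k2.
have r0 : 0 < r by exact: lt_le_trans r_ge2.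
have k0 : 0 < k by apply: lt_le_trans k1; rewrite mulr_gt0.
set w := expR (2 * lambda_g g c * t) in hN *.
have w0 : 0 < w by exact: expR_gt0.
have hE2 : w * E ^+ 2 <= E0 ^+ 2.
  apply: (@le_trans _ _ (w * (expR (- b_rate g * t) * E0) ^+ 2)).
    by rewrite ler_pM2l// ler_sqr ?nnegrE// mulr_ge0 ?expR_ge0.
  rewrite exprMn mulrA -expRM_natr /w -expRD ler_piMl ?sqr_ge0// -[leRHS]expR0 ler_expR.
  have : lambda_g g c * t <= b_rate g * t by rewrite ler_wpM2r.
  lra.
have hk1 : 16 <= k ^+ 2.
  have -> : 16 = 4 ^+ 2 :> R by rewrite -natrX.
  rewrite ler_sqr ?nnegrE ?(ltW k0)//; apply: le_trans k1; move: r_ge2; lra.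
have hk2 : 64 * (a * r) ^+ 2 <= k ^+ 2.
  have -> : 64 * (a * r) ^+ 2 = (8 * (a * r)) ^+ 2 by ring.
  have ar0 : 0 <= a * r by rewrite mulr_ge0// ltW.
  have ar8 : 0 <= 8 * (a * r) by rewrite mulr_ge0.
  rewrite ler_sqr ?nnegrE ?(ltW k0)//.
  apply: le_trans k2; have -> : 4 * a * r ^+ 2 = 4 * (a * r) * r by ring.
  have : a * r * 2 <= a * r * r by rewrite ler_wpM2l.
  lra.
have main : w * (N ^+ 2 + E ^+ 2) <= 3 * k ^+ 2 * (N0 ^+ 2 + E0 ^+ 2).
  have h1 : 16 * N0 ^+ 2 <= k ^+ 2 * N0 ^+ 2 by rewrite ler_wpM2r ?sqr_ge0.
  have h2 : 16 * E0 ^+ 2 <= k ^+ 2 * E0 ^+ 2 by rewrite ler_wpM2r ?sqr_ge0.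
  have h3 : 64 * (a * r) ^+ 2 * E0 ^+ 2 <= k ^+ 2 * E0 ^+ 2.
    by rewrite ler_wpM2r ?sqr_ge0.
  have h4 := sqr_ge0 N0; have h5 := sqr_ge0 E0.
  move: hN hE2 h1 h2 h3 h4 h5; rewrite exprMn mulrDr; lra.
rewrite -ler_sqr ?nnegrE; last 2 first.
- exact: sqrtr_ge0.
- by rewrite mulr_ge0 ?sqrtr_ge0// mulr_ge0 ?expR_ge0// ltW// kappa_g_gt0.
have s0 x y : 0 <= x ^+ 2 + y ^+ 2 :> R by rewrite addr_ge0 ?sqr_ge0.
have -> : (kappa_g g c * expR (- lambda_g g c * t) * Num.sqrt (N0 ^+ 2 + E0 ^+ 2)) ^+ 2 =
    3 * k ^+ 2 * (N0 ^+ 2 + E0 ^+ 2) * expR (- lambda_g g c * t * 2).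
  rewrite expRM_natr /kappa_g -/k !exprMn !sqr_sqrtr//; ring.
rewrite sqr_sqrtr// -(ler_pM2l w0); apply: (le_trans main).
rewrite [leRHS]mulrCA /w -expRD.
have -> : 2 * lambda_g g c * t + - lambda_g g c * t * 2 = 0 by ring.
by rewrite expR0 mulr1.
Qed.

Lemma explicit_exp_bound n p m' (E : set (R * nat)) (P : plant R n p m') :
  hybrid_time_domain E ->
  (forall z, E z -> frob_norm (phi_c P z) <= phi_M c) ->
  (forall z, Upsilon E z -> frob_norm (phi_d P z) <= phi_M c) ->
  exp_bound E P g (psi_0 c) (Delta c) (mu c) (kappa_g g c) (lambda_g g c).
Proof.
move=> hE hc hd dom xi sol [_ x0] pe t j dz.
have ea := sol_error_arc sol hc hd; have domE := sol_subset sol.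
have hpsi z : dom z -> induced_norm (st_psi (xi z)) <= psiM.
  move=> dz'; apply: (le_trans (induced_le_frob _)).
  apply: (psi_bound ea lc0 psi_M_flow psi_M_jump _ dz').
  exact: le_trans psi_0_le.
have ha1 : gamma_c g * psiM <= a by rewrite le_max lexx.
have ha2 : (2 * Num.sqrt (gamma_d g))^-1 <= a by rewrite le_max lexx orbT.
have hm1 : m <= gamma_c g by rewrite ge_min lexx.
have hm2 : m <= (2 * (gamma_d g + psiM ^+ 2))^-1 by rewrite ge_min lexx orbT.
have [b0 hb hbd] := b_rateP; have [lam0 lamb hlam] := lambda_gP.
have hr : (Delta c + 1) / sg <= r by apply: le_trans r_ge; rewrite lerDl.
have t0 : 0 <= t by case: (ea_dom ea) => /(_ (t, j) dz).
have h1 := tht_decay ea gc0 gd0 hpsi ha1 ha2 m_gt0 hm1 hm2 hE domE D0 sg0 (ltW sg1)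
  sigmaE pe (ltW b0) hb hbd (ltW lam0) lamb hlam hr dz.
have h2 := ep_decay_origin ea hb hbd dz.
apply: decay_combine h1 h2; rewrite ?eucl_ge0//.
by rewrite addr_ge0.
Qed.

End Constants.

(** * Lowering the excitation level until [sigma < 1] *)

Section Rescaling.
Context {R : realType}.

Lemma exp_bound_weaken_mu n p m (E : set (R * nat)) (P : plant R n p m) (g : gains R)
    (psi0 Delta mu' mu kappa lambda : R) : mu' <= mu ->
  exp_bound E P g psi0 Delta mu' kappa lambda ->
  exp_bound E P g psi0 Delta mu kappa lambda.
Proof.
move=> hmu h dom xi sol x0 pe; apply: h => // z' zs dz' dzs hd v.
have {pe} := pe z' zs dz' dzs hd v; set G := hybrid_gramian _ _ _ _ => hG.
have -> : G - mu'%:M = (G - mu%:M) + (mu - mu')%:M.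
  by rewrite raddfB/= addrA subrK.
by rewrite quadratic_formD quadratic_form_scalar addr_ge0// mulr_ge0 ?sqr_ge0// subr_ge0.
Qed.

(** [sigma] is linear in [mu], so dividing [mu] by [1 + s] turns the value [s] into
    [s / (1 + s)]. *)
Lemma exists_mu_sigma_lt1 (g : gains R) (phi_M Delta mu psi_0 q_m q_M zeta : R) :
  0 < mu -> 0 < sigma g (Bounds phi_M Delta mu psi_0 q_m q_M zeta) ->
  exists mu', [/\ 0 < mu', mu' <= mu &
    sigma g (Bounds phi_M Delta mu' psi_0 q_m q_M zeta) < 1].
Proof.
move=> mu0; set s := sigma _ _ => s0.
have s10 : 0 < 1 + s by rewrite ltr_wpDr// ltW.
exists (mu / (1 + s)); split; first exact: divr_gt0.
  by rewrite ler_pdivrMr// ler_peMr ?(ltW mu0)// lerDl ltW.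
have -> : sigma g (Bounds phi_M Delta (mu / (1 + s)) psi_0 q_m q_M zeta) = s / (1 + s).
  rewrite /s /sigma /mu_0 /psi_M /a_M/=.
  by move: (1 + _)^-1 => i; ring.
by rewrite ltr_pdivrMr// mul1r ltrDr.
Qed.

End Rescaling.

Theorem theorem5p1 (R : realType) (n p m : nat) (E : set (R * nat))
    (P : plant R n p m) (g : gains R) (phi_M Delta mu : R)
    (hE : hybrid_time_domain E)
    (hf : continuous (fun w : 'cV[R]_n * 'cV[R]_m => f_c P w.1 w.2))
    (hg : continuous (fun w : 'cV[R]_n * 'cV[R]_m => g_d P w.1 w.2))
    (hgamma_c : 0 < gamma_c g) (hlambda_c : 0 < lambda_c g)
    (hgamma_d : 0 < gamma_d g) (hlambda_d : 0 < lambda_d g < 2)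
    (hphi_M : 0 < phi_M)
    (hphi_c : forall z, E z -> frob_norm (phi_c P z) <= phi_M)
    (hphi_d : forall z, Upsilon E z -> frob_norm (phi_d P z) <= phi_M)
    (hDelta : 0 < Delta) (hmu : 0 < mu)
    (psi_0 q_m q_M zeta : R)
    (hpsi_0 : 0 <= psi_0) (hq_m : 0 < q_m) (hq_M : q_m <= q_M)
    (hzeta : 0 < zeta < 1) :
  (exists kappa lambda : R,
     [/\ 0 < kappa, 0 < lambda & exp_bound E P g psi_0 Delta mu kappa lambda])
  /\
  let c := Bounds phi_M Delta mu psi_0 q_m q_M zeta in
  (* [sigma < 1] is the condition for kappa_0 and lambda_0 to be defined;
     [1 <= p_M] normalizes the scale of (q_m, q_M), on which rho depends *)
  (sigma g c < 1 -> 1 <= p_M g c ->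
   [/\ 0 < kappa_g g c, 0 < lambda_g g c &
       exp_bound E P g psi_0 Delta mu (kappa_g g c) (lambda_g g c)]).
Proof.
have main mu' qm' qM' : 0 < mu' -> 0 < qm' -> qm' <= qM' ->
    let c := Bounds phi_M Delta mu' psi_0 qm' qM' zeta in
    sigma g c < 1 -> 1 <= p_M g c ->
    [/\ 0 < kappa_g g c, 0 < lambda_g g c &
        exp_bound E P g psi_0 Delta mu' (kappa_g g c) (lambda_g g c)].
  move=> mu0 qm0 qmM c sg1 pM1; split.
  - exact: kappa_g_gt0.
  - by have [] := @lambda_gP _ g c hgamma_c hlambda_c hgamma_d hlambda_d hDelta
      mu0 qm0 qmM hzeta sg1.
  - exact: (@explicit_exp_bound _ g c).
split; last exact: main.
have sg0 mu' : 0 < mu' -> 0 < sigma g (Bounds phi_M Delta mu' psi_0 1 1 zeta).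
  by move=> mu0; exact: sigma_gt0.
(* For the existence claim the parameters are free: [mu] is lowered until [sigma < 1], and
   [q_m = q_M = 1] gives [p_M >= 2] by [p_M_ge]. The bound obtained carries over because excitation
   at level [mu] implies it at level [mu']. *)
have [mu' [mu0 mule sg1]] := exists_mu_sigma_lt1 hmu (sg0 mu hmu).
have pM1 : 1 <= p_M g (Bounds phi_M Delta mu' psi_0 1 1 zeta).
  have := @p_M_ge _ g (Bounds phi_M Delta mu' psi_0 1 1 zeta) hgamma_c hgamma_d
    hDelta mu0 ltr01 (lexx _) sg1.
  apply: le_trans; rewrite mul1r -[leLHS]add0r lerD//; last by rewrite ler1n.
  by rewrite divr_ge0 ?addr_ge0// ltW// sg0.
have [k0 l0 hb] := main mu' 1 1 mu0 ltr01 (lexx _) sg1 pM1.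
exists (kappa_g g (Bounds phi_M Delta mu' psi_0 1 1 zeta)).
exists (lambda_g g (Bounds phi_M Delta mu' psi_0 1 1 zeta)); split => //.
exact: exp_bound_weaken_mu hb.
Qed.
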